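(* There exists an absolute constant $c>0$ such that the following holds for every $n\ge 1$. Let $\Omega\subseteq\mathbb{R}^n$ be a bounded convex domain with piecewise smooth boundary. For any natural number $k\geq 2$ we have $$\operatorname{inrad}(\Omega)\leq c\,\frac{n\log k\,\sqrt{\lambda^N_{k-1}(B_1)}}{\sqrt{\lambda^N_k(\Omega)}},$$ where $B_1$ is a unit ball in $\mathbb{R}^n$.
   Context: For a bounded domain $\Omega\subset\mathbb{R}^n$ with piecewise smooth boundary, $0=\lambda_0^N(\Omega)<\lambda_1^N(\Omega)\leq\lambda_2^N(\Omega)\leq\cdots\leq\lambda_k^N(\Omega)\leq\cdots$ denote the Neumann eigenvalues of the (positive) Laplacian on $\Omega$, listed in increasing order, counted with multiplicity, and indexed from $0$. $\operatorname{inrad}(\Omega)$ is the inner radius of $\Omega$, i.e. the supremum of the radii of balls contained in $\Omega$. ''Absolute constant'' means a constant independent of everything (of $n$, $k$, $\Omega$). $\log$ is the natural logarithm. *)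

(* Defs.v *)
From HB Require Import structures.
From mathcomp Require Import all_boot all_order all_algebra.
From mathcomp Require Import all_classical all_reals all_analysis.

Set Implicit Arguments.
Unset Strict Implicit.
Unset Printing Implicit Defensive.
Import Order.TTheory GRing.Theory Num.Theory.
Import numFieldNormedType.Exports.

Local Open Scope classical_set_scope.
Local Open Scope ring_scope.

Section rV_measurable.
Variables (R : realType) (n : nat).

Let coord : 'I_n -> 'rV[R]_n -> measurableTypeR R := fun i x => x 0 i.

Let rV_set0 : g_sigma_preimage coord set0.
Proof. exact: sigma_algebra0. Qed.

Let rV_setC A : g_sigma_preimage coord A -> g_sigma_preimage coord (~` A).
Proof. exact: sigma_algebraC. Qed.

Let rV_bigcup (F : (set 'rV[R]_n)^nat) :
  (forall i, g_sigma_preimage coord (F i)) ->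
  g_sigma_preimage coord (\bigcup_i (F i)).
Proof. exact: sigma_algebra_bigcup. Qed.

(* The sigma-algebra generated by the coordinates, i.e. the Borel one. *)
HB.instance Definition _ := @isMeasurable.Build default_measure_display
  'rV[R]_n (g_sigma_preimage coord) rV_set0 rV_setC rV_bigcup.

End rV_measurable.

Section lebesgue_rV.
Variable R : realType.

Lemma measurable_rV_coord n (i : 'I_n) :
  measurable_fun [set: 'rV[R]_n] (fun x => x 0 i : measurableTypeR R).
Proof.
move=> _ Y mY; rewrite setTI; apply: sub_sigma_algebra => /=.
rewrite -bigcup_seq/=; exists i => /=; first by rewrite mem_index_enum.
by exists Y => //; rewrite setTI.
Qed.

Lemma measurable_fun_rVP d (T : measurableType d) n (f : T -> 'rV[R]_n) :
  (forall i, measurable_fun [set: T] (fun x => f x 0 i : measurableTypeR R)) ->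
  measurable_fun [set: T] f.
Proof.
move=> mf; suff H : measurable `<=` [set A | measurable (f @^-1` A)].
  by move=> _ A mA; rewrite setTI; exact: H.
apply: smallest_sub.
  split => /=.
  - by rewrite preimage_set0.
  - by move=> A mA; rewrite setTD preimage_setC; exact: measurableC.
  - by move=> F mF; rewrite preimage_bigcup; exact: bigcup_measurable.
rewrite -bigcup_seq/=; apply: bigcup_sub => i _ _ [B mB <-] /=.
have := mf i measurableT B mB.
by rewrite !setTI.
Qed.

Definition consrV n (p : measurableTypeR R * 'rV[R]_n) : 'rV[R]_n.+1 :=
  \row_i (if unlift ord0 i is Some j then p.2 0 j else p.1).

Definition unconsrV n (v : 'rV[R]_n.+1) : measurableTypeR R * 'rV[R]_n :=
  (v 0 0, \row_j v 0 (lift ord0 j)).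

Lemma consrV0 n p : @consrV n p 0 0 = p.1.
Proof. by rewrite mxE unlift_none. Qed.

Lemma consrVS n p j : @consrV n p 0 (lift ord0 j) = p.2 0 j.
Proof. by rewrite mxE liftK. Qed.

Lemma consrVK n : cancel (@consrV n) (@unconsrV n).
Proof.
move=> [x v]; rewrite /unconsrV consrV0/=; congr pair.
by apply/rowP => j; rewrite mxE consrVS.
Qed.

Lemma measurable_consrV n : measurable_fun setT (@consrV n).
Proof.
apply: measurable_fun_rVP => i.
case: (unliftP ord0 i) => [j|] ->; last first.
  by rewrite (_ : (fun _ => _) = fst)//; apply/funext => p; rewrite consrV0.
rewrite (_ : (fun _ => _) =
  (fun v : 'rV[R]_n => v 0 j : measurableTypeR R) \o snd).
  by apply: measurableT_comp => //; exact: measurable_rV_coord.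
by apply/funext => p /=; rewrite consrVS.
Qed.

Lemma measurable_unconsrV n : measurable_fun setT (@unconsrV n).
Proof.
apply/measurable_fun_pairP; split; first exact: measurable_rV_coord.
apply: measurable_fun_rVP => j.
rewrite (_ : (fun _ => _) =
  (fun v : 'rV[R]_n.+1 => v 0 (lift ord0 j) : measurableTypeR R)).
  exact: measurable_rV_coord.
by apply/funext => v /=; rewrite mxE.
Qed.

Section step.
Variables (n : nat) (m : {sigma_finite_measure set 'rV[R]_n -> \bar R}).

Definition lebesgue_rV_step : set 'rV[R]_n.+1 -> \bar R :=
  pushforward (@lebesgue_measure R \x m)%E (@consrV n).

Let step0 : lebesgue_rV_step set0 = 0%E.
Proof. by rewrite /lebesgue_rV_step /pushforward preimage_set0 measure0. Qed.

Let step_ge0 A : (0 <= lebesgue_rV_step A)%E.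
Proof. exact: (measure_ge0 (@lebesgue_measure R \x m)%E). Qed.

Let step_additive : semi_sigma_additive lebesgue_rV_step.
Proof.
pose p : {measure set (measurableTypeR R * 'rV[R]_n)%type -> \bar R} :=
  (@lebesgue_measure R \x m)%E.
have mp : measurable_fun setT (@consrV n) := @measurable_consrV n.
exact: (@measure_semi_sigma_additive _ _ _
  (measure_function_pushforward__canonical__measure_function_Measure p mp)).
Qed.

HB.instance Definition _ := isMeasure.Build _ _ _ lebesgue_rV_step
  step0 step_ge0 step_additive.

Let step_sigma_finite : sigma_finite setT lebesgue_rV_step.
Proof.
have /sigma_finiteP[F [TF ndF Foo]] := sigma_finiteT (@lebesgue_measure R).
have /sigma_finiteP[G [TG ndG Goo]] := sigma_finiteT m.
exists (fun k => @unconsrV n @^-1` (F k `*` G k)).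
  rewrite -preimage_bigcup (_ : \bigcup_k _ = setT) ?preimage_setT//.
  rewrite -setXTT TF TG predeqE => -[x y]; split.
    by move=> [k _ []/= ? ?]; split; exists k.
  move=> [/= [k _ Fkx] [l _ Gly]]; exists (maxn k l) => //; split.
  - by move: x Fkx; exact/subsetPset/ndF/leq_maxl.
  - by move: y Gly; exact/subsetPset/ndG/leq_maxr.
move=> k; have [mF Fkoo] := Foo k; have [mG Gkoo] := Goo k; split.
  rewrite -[X in measurable X]setTI.
  by apply: measurable_unconsrV => //; exact: measurableX.
rewrite /lebesgue_rV_step /pushforward -comp_preimage.
rewrite (_ : _ \o _ = id); last by apply/funext => p /=; rewrite consrVK.
by rewrite product_measure1E// lte_mul_pinfty// ge0_fin_numE.
Qed.

HB.instance Definition _ := Measure_isSigmaFinite.Build _ _ _ lebesgue_rV_step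
  step_sigma_finite.

End step.

Let dirac_rV0_sigma_finite :
  sigma_finite setT (\d_(0 : 'rV[R]_0) : set 'rV[R]_0 -> \bar R).
Proof.
exists (fun=> setT); first by rewrite bigcup_const//; exists 0%N.
by move=> _; split => //; rewrite diracE ltry.
Qed.

HB.instance Definition _ := Measure_isSigmaFinite.Build _ _ _
  (\d_(0 : 'rV[R]_0) : set 'rV[R]_0 -> \bar R) dirac_rV0_sigma_finite.

(* Lebesgue measure on R^n, the n-fold product of the one on R. *)
Fixpoint lebesgue_rV n : {sigma_finite_measure set 'rV[R]_n -> \bar R} :=
  if n is n'.+1 then lebesgue_rV_step (lebesgue_rV n') else \d_(0 : 'rV[R]_0).

End lebesgue_rV.

Section euclidean.
Variables (R : realType) (n : nat).
Implicit Types (x c : 'rV[R]_n) (A : set 'rV[R]_n).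

(* The library norm on 'rV[R]_n is the sup norm; it induces the same topology
   and bounded sets, but balls must be Euclidean here. *)
Definition enorm x : R := Num.sqrt (\sum_i x 0 i ^+ 2).

Definition eball c (r : R) : set 'rV[R]_n := [set x | enorm (x - c) < r].

Definition inrad A : R :=
  sup [set r : R | 0 < r /\ exists c, eball c r `<=` A].

Definition domain A := [/\ open A, connected A & A !=set0].

Definition boundary A := closure A `\` interior A.

End euclidean.

Section smoothness.
Variables (R : realType) (n : nat).
Implicit Types (f g : 'rV[R]_n -> R) (U V A : set 'rV[R]_n).

Definition partial (i : 'I_n) f : 'rV[R]_n -> R :=
  fun x => 'D_(delta_mx 0 i) f x.

Definition iter_partial (s : seq 'I_n) f := foldr partial f s.

(* C^oo on the open set U *)
Definition smooth_on U f :=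
  forall (s : seq 'I_n) x, U x -> differentiable (iter_partial s f) x.

(* V is a connected relatively open part of the boundary of A along which this
   boundary is an embedded C^oo hypersurface. *)
Definition smooth_boundary_piece A V :=
  [/\ V `<=` boundary A, connected V &
    forall p, V p -> exists U g,
      [/\ open U, U p, smooth_on U g, exists i, partial i g p != 0 &
        boundary A `&` U = [set x | U x /\ g x = 0]
        /\ boundary A `&` U `<=` V]].

(* A has zero (n-1)-dimensional Hausdorff measure. The index set D may be
   finite or empty: for n = 1 every ball of the cover costs r ^+ 0 = 1, so that
   only the empty set is null. *)
Definition surface_null A :=
  forall e : R, 0 < e -> exists (D : set nat) (c : nat -> 'rV[R]_n) (r : nat -> R),
    [/\ forall i, 0 < r i, A `<=` \bigcup_(i in D) eball (c i) (r i) &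
      (\esum_(i in D) (r i ^+ n.-1)%:E < e%:E)%E].

(* Up to a set of zero surface measure (edges, corners, conical points), the
   boundary is a finite union of smooth pieces. *)
Definition piecewise_smooth_boundary A :=
  exists (m : nat) (V : 'I_m -> set 'rV[R]_n),
    (forall i, smooth_boundary_piece A (V i))
    /\ surface_null (boundary A `\` \bigcup_i V i).

(* C_c^oo(A), as functions on the whole space *)
Definition test_function A f :=
  smooth_on setT f /\
  exists K, [/\ compact K, K `<=` A & forall x, ~ K x -> f x = 0].

End smoothness.

Section neumann.
Variables (R : realType) (n : nat).
Implicit Types (u v : 'rV[R]_n -> R) (g h : 'I_n -> 'rV[R]_n -> R).
Implicit Types (A : set 'rV[R]_n).

Local Notation leb := (lebesgue_rV R n).

Definition square_integrable A u :=
  measurable_fun A (u : 'rV[R]_n -> measurableTypeR R) /\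
  leb.-integrable A (fun x => (u x ^+ 2)%:E).

(* u belongs to the Sobolev space H^1(A) = W^{1,2}(A), with weak gradient g *)
Definition sobolev_H1 A u g :=
  square_integrable A u /\
  forall i, square_integrable A (g i) /\
    forall f, test_function A f ->
      \int[leb]_(x in A) (u x * partial i f x) =
      - \int[leb]_(x in A) (g i x * f x).

(* u solves - Delta u = l u in A with Neumann condition du/dnu = 0 on the
   boundary, in the weak form that defines the Neumann Laplacian. u = 0 is
   allowed, so this is membership in the eigenspace of l. *)
Definition neumann_eigenspace A (l : R) u :=
  exists g, sobolev_H1 A u g /\
    forall v h, sobolev_H1 A v h ->
      \int[leb]_(x in A) (\sum_i g i x * h i x) =
      l * \int[leb]_(x in A) (u x * v x).

(* linear independence in L^2(A), i.e. modulo equality almost everywhere *)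
Definition ae_free A m (u : 'I_m -> 'rV[R]_n -> R) :=
  forall a : 'I_m -> R,
    {ae leb, forall x, A x -> \sum_i a i * u i x = 0} -> forall i, a i = 0.

(* The k-th entry, counted from 0, of the nondecreasing list of the Neumann
   eigenvalues of A repeated according to multiplicity: the least t such that
   at least k + 1 eigenvalues, counted with multiplicity, are at most t. *)
Definition neumann_eigenvalue A (k : nat) : R :=
  inf [set t | exists (l : 'I_k.+1 -> R) (u : 'I_k.+1 -> 'rV[R]_n -> R),
    (forall i, l i <= t /\ neumann_eigenspace A (l i) (u i)) /\ ae_free A u].

End neumann.

(* Main.v *)
(* If a ball of radius r lies in Omega, a cubic grid with q^n > k cells inside
   the ball carries k + 1 disjointly supported smooth bumps, so that min-max
   gives lambda_k(Omega) <= C n^2 q^2 / r^2.  Conversely, cut the unit ball by a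
   grid into fewer than k convex pieces of diameter at most of order sqrt n / p.
   Some combination of k orthonormal test functions has mean zero on every
   piece, and the Poincare inequality on each convex piece yields
   lambda_(k-1)(B_1) >= c p^2 / n.  With q minimal and p = q - 2, the factor
   n log k, where log k >= n log (q - 1), covers the ratio of the two bounds.

   The Poincare inequality comes from Prekopa-Leindler applied to exponentials
   of a smooth function against a Gaussian-weighted indicator of the convex set,
   to second order in the exponent; mollification transfers it to weak
   gradients.  The infima defining the eigenvalues are attained because the
   Poincare inequalities on fine grids make minimising sequences precompact. *)
Require Import Defs.
From mathcomp Require Import all_boot all_order all_algebra.
From mathcomp Require Import all_classical all_reals all_analysis.
From mathcomp Require Import measurable_realfun.
From mathcomp Require Import ring lra.
From mathcomp Require finmap.

Set Implicit Arguments.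
Unset Strict Implicit.
Unset Printing Implicit Defensive.
Import Order.TTheory GRing.Theory Num.Theory.
Import numFieldNormedType.Exports.
Import HBSimple HBNNSimple.

Local Open Scope classical_set_scope.
Local Open Scope ring_scope.

(** * Spectrum of a pair of quadratic forms *)

(** The eigenvalues are infima over families of genuine weak eigenfunctions, not min-max values, so
    a space of trial functions bounds nothing until eigenfunctions have been produced from it. This
    is why a small spectral theory for a pair of semidefinite forms comes in, for [Omega] and for
    the ball alike. Its compactness input is the piecewise Poincare inequality itself: on a fine
    grid the mass is at most a small multiple of the energy plus finitely many squared means. The
    Poincare constant on a convex set has to depend on the diameter alone, since an exponential loss
    in the dimension would not be covered by [n * ln k]. Mollified functions are controlled only
    away from the boundary; the pieces are therefore exhausted by midpoint-convex sets at positive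
    distance from the complement of the domain, and the inequality is kept free of division by the
    volume so that it survives the limit. *)

Lemma quadratic_ge0_discr (R : realFieldType) (A B C : R) :
  (forall t, 0 <= A + 2 * t * B + t ^+ 2 * C) -> B ^+ 2 <= A * C.
Proof.
move=> H; have [C0|C0] := eqVneq C 0.
  have [->|B0] := eqVneq B 0; first by rewrite C0 mulr0 expr0n.
  have := H (- (A + 1) / (2 * B)); rewrite C0 mulr0 addr0.
  rewrite (_ : 2 * (- (A + 1) / (2 * B)) * B = - (A + 1)); last by field.
  lra.
have Cgt0 : 0 < C.
  rewrite lt_neqAle eq_sym C0/= leNgt; apply/negP => Clt0.
  have A0 : 0 <= A by have := H 0; rewrite mulr0 mul0r expr0n mul0r !addr0.
  (* This [t >= 1] satisfies [t * - C = - C + A + 2 * |B|], so the negative quadratic term outweighs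
     the other two. *)
  pose t := 1 + A / - C + (2 * `|B|) / - C.
  have N0 : 0 < - C by rewrite oppr_gt0.
  have h1 : 0 <= A / - C by rewrite divr_ge0 // ltW.
  have h2 : 0 <= (2 * `|B|) / - C by rewrite divr_ge0 ?mulr_ge0 // ltW.
  have t1 : 1 <= t by rewrite /t -addrA lerDl addr_ge0.
  have tC : t * - C = - C + A + 2 * `|B| by rewrite /t; field.
  have := H t; have BB : B <= `|B| := ler_norm B.
  have B0 : 0 <= `|B| := normr_ge0 B.
  have tt : t ^+ 2 * C = - (t * (- C + A + 2 * `|B|)) by rewrite -tC; ring.
  nra.
have := H (- B / C).
rewrite (_ : A + 2 * (- B / C) * B + (- B / C) ^+ 2 * C = (A * C - B ^+ 2) / C); last by field.
by rewrite pmulr_lge0 ?invr_gt0 // subr_ge0.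
Qed.

(** * Semidefinite forms on a subspace: Cauchy-Schwarz, parallelogram law, limits *)

Section psd_form.
Variables (R : realType) (V : lmodType R).
Implicit Types (P : V -> Prop) (a b : V -> V -> R).

Definition subspace_pred P := P 0 /\ forall c x y, P x -> P y -> P (c *: x + y).

(** The laws are required on [P] only: an integral of products is total but additive only for
    square-integrable functions. The form is merely semidefinite because functions equal almost
    everywhere are not identified. *)
Definition psd_form P a := [/\
  forall x y, P x -> P y -> a x y = a y x,
  forall c x y z, P x -> P y -> P z -> a (c *: x + y) z = c * a x z + a y z &
  forall x, P x -> 0 <= a x x].

Section theory.
Variables (P : V -> Prop) (a : V -> V -> R).
Hypotheses (subP : subspace_pred P) (fa : psd_form P a).

Lemma subspD x y : P x -> P y -> P (x + y).
Proof. by move=> Px Py; rewrite -[x]scale1r; apply subP. Qed.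

Lemma subspZ c x : P x -> P (c *: x).
Proof. by move=> Px; rewrite -[_ *: _]addr0; apply subP => //; case: subP. Qed.

Lemma subspB x y : P x -> P y -> P (x - y).
Proof. by move=> Px Py; apply: subspD => //; rewrite -scaleN1r; apply: subspZ. Qed.

Lemma subsp_sum I (r : seq I) (p : pred I) (F : I -> V) :
  (forall i, P (F i)) -> P (\sum_(i <- r | p i) F i).
Proof. by move=> PF; apply: big_ind => //; [case: subP|exact: subspD]. Qed.

Lemma formC x y : P x -> P y -> a x y = a y x.
Proof. by case: fa => aC _ _; exact: aC. Qed.

Lemma form_ge0 x : P x -> 0 <= a x x.
Proof. by case: fa => _ _; apply. Qed.

Lemma formDl x y z : P x -> P y -> P z -> a (x + y) z = a x z + a y z.
Proof. by case: fa => _ aL _ Px Py Pz; rewrite -[x]scale1r aL// mul1r scale1r. Qed.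

Lemma form0l z : P z -> a 0 z = 0.
Proof.
move=> Pz; have P0 : P 0 by case: subP.
have := formDl P0 P0 Pz; rewrite addr0 => h.
by apply: (addrI (a 0 z)); rewrite -h addr0.
Qed.

Lemma formZl c x z : P x -> P z -> a (c *: x) z = c * a x z.
Proof.
case: fa => _ aL _ Px Pz; have P0 : P 0 by case: subP.
by rewrite -[_ *: _]addr0 aL// form0l// addr0.
Qed.

Lemma formDr x y z : P x -> P y -> P z -> a z (x + y) = a z x + a z y.
Proof.
by move=> Px Py Pz; rewrite formC ?formDl ?(formC Pz)//; exact: subspD.
Qed.

Lemma formZr c x z : P x -> P z -> a z (c *: x) = c * a z x.
Proof.
by move=> Px Pz; rewrite formC ?formZl// ?(formC Pz)//; exact: subspZ.
Qed.

Lemma formNl x z : P x -> P z -> a (- x) z = - a x z.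
Proof. by move=> Px Pz; rewrite -scaleN1r formZl// mulN1r. Qed.

Lemma form_suml I (r : seq I) (p : pred I) (F : I -> V) z :
  (forall i, P (F i)) -> P z ->
  a (\sum_(i <- r | p i) F i) z = \sum_(i <- r | p i) a (F i) z.
Proof.
move=> PF Pz; elim: r => [|i r IH]; first by rewrite !big_nil form0l.
by rewrite !big_cons; case: ifP => // _; rewrite formDl ?IH//; exact: subsp_sum.
Qed.

Lemma form_sumr I (r : seq I) (p : pred I) (F : I -> V) z :
  (forall i, P (F i)) -> P z ->
  a z (\sum_(i <- r | p i) F i) = \sum_(i <- r | p i) a z (F i).
Proof.
move=> PF Pz; rewrite formC ?form_suml//; last exact: subsp_sum.
by apply: eq_bigr => i _; exact: formC.
Qed.

Lemma form_sqrD x y : P x -> P y -> a (x + y) (x + y) = a x x + 2 * a x y + a y y.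
Proof.
move=> Px Py; have Pxy := subspD Px Py.
by rewrite formDl// !formDr// (formC Py Px); ring.
Qed.

Lemma form_sqrZ c x : P x -> a (c *: x) (c *: x) = c ^+ 2 * a x x.
Proof. by move=> Px; rewrite formZl ?formZr//; [ring|exact: subspZ]. Qed.

Lemma form_CS x y : P x -> P y -> a x y ^+ 2 <= a x x * a y y.
Proof.
move=> Px Py; apply: quadratic_ge0_discr => t.
have Pt : P (t *: y) by exact: subspZ.
have := form_ge0 (subspD Px Pt); rewrite form_sqrD// form_sqrZ// formZr//.
by congr (0 <= _); ring.
Qed.

Lemma form_sqrB_le x y : P x -> P y -> a (x - y) (x - y) <= 2 * a x x + 2 * a y y.
Proof.
move=> Px Py; have Pn : P (- y) by rewrite -scaleN1r; exact: subspZ.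
have h1 := form_ge0 (subspD Px Py).
rewrite form_sqrD// in h1; rewrite form_sqrD// (formC Px Pn) !formNl//.
rewrite (formC Py Px) (formC Py Pn) formNl//; lra.
Qed.

Lemma form_parallelogram x y : P x -> P y ->
  a (x - y) (x - y) = 2 * a x x + 2 * a y y - a (x + y) (x + y).
Proof.
move=> Px Py; have Pn : P (- y) by rewrite -scaleN1r; exact: subspZ.
rewrite !form_sqrD// (formC Px Pn) !formNl//.
rewrite (formC Py Px) (formC Py Pn) formNl//; ring.
Qed.

Section limit.
Variables (x_ : nat -> V) (x : V).
Hypotheses (Px_ : forall n, P (x_ n)) (Px : P x).
Hypothesis x_x : a (x_ n - x) (x_ n - x) @[n --> \oo] --> (0 : R).

Lemma cvg_form z : P z -> a (x_ n) z @[n --> \oo] --> a x z.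
Proof.
move=> Pz.
suff : a (x_ n - x) z @[n --> \oo] --> (0 : R).
  move=> h; rewrite -[a x z]add0r.
  rewrite (_ : (fun n => _) = (fun n => a (x_ n - x) z + a x z)); last first.
    apply/funext => n; rewrite formDl// ?formNl//; first by rewrite subrK.
    by rewrite -scaleN1r; exact: subspZ.
  by apply: cvgD => //; exact: cvg_cst.
apply/norm_cvg0P.
have : Num.sqrt (a (x_ n - x) (x_ n - x) * a z z) @[n --> \oo] --> (0 : R).
  rewrite -(sqrtr0 R); apply: (@cvg_comp _ _ _ _ (fun y => Num.sqrt y : R)); last first.
    exact: sqrt_continuous.
  by rewrite -(mul0r (a z z)); apply: cvgMl.
apply: (@squeeze_cvgr _ _ _ _ (fun=> 0)); last exact: cvg_cst.
near=> n; rewrite normr_ge0/= -sqrtr_sqr ler_sqrt.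
  by apply: form_CS => //; exact: subspB.
by rewrite mulr_ge0// form_ge0//; exact: subspB.
Unshelve. all: by end_near. Qed.

(** Expanding [x_ n] around [x] leaves the seminorm of the difference, which tends to 0, and a term
    linear in [x_ n], which [cvg_form] handles. *)
Lemma cvg_form_sqr : a (x_ n) (x_ n) @[n --> \oo] --> a x x.
Proof.
have h := cvg_form Px.
rewrite (_ : (fun n => _) = (fun n => a (x_ n - x) (x_ n - x) +
    (2 * a (x_ n) x - a x x))); last first.
  apply/funext => n; rewrite form_parallelogram// form_sqrD//; ring.
rewrite -[X in _ --> X]add0r; apply: cvgD => //.
have e2 : 2 * a x x - a x x = a x x by ring.
by rewrite -[X in _ --> X]e2; apply: cvgB; [apply: cvgM => //; exact: cvg_cst|exact: cvg_cst].
Qed.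

End limit.
End theory.
End psd_form.

(** Compactness of the segment [[- C, C]] gives a cluster point, and for an ultrafilter a cluster
    point is a limit. *)
Lemma ultra_cvg_bounded (R : realType) T (U : set_system T) (f : T -> R) (C : R) :
  UltraFilter U -> (forall x, `|f x| <= C) -> exists l : R, f x @[x --> U] --> l.
Proof.
move=> UU fC.
have fC' : U (f @^-1` [set` `[- C, C]]).
  apply: filterS (@filterT _ U _) => x _ /=.
  by rewrite in_itv/= -ler_norml.
have [p [_ clp]] := @segment_compact R (- C) C (f @ U) _ fC'.
exists p; apply/cvgrPdist_lt => e e0; apply: contrapT => h.
have [//|h'] := in_ultra_setVsetC [set x | `|p - f x| < e] UU.
have [y [/= [x xh <-]]] := clp [set f x | x in [set x | ~ (`|p - f x| < e)]] (ball p e)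
  (filterS (fun x hx => ex_intro2 _ _ x hx erefl) h') (nbhsx_ballx p e e0).
by [].
Qed.

(** A dimension count: with fewer linear constraints than vectors, some nonzero combination meets
    them all. It provides trial vectors orthogonal to earlier eigenvectors, and combinations with
    mean zero on every piece. *)
Lemma exists_kernel_rV (F : fieldType) (m n : nat) (A : 'M[F]_(m, n)) : (n < m)%N ->
  exists2 v : 'rV[F]_m, v != 0 & v *m A = 0.
Proof.
move=> nm; have : kermx A != 0.
  by rewrite kermx_eq0 /row_free ltn_eqF// (leq_ltn_trans (rank_leq_col _)).
move=> /rowV0Pn[v /sub_kermxP vA v0].
by exists v.
Qed.

(** * The direct method: minimisers of a Rayleigh quotient and families of eigenvectors *)

Section spectral.
Variables (R : realType) (V : lmodType R) (P : V -> Prop) (a b : V -> V -> R).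
Hypotheses (subP : subspace_pred P) (fa : psd_form P a) (fb : psd_form P b).

Hypothesis complete : forall x_ : nat -> V, (forall n, P (x_ n)) ->
  (forall e : R, 0 < e -> exists N, forall m n, (N <= m)%N -> (N <= n)%N ->
     a (x_ m - x_ n) (x_ m - x_ n) + b (x_ m - x_ n) (x_ m - x_ n) <= e) ->
  exists x, [/\ P x, a (x_ n - x) (x_ n - x) @[n --> \oo] --> (0 : R) &
    b (x_ n - x) (x_ n - x) @[n --> \oo] --> (0 : R)].

(** The abstract form of Rellich compactness: up to finitely many [b]-bounded functionals, [b] is an
    arbitrarily small multiple of [a]. A sequence with bounded [a] along which the functionals
    converge is then Cauchy for [b]. *)
Hypothesis coercive : forall e : R, 0 < e -> exists N (ell : 'I_N -> V -> R) C,
  [/\ forall i x y, P x -> P y -> ell i (x - y) = ell i x - ell i y,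
      forall i x, P x -> ell i x ^+ 2 <= C * b x x &
      forall x, P x -> b x x <= e * a x x + \sum_i ell i x ^+ 2].

Section minimizer.
Variables (S : V -> Prop) (T : R) (v0 : V).
Hypothesis (subS : subspace_pred S) (SP : forall v, S v -> P v).
Hypothesis closedS : forall (x_ : nat -> V) x, (forall n, S (x_ n)) -> P x ->
  b (x_ n - x) (x_ n - x) @[n --> \oo] --> (0 : R) -> S x.
Hypotheses (Sv0 : S v0) (bv0 : 0 < b v0 v0) (av0 : a v0 v0 <= T * b v0 v0).

Let unit_values := [set a v v | v in [set v | S v /\ b v v = 1]].
Let lam := inf unit_values.

Let scale_unit v : S v -> 0 < b v v ->
  S ((Num.sqrt (b v v))^-1 *: v) /\
  b ((Num.sqrt (b v v))^-1 *: v) ((Num.sqrt (b v v))^-1 *: v) = 1 /\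
  a ((Num.sqrt (b v v))^-1 *: v) ((Num.sqrt (b v v))^-1 *: v) = a v v / b v v.
Proof.
move=> Sv bv; have Pv := SP Sv; split; first exact: (subspZ subS).
rewrite (form_sqrZ subP fb)// (form_sqrZ subP fa)// exprVn sqr_sqrtr ?ltW//.
by rewrite mulVf ?gt_eqF// mulrC.
Qed.

Let has_inf_values : has_inf unit_values.
Proof.
split; last by exists 0 => _ [v [Sv _] <-]; exact: (form_ge0 fa (SP Sv)).
have [S1 [b1 a1]] := scale_unit Sv0 bv0.
by exists (a v0 v0 / b v0 v0); exists ((Num.sqrt (b v0 v0))^-1 *: v0).
Qed.

(** The bound passes from unit vectors to all of [S] by scaling; vectors of zero mass are covered by
    [a] being nonnegative. *)
Let lam_le v : S v -> lam * b v v <= a v v.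
Proof.
move=> Sv; have Pv := SP Sv; have := form_ge0 fb Pv; rewrite le_eqVlt => /orP[/eqP<-|bv].
  by rewrite mulr0 (form_ge0 fa).
rewrite -ler_pdivlMr//; apply: ge_inf; first by case: has_inf_values.
by have [S1 [b1 a1]] := scale_unit Sv bv; exists ((Num.sqrt (b v v))^-1 *: v).
Qed.

Let lamT : lam <= T.
Proof. by have := le_trans (lam_le Sv0) av0; rewrite ler_pM2r. Qed.

Let minimizing : exists v_ : nat -> V, forall n,
  [/\ S (v_ n), b (v_ n) (v_ n) = 1 & a (v_ n) (v_ n) <= lam + n.+1%:R^-1].
Proof.
suff h n : exists v, [/\ S v, b v v = 1 & a v v <= lam + n.+1%:R^-1].
  by have [v_ hv] := boolp.choice h; exists v_.
 have n0 : 0 < n.+1%:R^-1 :> R by rewrite invr_gt0.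
have [_ [v [Sv bv] <-] h] := inf_adherent n0 has_inf_values.
by exists v; split => //; exact: ltW.
Qed.

(* Along an ultrafilter all the bounded functionals of [coercive] converge at
   once, which replaces the extraction of a diagonal subsequence. *)
Let cauchy_minimizing (v_ : nat -> V) (U : set_system nat) : UltraFilter U -> \oo `<=` U ->
  (forall n, [/\ S (v_ n), b (v_ n) (v_ n) = 1 & a (v_ n) (v_ n) <= lam + n.+1%:R^-1]) ->
  forall e : R, 0 < e -> exists2 A, U A & forall m n, A m -> A n ->
    a (v_ m - v_ n) (v_ m - v_ n) + b (v_ m - v_ n) (v_ m - v_ n) <= e.
Proof.
move=> UU ooU hv.
have Sv n : S (v_ n) by have [] := hv n.
have Pv n : P (v_ n) by exact: SP.
have bv n : b (v_ n) (v_ n) = 1 by have [] := hv n.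
have av n : a (v_ n) (v_ n) <= lam + n.+1%:R^-1 by have [] := hv n.
have inv1 n : n.+1%:R^-1 <= 1 :> R by rewrite invf_le1// ler1n.
have lam0 : 0 <= lam.
  by apply: lb_le_inf; [case: has_inf_values|move=> _ [v [Sv' _] <-]; exact: (form_ge0 fa (SP Sv'))].
have bcauchy : forall e : R, 0 < e -> exists2 A, U A & forall m n, A m -> A n ->
    b (v_ m - v_ n) (v_ m - v_ n) <= e.
  (* [K] bounds the energy of a difference of two members, each of energy at most [lam + 1]. *)
  move=> e e0; pose K := 4 * (lam + 1).
  have K0 : 0 < K by rewrite /K; lra.
  have eK0 : 0 < e / (2 * K) by rewrite divr_gt0// mulr_gt0.
  have [N [ell [C [ellB ellC ellb]]]] := coercive eK0.
  have cl i : exists l : R, ell i (v_ n) @[n --> U] --> l.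
    apply: (@ultra_cvg_bounded _ _ _ _ (Num.sqrt C)) => n.
    rewrite -sqrtr_sqr; apply: ler_wsqrtr.
    by have := ellC i _ (Pv n); rewrite bv mulr1.
  have [l hl] := choice cl.
  (* Each of the [N] functionals varies by at most [2 * d], which makes their squares sum to at most
     [e / 2]; [N.+1] keeps the denominator nonzero. *)
  pose d : R := Num.sqrt (e / (2 * N.+1%:R)) / 2.
  have d0 : 0 < d by rewrite divr_gt0// sqrtr_gt0 divr_gt0// mulr_gt0// ltr0n.
  have : \forall n \near U, forall i, `|l i - ell i (v_ n)| < d.
    by apply: filter_forall => i; move/cvgrPdist_lt : (hl i); exact.
  move=> UA; exists [set n | forall i, `|l i - ell i (v_ n)| < d] => // m n Am An.
  apply: (le_trans (ellb _ (subspB subP (Pv m) (Pv n)))).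
  have h1 : a (v_ m - v_ n) (v_ m - v_ n) <= K.
    apply: (le_trans (form_sqrB_le subP fa (Pv m) (Pv n))).
    have h v : a (v_ v) (v_ v) <= lam + 1 by apply: (le_trans (av v)); rewrite lerD2l.
    have := h m; have := h n; rewrite /K; lra.
  have h2 : \sum_i ell i (v_ m - v_ n) ^+ 2 <= e / 2.
    apply: (@le_trans _ _ (\sum_(i < N) (2 * d) ^+ 2)).
      apply: ler_sum => i _; rewrite ellB//.
      rewrite -real_normK ?num_real// lerXn2r ?nnegrE ?normr_ge0//.
        by rewrite mulr_ge0// ltW.
      have := Am i; have := An i; rewrite !ltr_norml ler_norml => /andP[? ?] /andP[? ?].
      by apply/andP; split; lra.
    rewrite sumr_const card_ord -[_ *+ N]mulr_natl (_ : 2 * d = Num.sqrt (e / (2 * N.+1%:R))); last first.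
      by rewrite /d; field.
    rewrite sqr_sqrtr; last by rewrite divr_ge0 ?mulr_ge0 ?ltW.
    have q0 : 0 < N.+1%:R :> R by rewrite ltr0n.
    have Nq : N%:R <= N.+1%:R :> R by rewrite ler_nat.
    move: q0 Nq; set q : R := N.+1%:R => q0 Nq.
    rewrite (_ : N%:R * (e / (2 * q)) = e / 2 * (N%:R / q)); last first.
      by field; rewrite gt_eqF.
    by rewrite ler_piMr ?divr_ge0 ?(ltW e0)// ler_pdivrMr// mul1r.
  have h3 : e / (2 * K) * a (v_ m - v_ n) (v_ m - v_ n) <= e / 2.
    apply: (@le_trans _ _ (e / (2 * K) * K)); first by rewrite ler_pM2l.
    by rewrite le_eqVlt; apply/orP; left; apply/eqP; field; rewrite gt_eqF.
  by rewrite [leRHS]splitr; exact: lerD.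
move=> e e0.
have l1 : 0 < e / (4 * (lam + 1)) by rewrite divr_gt0//; lra.
have [A UA hA] := bcauchy _ l1.
have : \forall n \near \oo, n.+1%:R^-1 < e / 8 :> R.
  by apply: near_infty_natSinv_lt (PosNum (divr_gt0 e0 (ltr0n R 8))).
move=> /ooU UB.
exists (A `&` [set n | n.+1%:R^-1 < e / 8 :> R]); first exact: filterI.
move=> m n [Am /= Bm] [An /= Bn]; have hb := hA _ _ Am An.
(* The sum [v_ m + v_ n] has energy at least [lam] times its mass. With the two parallelogram laws
   this bounds the energy of the difference by [e / 2] plus [lam] times its mass. *)
have hS := lam_le (subspD subS (Sv m) (Sv n)).
have pb := form_parallelogram subP fb (Pv m) (Pv n).
have pa := form_parallelogram subP fa (Pv m) (Pv n).
rewrite !bv in pb.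
have hl : (lam + 1) * b (v_ m - v_ n) (v_ m - v_ n) <= e / 4.
  apply: (@le_trans _ _ ((lam + 1) * (e / (4 * (lam + 1))))).
    by rewrite ler_wpM2l//; lra.
  by rewrite le_eqVlt; apply/orP; left; apply/eqP; field; lra.
have hm : a (v_ m) (v_ m) <= lam + e / 8.
  by apply: (le_trans (av m)); rewrite lerD2l ltW.
have hn : a (v_ n) (v_ n) <= lam + e / 8.
  by apply: (le_trans (av n)); rewrite lerD2l ltW.
nra.
Qed.

Lemma exists_minimizer : exists w l, [/\ S w, b w w = 1, l <= T, a w w = l &
  forall v, S v -> l * b v v <= a v v].
Proof.
have [v_ hv] := minimizing.
have [U [UU ooU]] := @ultraFilterLemma nat \oo _.
have /choice[A hA] : forall k : nat, exists A : set nat, U A /\ forall m n, A m -> A n ->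
    a (v_ m - v_ n) (v_ m - v_ n) + b (v_ m - v_ n) (v_ m - v_ n) <= k.+1%:R^-1.
  move=> k; have k0 : 0 < k.+1%:R^-1 :> R by rewrite invr_gt0.
  by have [A ? ?] := cauchy_minimizing UU ooU hv k0; exists A.
(* An index [m k >= k] common to [A 0], ..., [A k]. Along [m] the ultrafilter statement becomes an
   ordinary Cauchy sequence, to which [complete] applies. *)
have /choice[m hm] : forall k : nat, exists m : nat, (k <= m)%N /\ forall i, (i <= k)%N -> A i m.
  move=> k; have UB : \forall n \near U, (k <= n)%N by apply: ooU; exact: nbhs_infty_ge.
  have UA : \forall n \near U, forall i : 'I_k.+1, A i n.
    by apply: filter_forall => i; have [] := hA i.
  have [n [/= kn An]] := filter_ex (filterI UB UA).
  by exists n; split => // i ik; have := An (inord i); rewrite inordK.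
pose x_ k := v_ (m k).
have Sx k : S (x_ k) by have [] := hv (m k).
have [x [Px ax bx]] : exists x, [/\ P x, a (x_ n - x) (x_ n - x) @[n --> \oo] --> (0 : R) &
    b (x_ n - x) (x_ n - x) @[n --> \oo] --> (0 : R)].
  apply: complete => [n|e e0]; first exact: SP.
  have [N _ hN] : \forall n \near \oo, n.+1%:R^-1 < e :> R.
    exact: near_infty_natSinv_lt (PosNum e0).
  exists N => i j Ni Nj; apply: (le_trans _ (ltW (hN N (leqnn N)))).
  by have [_ ] := hA N; apply; [have [_ ] := hm i|have [_ ] := hm j]; exact.
have Sx' : S x := closedS Sx Px bx.
have cb : b (x_ n) (x_ n) @[n --> \oo] --> b x x.
  by apply: (cvg_form_sqr subP fb) => // n; exact: SP.
have ca : a (x_ n) (x_ n) @[n --> \oo] --> a x x.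
  by apply: (cvg_form_sqr subP fa) => // n; exact: SP.
have b1 : b x x = 1.
  apply: (cvg_unique _ cb); rewrite // (_ : (fun n => _) = cst 1); first exact: cvg_cst.
  by apply/funext => n; have [] := hv (m n).
exists x, lam; split => //; apply/eqP; rewrite eq_le; apply/andP; split; last first.
  by have := lam_le Sx'; rewrite b1 mulr1.
have cl : lam + n.+1%:R^-1 @[n --> \oo] --> lam.
  rewrite -[X in _ --> X]addr0; apply: cvgD; [exact: cvg_cst|exact: cvg_harmonic].
apply: (ler_lim_cvg _ _ ca cl) || (rewrite -(cvg_lim _ ca)// -(cvg_lim _ cl)//; apply: ler_lim).
- by apply/cvg_ex; exists (a x x).
- by apply/cvg_ex; exists lam.
near=> n; have [_ _ h] := hv (m n); apply: (le_trans h).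
rewrite lerD2l lef_pV2 ?posrE ?ltr0n// ler_nat ltnS.
by have [] := hm n.
Unshelve. all: by end_near. Qed.

End minimizer.

(** Indexing by [nat] with a bound [j] lets a family be extended by one vector without recasting
    ordinals. *)
Definition eigenfamily (j : nat) (l : nat -> R) (w : nat -> V) := [/\
  forall i, (i < j)%N -> P (w i),
  forall i i', (i < j)%N -> (i' < j)%N -> b (w i) (w i') = (i == i')%:R &
  forall i v, (i < j)%N -> P v -> a (w i) v = l i * b (w i) v].

(** The next eigenvector minimises the Rayleigh quotient on the [b]-orthogonal complement of the
    previous ones; [v0] shows that the minimum is at most [T]. *)
Lemma eigenfamilyS j l w T v0 : eigenfamily j l w ->
  P v0 -> (forall i, (i < j)%N -> b v0 (w i) = 0) ->
  0 < b v0 v0 -> a v0 v0 <= T * b v0 v0 ->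
  exists w' l', [/\ P w', b w' w' = 1, l' <= T, forall i, (i < j)%N -> b w' (w i) = 0 &
    forall v, P v -> a w' v = l' * b w' v].
Proof.
move=> [Pw ow aw] Pv0 ov0 bv0 av0.
pose S v := P v /\ forall i, (i < j)%N -> b v (w i) = 0.
have subS : subspace_pred S.
  split; first by split; [case: subP|move=> i ij; rewrite (form0l subP fb)//; exact: Pw].
  move=> c x y [Px ox] [Py oy]; split; first by case: subP => _; exact.
  by move=> i ij; case: fb => _ -> //; rewrite ?ox ?oy ?mulr0 ?addr0//; exact: Pw.
have SP v : S v -> P v by case.
have closedS (x_ : nat -> V) x : (forall n, S (x_ n)) -> P x ->
    b (x_ n - x) (x_ n - x) @[n --> \oo] --> (0 : R) -> S x.
  move=> hS Px bx; split => // i ij.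
  have h : b (x_ n) (w i) @[n --> \oo] --> b x (w i).
    by apply: (cvg_form subP fb) => //; [move=> n; exact: SP|exact: Pw].
  apply: (cvg_unique _ h); rewrite // (_ : (fun n => _) = cst 0); first exact: cvg_cst.
  by apply/funext => n; have [_ ->] := hS n.
have [w' [l' [[Pw' ow'] bw' l'T aw' minw']]] :=
  exists_minimizer subS SP closedS (conj Pv0 ov0) bv0 av0.
exists w', l'; split => //.
(* First variation: [a - l' * b] is nonnegative on [S] and vanishes at [w'], so the quadratic in [t]
   along [w' + t *: v] has zero constant term and its linear term must vanish. *)
have orthS v : S v -> a w' v = l' * b w' v.
  move=> Sv; have Pv := SP _ Sv.
  have : (a w' v - l' * b w' v) ^+ 2 <= 0 * (a v v - l' * b v v).
    apply: quadratic_ge0_discr => t.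
    have := minw' _ (subspD subS (conj Pw' ow') (subspZ subS t Sv)).
    have Ptv := subspZ subP t Pv.
    rewrite !(form_sqrD subP)// !(form_sqrZ subP)// !(formZr subP)// bw' aw'.
    by rewrite -subr_ge0; congr (0 <= _); ring.
  by rewrite mul0r => h; apply/eqP; rewrite -subr_eq0 -sqrf_eq0 eq_le h sqr_ge0.
(* A general test vector is reduced to [S] by subtracting its projection [p] onto the old
   eigenvectors; both forms vanish on [w'] and [p], the form [a] because the [w i] are
   eigenvectors. *)
move=> v Pv; pose p := \sum_(i < j) b v (w i) *: w i.
have PF (i : 'I_j) : P (b v (w i) *: w i) by apply: (subspZ subP); exact: Pw.
have Pp : P p by exact: (subsp_sum subP).
have Svp : S (v - p).
  split; first exact: subspB.
  move=> i ij; have Pwi := Pw _ ij.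
  have Pnp : P (- p) by rewrite -scaleN1r; exact: subspZ.
  rewrite (formDl fb)// (formNl subP fb)// {1}/p (form_suml subP fb)//.
  rewrite (bigD1 (Ordinal ij))//= big1 ?addr0.
    by rewrite (formZl subP fb)// ow// eqxx mulr1 subrr.
  move=> k ki; rewrite (formZl subP fb) ?ow//; last exact: Pw.
  by rewrite (_ : (k == i :> nat) = false) ?mulr0//; apply/negbTE.
have bp : b w' p = 0.
  rewrite (form_sumr subP fb)// big1// => i _; rewrite (formZr subP fb) ?ow' ?mulr0//.
  exact: Pw.
have ap : a w' p = 0.
  rewrite (form_sumr subP fa)// big1// => i _; have Pwi := Pw _ (ltn_ord i).
  rewrite (formZr subP fa)// (formC fa)// aw// (formC fb Pwi Pw') ow'//.
  by rewrite !mulr0.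
have := orthS _ Svp.
have Pnp : P (- p) by rewrite -scaleN1r; exact: subspZ.
rewrite (formDr subP fa)// (formDr subP fb)// (formC fa Pw' Pnp) (formC fb Pw' Pnp).
rewrite (formNl subP fa)// (formNl subP fb)// (formC fa Pp Pw') (formC fb Pp Pw').
by rewrite bp ap oppr0 !addr0.
Qed.

(** The trial space has dimension [N], so as long as [j < N] it contains a nonzero vector orthogonal
    to the [j] eigenvectors already found. Its Rayleigh quotient keeps every new eigenvalue below
    [T]. *)
Theorem exists_eigenfamily N T (e : 'I_N -> V) : (forall i, P (e i)) ->
  (forall c : 'I_N -> R, a (\sum_i c i *: e i) (\sum_i c i *: e i) <=
     T * b (\sum_i c i *: e i) (\sum_i c i *: e i)) ->
  (forall c : 'I_N -> R, b (\sum_i c i *: e i) (\sum_i c i *: e i) = 0 ->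
     forall i, c i = 0) ->
  exists l w, eigenfamily N l w /\ forall i, (i < N)%N -> l i <= T.
Proof.
move=> Pe aT bfree.
suff : forall j, (j <= N)%N -> exists l w, eigenfamily j l w /\ forall i, (i < j)%N -> l i <= T.
  by apply.
elim=> [_|j IH jN]; first by exists (fun=> 0), (fun=> 0).
have [l [w [[Pw ow aw] lT]]] := IH (ltnW jN).
pose A : 'M[R]_(N, j) := \matrix_(i, k) b (e i) (w k).
have [c c0 cA] := exists_kernel_rV A jN.
pose v0 := \sum_i c 0 i *: e i.
have PF (i : 'I_N) : P (c 0 i *: e i) by exact: (subspZ subP).
have Pv0 : P v0 by exact: (subsp_sum subP).
have ov0 i : (i < j)%N -> b v0 (w i) = 0.
  move=> ij; have Pwi := Pw _ ij; rewrite (form_suml subP fb)//.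
  have := congr1 (fun M : 'rV_j => M 0 (Ordinal ij)) cA; rewrite !mxE => {2}<-.
  by apply: eq_bigr => k _; rewrite (formZl subP fb)// !mxE.
have bv0 : 0 < b v0 v0.
  rewrite lt_neqAle (form_ge0 fb)// andbT eq_sym; apply: contra c0 => /eqP /bfree h.
  by apply/eqP/rowP => i; rewrite mxE.
have [w' [l' [Pw' bw' l'T ow' aw']]] := eigenfamilyS (And3 Pw ow aw) Pv0 ov0 bv0 (aT (fun i => c 0 i)).
exists (fun i => if i == j then l' else l i), (fun i => if i == j then w' else w i).
split; first split.
- by move=> i; rewrite ltnS leq_eqVlt; case: eqP => //= _ ij; exact: Pw.
- move=> i i'; rewrite !ltnS.
  case: (eqVneq i j) => [->|ij]; case: (eqVneq i' j) => [->|i'j] hi hi'.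
  + by rewrite bw'.
  + have i'lt : (i' < j)%N by rewrite ltn_neqAle i'j.
    by rewrite ow'// eq_sym (negbTE i'j).
  + have ilt : (i < j)%N by rewrite ltn_neqAle ij.
    by rewrite (formC fb) ?ow'// ?(negbTE ij)//; exact: Pw.
  + by rewrite ow// ltn_neqAle ?ij ?i'j.
- by move=> i v; rewrite ltnS leq_eqVlt; case: eqP => //= _ ij Pv; [exact: aw'|exact: aw].
- by move=> i; rewrite ltnS leq_eqVlt; case: eqP => //= _ ij; exact: lT.
Qed.

End spectral.

(** * Completeness of L^2 *)

Section L2.
Context d (T : measurableType d) (R : realType).
Variables (mu : {measure set T -> \bar R}) (D : set T) (mD : measurable D).
Implicit Types u v w : T -> R.

(** For Lebesgue measure this is [square_integrable] by conversion; the general measure costs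
    nothing and is shared by all restrictions. *)
Definition sqint u := measurable_fun D (u : T -> measurableTypeR R) /\
  mu.-integrable D (fun x => (u x ^+ 2)%:E).

Definition ip u v := \int[mu]_(x in D) (u x * v x).

Lemma integrable_le_fun u v : measurable_fun D (u : T -> measurableTypeR R) ->
  (forall x, D x -> `|u x| <= v x) ->
  mu.-integrable D (EFin \o v) -> mu.-integrable D (EFin \o u).
Proof.
move=> mu' uv iv; apply: (le_integrable mD _ _ iv).
  by apply/measurable_EFinP.
by move=> x Dx /=; rewrite lee_fin (le_trans (uv _ Dx))// ler_norm.
Qed.

Lemma sqint_mul u v : sqint u -> sqint v -> mu.-integrable D (EFin \o (fun x => u x * v x)).
Proof.
move=> [mu' iu] [mv iv].
apply: (@integrable_le_fun _ (fun x => u x ^+ 2 + v x ^+ 2)).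
- exact: measurable_funM.
- move=> x _; rewrite normrM.
  have := sqr_ge0 (`|u x| - `|v x|); rewrite -(real_normK (num_real (u x))).
  rewrite -[in X in _ -> _ <= _ + X](real_normK (num_real (v x))).
  have := normr_ge0 (u x); have := normr_ge0 (v x); nra.
- exact: (integrableD mD iu iv).
Qed.

Lemma sqint0 : sqint (fun=> 0).
Proof.
split; first exact: measurable_cst.
rewrite (_ : (fun=> _) = cst 0%E); first exact: integrable0.
by apply/funext => x /=; rewrite expr0n.
Qed.

Lemma sqintZD c u v : sqint u -> sqint v -> sqint (fun x => c * u x + v x).
Proof.
move=> su sv; have [mu' iu] := su; have [mv iv] := sv; split.
  by apply: measurable_funD => //; apply: measurable_funM => //; exact: measurable_cst.
have := integrableD mD (integrableD mD (integrableZl mD (c ^+ 2) iu) iv)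
  (integrableZl mD (2 * c) (sqint_mul su sv)).
apply: eq_integrable => // x _ /=; rewrite -!EFinM -!EFinD; congr EFin; ring.
Qed.

Lemma sqintZ c u : sqint u -> sqint (fun x => c * u x).
Proof.
move=> su; have := sqintZD c su sqint0.
by rewrite (_ : (fun x => c * u x + 0) = fun x => c * u x)//; apply/funext => x; rewrite addr0.
Qed.

Lemma sqintD u v : sqint u -> sqint v -> sqint (fun x => u x + v x).
Proof.
move=> su sv; have := sqintZD 1 su sv.
by rewrite (_ : (fun x => 1 * u x + v x) = fun x => u x + v x)//; apply/funext => x; rewrite mul1r.
Qed.

Lemma sqintB u v : sqint u -> sqint v -> sqint (fun x => u x - v x).
Proof.
move=> su sv; have := sqintZD (-1) sv su.
by rewrite (_ : (fun x => -1 * v x + u x) = fun x => u x - v x)//; apply/funext => x; ring.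
Qed.

Lemma ipC u v : ip u v = ip v u.
Proof. by apply: eq_Rintegral => x _; rewrite mulrC. Qed.

Lemma ipZDl c u v w : sqint u -> sqint v -> sqint w ->
  ip (fun x => c * u x + v x) w = c * ip u w + ip v w.
Proof.
move=> su sv sw; have iu := sqint_mul su sw; have iv := sqint_mul sv sw.
rewrite /ip -RintegralZl// -RintegralD//; last exact: (integrableZl mD c iu).
by apply: eq_Rintegral => x _; ring.
Qed.

Lemma ip_ge0 u : 0 <= ip u u.
Proof. by apply: Rintegral_ge0 => x _; rewrite -expr2 sqr_ge0. Qed.

Lemma subspace_sqint : @subspace_pred R (T -> R^o) sqint.
Proof. by split; [exact: sqint0|move=> c x y; exact: sqintZD]. Qed.

Lemma psd_ip : @psd_form R (T -> R^o) sqint ip.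
Proof.
split; first by move=> *; exact: ipC.
- by move=> *; exact: ipZDl.
- by move=> *; exact: ip_ge0.
Qed.

Lemma ip_CS u v : sqint u -> sqint v -> ip u v ^+ 2 <= ip u u * ip v v.
Proof. by move=> su sv; exact: (form_CS subspace_sqint psd_ip). Qed.

Lemma ip_EFin u : sqint u -> (\int[mu]_(x in D) (u x ^+ 2)%:E)%E = (ip u u)%:E.
Proof.
by move=> [mu' iu]; rewrite /ip /Rintegral fineK//; exact: (integrable_fin_num mD iu).
Qed.

Lemma sqint_ltyP u : measurable_fun D (u : T -> measurableTypeR R) ->
  (\int[mu]_(x in D) (u x ^+ 2)%:E < +oo)%E -> sqint u.
Proof.
move=> mu' h; split => //; apply/integrableP; split.
  by apply/measurable_EFinP; exact: measurable_funX.
by under eq_integral do rewrite gee0_abs ?lee_fin ?sqr_ge0//.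
Qed.

Lemma ip_eq0 u : sqint u -> ip u u = 0 -> {ae mu, forall x, D x -> u x = 0}.
Proof.
move=> su u0; have [mu' iu] := su.
have h : ae_eq mu D (fun x => (u x ^+ 2)%:E) (cst 0%E).
  apply/ae_eq_integral_abs => //; first by apply/measurable_EFinP; exact: measurable_funX.
  by under eq_integral do rewrite gee0_abs ?lee_fin ?sqr_ge0//; rewrite ip_EFin// u0.
apply: filterS h => x /= h Dx; have [/eqP] := h Dx.
by rewrite sqrf_eq0 => /eqP.
Qed.

Lemma ae_ip0 u v : {ae mu, forall x, D x -> u x = 0} ->
  measurable_fun D (u : T -> measurableTypeR R) -> measurable_fun D (v : T -> measurableTypeR R) ->
  ip u v = 0.
Proof.
move=> u0 mu' mv; rewrite /ip /Rintegral.
rewrite (@ae_eq_integral _ _ _ mu D (cst 0%E))//; first by rewrite integral0.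
- by apply/measurable_EFinP; exact: measurable_funM.
- by apply: filterS u0 => x /= h Dx; rewrite h// mul0r.
Qed.

Section complete.
Variable u_ : nat -> T -> R.
Hypothesis su_ : forall n, sqint (u_ n).
Hypothesis cauchy_u : forall e : R, 0 < e -> exists N, forall m n, (N <= m)%N -> (N <= n)%N ->
  ip (u_ m \- u_ n) (u_ m \- u_ n) <= e.

(** Chosen so that [4 ^+ k * w k = 1 / 2 ^+ k.+1], the terms summed by [epsilon_trick]. *)
Let w (k : nat) : R := 8^-1 ^+ k / 2.

Let w_gt0 k : 0 < w k.
Proof. by rewrite divr_gt0// exprn_gt0// invr_gt0. Qed.

(** Adding up the moduli [N_ i] for [i <= k] gives an index above [k] and above every one of them,
    so no recursive extraction is involved. *)
Let subseq_cauchy : exists2 M : nat -> nat, forall k, (k <= M k)%N & forall k j, (k <= j)%N ->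
  ip (u_ (M j) \- u_ (M k)) (u_ (M j) \- u_ (M k)) <= w k.
Proof.
have [N_ hN] := boolp.choice (fun k => cauchy_u (w_gt0 k)).
exists (fun k => k + \sum_(i < k.+1) N_ i)%N => [k|k j kj]; first exact: leq_addr.
apply: hN.
  by rewrite (bigD1 (Ordinal (kj : (k < j.+1)%N)))//= addnCA leq_addr.
by rewrite (bigD1 (ord_max : 'I_k.+1))//= addnCA leq_addr.
Qed.

(* The subsequence is chosen so that [4 ^ k |f_(k+1) - f_k|^2] is summable in
   [L^1], hence almost everywhere, which makes [f_k] converge geometrically. *)
Let ae_cvg_subseq (f : nat -> T -> R) : (forall k, sqint (f k)) ->
  (forall k j, (k <= j)%N -> ip (f j \- f k) (f j \- f k) <= w k) ->
  {ae mu, forall x, D x -> cvgn (f^~ x)}.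
Proof.
move=> sf hf.
pose h k x := (4 ^+ k * (f k.+1 x - f k x) ^+ 2)%:E.
have h0 k x : D x -> (0 <= h k x)%E.
  by move=> _; rewrite lee_fin mulr_ge0 ?sqr_ge0// exprn_ge0.
have sB k : sqint (f k.+1 \- f k) := sqintB (sf _) (sf _).
have mh k : measurable_fun D (h k).
  apply/measurable_EFinP; apply: measurable_funM; first exact: measurable_cst.
  by apply: measurable_funX; have [] := sB k.
have mS : measurable_fun D (fun x => \sum_(0 <= k <oo) h k x)%E.
  by apply: (@ge0_emeasurable_sum _ _ _ D h xpredT) => // k x Dx _; exact: h0.
have S0 x : D x -> (0 <= \sum_(0 <= k <oo) h k x)%E.
  by move=> Dx; apply: nneseries_ge0 => k _ _; exact: h0.
have iS : mu.-integrable D (fun x => \sum_(0 <= k <oo) h k x)%E.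
  apply/integrableP; split => //.
  rewrite (eq_integral (fun x => \sum_(0 <= k <oo) h k x)%E); last first.
    by move=> x /set_mem Dx; rewrite gee0_abs// S0.
  rewrite integral_nneseries//.
  apply: (@le_lt_trans _ _ (\sum_(0 <= k <oo) (0 + (1 / (2 ^ k.+1)%:R)%:E))%E); last first.
    have := @epsilon_trick R (fun=> 0%E) 1 xpredT (fun=> lexx _) ler01.
    have e0 : (\sum_(0 <= i <oo) (0 : \bar R) = 0)%E by apply: eseries0.
    by rewrite e0 add0e => /le_lt_trans; apply; rewrite ltry.
  apply: lee_nneseries => [k _ _|k _]; first by apply: integral_ge0 => x; exact: h0.
  rewrite add0e /h; under eq_integral do rewrite EFinM.
  have := sB k => -[mB iB].
  rewrite integralZl// -/((f k.+1 \- f k) _).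
  rewrite (_ : (\int[mu]_(x in D) _)%E = (ip (f k.+1 \- f k) (f k.+1 \- f k))%:E); last first.
    by rewrite -ip_EFin.
  rewrite -EFinM lee_fin.
  apply: (@le_trans _ _ (4 ^+ k * w k)).
    by rewrite ler_pM2l ?exprn_gt0//; apply: hf.
  rewrite le_eqVlt; apply/orP; left; apply/eqP.
  rewrite /w mulrA -exprMn (_ : 4 * 8^-1 = 2^-1 :> R); last by field.
  by rewrite natrX div1r exprS invfM exprVn mulrC.
have := integrable_ae mD iS; apply: filterS => x + Dx => /(_ Dx) Sfin.
pose C := fine (\sum_(0 <= k <oo) h k x)%E.
have hC k : 4 ^+ k * (f k.+1 x - f k x) ^+ 2 <= C.
  rewrite -lee_fin fineK//; apply: le_trans (nneseries_lim_ge k.+1 _); last first.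
    by move=> n _ _; exact: h0.
  rewrite big_nat_recr//= leeDr// sume_ge0// => i _; exact: h0.
have C0 : 0 <= C by apply: le_trans (hC 0%N); rewrite mulr_ge0 ?sqr_ge0// exprn_ge0.
have step k : `|f k.+1 x - f k x| <= Num.sqrt C * 2^-1 ^+ k.
  have p0 : 0 < 2 ^+ k :> R by rewrite exprn_gt0.
  rewrite exprVn ler_pdivlMr// -(ger0_norm (ltW p0)) -normrM -sqrtr_sqr.
  apply: ler_wsqrtr; apply: le_trans (hC k).
  by rewrite exprMn -exprM mulnC exprM mulrC (_ : 2 ^+ 2 = 4 :> R)//; ring.
have cs : cvgn (series (telescope (f^~ x))).
  apply: normed_cvg; apply: (@series_le_cvg _ _ (geometric (Num.sqrt C) 2^-1)).
  - by move=> n; exact: normr_ge0.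
  - by move=> n; rewrite /geometric/= mulr_ge0 ?sqrtr_ge0// exprn_ge0// invr_ge0.
  - by move=> n; exact: step.
  - by apply: is_cvg_geometric_series; rewrite ger0_norm ?invr_ge0// invf_lt1// ltr1n.
rewrite (_ : f^~ x = fun n => f 0%N x + series (telescope (f^~ x)) n); last first.
  by apply/funext => n; exact: eq_sum_telescope.
by apply: is_cvgD => //; exact: is_cvg_cst.
Qed.

Lemma sqint_complete : exists u, sqint u /\
  ip (u_ n \- u) (u_ n \- u) @[n --> \oo] --> (0 : R).
Proof.
have [M Mk hM] := subseq_cauchy.
pose f k := u_ (M k).
have sf k : sqint (f k) by exact: su_.
(* The upper limit is measurable and defined everywhere. At almost every point of [D] the sequence
   converges to a real number and [u] is its limit. *)
pose u x := fine (limn_esup (fun k => (f k x)%:E)).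
have cf := ae_cvg_subseq sf hM.
have fu : {ae mu, forall x, D x -> f k x @[k --> \oo] --> u x}.
  apply: filterS cf => x + Dx => /(_ Dx) cx.
  have e : (f k x)%:E @[k --> \oo] --> (limn (f^~ x))%:E.
    by apply: cvg_EFin => //; near=> k.
  by rewrite /u (cvg_limn_einf_sup e).2.
have mu' : measurable_fun D (u : T -> measurableTypeR R).
  apply: (@measurableT_comp _ _ _ _ _ _ (@fine R)); first exact: fine_measurable.
  by apply: measurable_fun_limn_esup => k; apply/measurable_EFinP; have [] := sf k.
(* Fatou's lemma applied to [(f (j + k) - f k) ^+ 2] as [j] grows. *)
have bound k : (\int[mu]_(x in D) ((u \- f k) x ^+ 2)%:E <= (w k)%:E)%E.
  pose g j x := (((f (j + k)%N \- f k) x) ^+ 2)%:E.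
  have mg j : measurable_fun D (g j).
    apply/measurable_EFinP; apply: measurable_funX.
    by have [] := sqintB (sf (j + k)%N) (sf k).
  have g0 j x : D x -> (0 <= g j x)%E by move=> _; rewrite lee_fin sqr_ge0.
  have gu : ae_eq mu D (fun x => ((u \- f k) x ^+ 2)%:E) (fun x => limn_einf (g^~ x)).
    apply: filterS fu => x + Dx => /(_ Dx) cx.
    apply/esym; apply: (cvg_limn_einf_sup _).1; apply: cvg_EFin.
      by near=> j.
    apply: (@cvg_comp _ _ _ _ (fun y : R => y ^+ 2)); last exact: exprn_continuous.
    apply: cvgB; last exact: cvg_cst.
    by rewrite (cvg_shiftn k (f^~ x)).
  rewrite (ge0_ae_eq_integral mD _ _ _ _ gu); last 4 first.
  - by apply/measurable_EFinP; apply: measurable_funX; apply: measurable_funB => //; have [] := sf k.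
  - rewrite (_ : (fun x => _) = (fun x => - limn_esup (fun j => - g j x))%E); last first.
      apply/funext => x; rewrite -limn_einfN; congr limn_einf.
      by apply/funext => j; rewrite /comp oppeK.
    apply: measurableT_comp => //; apply: measurable_fun_limn_esup => j.
    exact: measurableT_comp.
  - by move=> x _; rewrite lee_fin sqr_ge0.
  - by move=> x Dx; rewrite limn_einf_lim; apply: lime_ge; [exact: is_cvg_einfs|near=> n;
      apply: le_ereal_inf_tmp => _ [j _ <-]; exact: g0].
  apply: (le_trans (fatou mu mD mg g0)).
  rewrite limn_einf_lim; apply: lime_le; first exact: is_cvg_einfs.
  near=> n; apply: (@le_trans _ _ (\int[mu]_(x in D) g n x)%E).
    by apply: ereal_inf_lbound; exists n => /=.
  rewrite /g ip_EFin; last exact: sqintB.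
  by rewrite lee_fin; apply: hM; rewrite leq_addl.
have sB k : sqint (u \- f k).
  apply: sqint_ltyP; last by rewrite (le_lt_trans (bound k))// ltry.
  by apply: measurable_funB => //; have [] := sf k.
have su : sqint u.
  have := sqintD (sB 0%N) (sf 0%N).
  by rewrite (_ : (fun x => _) = u)//; apply/funext => x /=; rewrite subrK.
exists u; split => //.
apply/cvgrPdist_le => e e0.
have e4 : 0 < e / 4 by rewrite divr_gt0.
have [N hN] := cauchy_u e4.
have wlim : \forall k \near \oo, w k <= e / 4.
  have : w k @[k --> \oo] --> (0 : R).
    rewrite -(mul0r (2^-1 : R)); apply: cvgMl; apply: cvg_expr.
    by rewrite ger0_norm ?invr_ge0// invf_lt1// ltr1n.
  move=> /cvgrPdist_le/(_ _ e4); apply: filterS => k.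
  by rewrite sub0r normrN ger0_norm// ltW.
have [k0 _ hk0] := wlim.
pose k := maxn k0 N; have wk : w k <= e / 4 by apply: hk0; exact: leq_maxl.
near=> n.
rewrite sub0r normrN ger0_norm ?ip_ge0//.
have h1 : ip (u_ n \- u_ (M k)) (u_ n \- u_ (M k)) <= e / 4.
  apply: hN; first by near: n; exact: nbhs_infty_ge.
  by apply: leq_trans (Mk k); exact: leq_maxr.
have h2 : ip (u \- f k) (u \- f k) <= e / 4.
  by apply: le_trans wk; rewrite -lee_fin -ip_EFin.
have /(_ _ _ (sqintB (su_ n) (su_ (M k))) (sB k)) :=
  form_sqrB_le subspace_sqint psd_ip.
rewrite (_ : _ - _ = u_ n \- u); last first.
  apply/funext => x; rewrite -[LHS]/((u_ n x - u_ (M k) x) - (u x - u_ (M k) x)).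
  by rewrite /=; ring.
by move=> h; apply: (le_trans h); lra.
Unshelve. all: by end_near. Qed.

End complete.
End L2.

(** * Lebesgue measure on row vectors *)

Lemma eq_measure_ge0_integral d (T : measurableType d) (R : realType)
    (m1 m2 : {measure set T -> \bar R}) (f : T -> \bar R) :
  (forall A, measurable A -> m1 A = m2 A) ->
  (\int[m1]_x f x = \int[m2]_x f x)%E.
Proof. by move=> h; apply: eq_measure_integral => A mA _; exact: h. Qed.

Section lebesgue_affine.
Variable R : realType.
Local Notation mu := (@lebesgue_measure R).

Let aff (c t : R) : measurableTypeR R -> measurableTypeR R := fun x => c * x + t.

Let measurable_aff c t : measurable_fun setT (aff c t).
Proof.
apply: measurable_funD; last exact: measurable_cst.
by apply: measurable_funM; [exact: measurable_cst|exact: measurable_id].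
Qed.

(** The pushforward under the affine map, scaled by [c], agrees with Lebesgue measure on half-open
    intervals, and these determine it. *)
Lemma lebesgue_measure_affine (c t : R) (A : set R) : 0 < c -> measurable A ->
  (mu ((fun x => c * x + t)%R @^-1` A) = (c^-1)%:E * mu A)%E.
Proof.
move=> c0 mA.
have mf : measurable_fun setT (aff c t) := measurable_aff c t.
have c0' : 0 <= c by exact: ltW.
pose p : {measure set (measurableTypeR R) -> \bar R} := mu.
pose pf : {measure set (measurableTypeR R) -> \bar R} :=
  measure_function_pushforward__canonical__measure_function_Measure p mf.
pose m2 : {measure set (measurableTypeR R) -> \bar R} := mscale (NngNum c0') pf.
have h : mu A = m2 A.
  apply: lebesgue_measure_unique => // _ [[a b]] _ <-.
  rewrite /m2/= /mscale/= /pushforward/=.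
  rewrite (_ : aff c t @^-1` _ = `](a - t) / c, (b - t) / c]%classic); last first.
    apply/seteqP; split => x /=; rewrite !in_itv/= ltr_pdivrMr// ler_pdivlMr//
      ltrBlDr lerBrDr mulrC//.
  rewrite !lebesgue_measure_itv/= !lte_fin ltr_pM2r ?invr_gt0// ltrD2r.
  case: ifPn => _; last by rewrite mule0.
  by rewrite -!EFinB -EFinM; congr EFin; field; rewrite gt_eqF.
rewrite h /m2/= /mscale/= /pushforward/= muleA -EFinM mulVf ?gt_eqF// mul1e.
by [].
Qed.

Lemma ge0_integral_affine (c t : R) (f : R -> \bar R) : 0 < c ->
  measurable_fun setT f -> (forall x, 0 <= f x)%E ->
  (\int[mu]_x f (c * x + t)%R = (c^-1)%:E * \int[mu]_x f x)%E.
Proof.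
move=> c0 mf f0.
have ma : measurable_fun setT (aff c t) := measurable_aff c t.
have c0' : 0 <= c^-1 by rewrite invr_ge0 ltW.
pose p : {measure set (measurableTypeR R) -> \bar R} := mu.
pose pf : {measure set (measurableTypeR R) -> \bar R} :=
  measure_function_pushforward__canonical__measure_function_Measure p ma.
transitivity (\int[pf]_x f x)%E.
  by rewrite /pf/= ge0_integral_pushforward//= => x _; exact: f0.
pose m2 : {measure set (measurableTypeR R) -> \bar R} := mscale (NngNum c0') p.
transitivity (\int[m2]_x f x)%E.
  by apply: eq_measure_ge0_integral => A mA; exact: lebesgue_measure_affine.
by rewrite /m2 ge0_integral_mscale.
Qed.

Lemma ge0_integral_opp (f : R -> \bar R) :
  measurable_fun setT f -> (forall x, 0 <= f x)%E ->
  (\int[mu]_x f (- x)%R = \int[mu]_x f x)%E.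
Proof.
move=> mf f0.
have ma : measurable_fun setT (-%R : measurableTypeR R -> measurableTypeR R).
  exact: oppr_measurable.
pose p : {measure set (measurableTypeR R) -> \bar R} := mu.
pose pf : {measure set (measurableTypeR R) -> \bar R} :=
  measure_function_pushforward__canonical__measure_function_Measure p ma.
transitivity (\int[pf]_x f x)%E.
  by rewrite /pf/= ge0_integral_pushforward//= => x _; exact: f0.
by apply: eq_measure_ge0_integral => A mA; exact: lebesgue_measureN.
Qed.

End lebesgue_affine.

Section rV.
Variable R : realType.
Local Notation mu := (@lebesgue_measure R).
Local Notation leb n := (lebesgue_rV R n).

Lemma integral_rV0 (f : 'rV[R]_0 -> \bar R) : measurable_fun setT f ->
  (\int[leb 0]_x f x = f 0%R)%E.
Proof.
by move=> mf; rewrite /lebesgue_rV integral_dirac// diracE in_setT mul1e.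
Qed.

Lemma ge0_integral_rVS n (f : 'rV[R]_n.+1 -> \bar R) : measurable_fun setT f ->
  (forall x, 0 <= f x)%E ->
  (\int[leb n.+1]_x f x = \int[mu]_s \int[leb n]_v f (consrV (s, v)))%E.
Proof.
move=> mf f0.
have mc : measurable_fun setT (@consrV R n) := @measurable_consrV R n.
rewrite /= /lebesgue_rV_step ge0_integral_pushforward//=.
by rewrite fubini_tonelli1//=; exact: measurableT_comp.
Qed.

Lemma measurable_slice n (f : 'rV[R]_n.+1 -> \bar R) s : measurable_fun setT f ->
  measurable_fun setT (fun v => f (consrV (s, v))).
Proof.
move=> mf; have mc : measurable_fun setT (@consrV R n) := @measurable_consrV R n.
exact: (measurable_fun_pair2 s (measurableT_comp mf mc)).
Qed.

Lemma measurable_int_slice n (f : 'rV[R]_n.+1 -> \bar R) : measurable_fun setT f ->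
  (forall x, 0 <= f x)%E ->
  measurable_fun setT (fun s : measurableTypeR R => \int[leb n]_v f (consrV (s, v)))%E.
Proof.
move=> mf f0; have mc : measurable_fun setT (@consrV R n) := @measurable_consrV R n.
apply: (@measurable_fun_fubini_tonelli_F _ _ _ _ _ (leb n) (f \o @consrV R n)).
  exact: measurableT_comp.
by move=> x; exact: f0.
Qed.

Lemma consrVD n s (v : 'rV[R]_n) t w : consrV (s, v) + consrV (t, w) = consrV (s + t, v + w).
Proof. by apply/rowP => i; rewrite !mxE; case: unlift => // j; rewrite !mxE. Qed.

Lemma consrVN n s (v : 'rV[R]_n) : - consrV (s, v) = consrV (- s, - v).
Proof. by apply/rowP => i; rewrite !mxE; case: unlift => // j; rewrite !mxE. Qed.

Lemma consrVZ n c s (v : 'rV[R]_n) : c *: consrV (s, v) = consrV (c * s, c *: v).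
Proof. by apply/rowP => i; rewrite !mxE; case: unlift => // j; rewrite !mxE. Qed.

Lemma unconsrVK n (v : 'rV[R]_n.+1) : consrV (unconsrV v) = v.
Proof.
apply/rowP => i; rewrite !mxE; case: unliftP => [j|] ->; last by [].
by rewrite !mxE.
Qed.

Lemma measurable_rV_affine n (c : R) (a : 'rV[R]_n) :
  measurable_fun setT (fun x : 'rV[R]_n => c *: x + a).
Proof.
apply: measurable_fun_rVP => i.
rewrite (_ : (fun _ => _) = fun x : 'rV[R]_n => c * x 0 i + a 0 i); last first.
  by apply/funext => x; rewrite !mxE.
apply: measurable_funD; last exact: measurable_cst.
by apply: measurable_funM; [exact: measurable_cst|exact: measurable_rV_coord].
Qed.

(** Induction on the dimension through Tonelli: the leading coordinate is moved by the
    one-dimensional change of variables, the remaining block by the induction hypothesis. *)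
Lemma ge0_integral_rV_shift n (a : 'rV[R]_n) (f : 'rV[R]_n -> \bar R) :
  measurable_fun setT f -> (forall x, 0 <= f x)%E ->
  (\int[leb n]_x f (x + a)%R = \int[leb n]_x f x)%E.
Proof.
elim: n => [|n IH] in a f * => mf f0.
  have ms : measurable_fun setT (fun x : 'rV[R]_0 => f (x + a)).
    apply: measurableT_comp => //; have := measurable_rV_affine 1 a.
    by under eq_fun do rewrite scale1r.
  by rewrite !integral_rV0//; congr f; apply/rowP => -[].
have ms : measurable_fun setT (fun x : 'rV[R]_n.+1 => f (x + a)).
  apply: measurableT_comp => //; have := measurable_rV_affine 1 a.
  by under eq_fun do rewrite scale1r.
rewrite !ge0_integral_rVS//.
pose F s := (\int[leb n]_v f (consrV (s, v)))%E.
have F0 s : (0 <= F s)%E by apply: integral_ge0 => v _.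
have mF : measurable_fun setT (F : measurableTypeR R -> \bar R) by exact: measurable_int_slice.
transitivity (\int[mu]_s F (1 * s + a 0 0)%R)%E; last first.
  by rewrite ge0_integral_affine// invr1 mul1e.
apply: eq_integral => s _; rewrite mul1r.
rewrite -[RHS](IH (unconsrV a).2 (fun v => f (consrV (s + a 0 0, v))))//; last exact: measurable_slice.
by apply: eq_integral => v _; rewrite -{1}(unconsrVK a) consrVD.
Qed.

Lemma ge0_integral_rV_opp n (f : 'rV[R]_n -> \bar R) :
  measurable_fun setT f -> (forall x, 0 <= f x)%E ->
  (\int[leb n]_x f (- x)%R = \int[leb n]_x f x)%E.
Proof.
elim: n => [|n IH] in f * => mf f0.
  have ms : measurable_fun setT (fun x : 'rV[R]_0 => f (- x)).
    apply: measurableT_comp => //; have := @measurable_rV_affine 0 (-1) 0.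
    by under eq_fun do rewrite scaleN1r addr0.
  by rewrite !integral_rV0//; congr f; apply/rowP => -[].
have ms : measurable_fun setT (fun x : 'rV[R]_n.+1 => f (- x)).
  apply: measurableT_comp => //; have := @measurable_rV_affine n.+1 (-1) 0.
  by under eq_fun do rewrite scaleN1r addr0.
rewrite !ge0_integral_rVS//.
pose F s := (\int[leb n]_v f (consrV (s, v)))%E.
have F0 s : (0 <= F s)%E by apply: integral_ge0 => v _.
have mF : measurable_fun setT (F : measurableTypeR R -> \bar R) by exact: measurable_int_slice.
transitivity (\int[mu]_s F (- s)%R)%E; last by rewrite ge0_integral_opp.
apply: eq_integral => s _.
rewrite -[RHS](IH (fun v => f (consrV (- s, v))))//; last exact: measurable_slice.
by apply: eq_integral => v _; rewrite consrVN.
Qed.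

Lemma integral_rV_shift n (a : 'rV[R]_n) (f : 'rV[R]_n -> \bar R) :
  measurable_fun setT f ->
  (\int[leb n]_x f (x + a)%R = \int[leb n]_x f x)%E.
Proof.
move=> mf; rewrite integralE [RHS]integralE; congr (_ - _)%E.
- transitivity (\int[leb n]_x (f^\+ (x + a)%R))%E.
  by apply: eq_integral => x _; rewrite !funepos.unlock.
  by apply: ge0_integral_rV_shift => //; exact: measurable_funepos.
- transitivity (\int[leb n]_x (f^\- (x + a)%R))%E.
  by apply: eq_integral => x _; rewrite !funeneg.unlock.
  by apply: ge0_integral_rV_shift => //; exact: measurable_funeneg.
Qed.

Lemma integral_rV_opp n (f : 'rV[R]_n -> \bar R) :
  measurable_fun setT f ->
  (\int[leb n]_x f (- x)%R = \int[leb n]_x f x)%E.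
Proof.
move=> mf; rewrite integralE [RHS]integralE; congr (_ - _)%E.
- transitivity (\int[leb n]_x (f^\+ (- x)%R))%E.
  by apply: eq_integral => x _; rewrite !funepos.unlock.
  by apply: ge0_integral_rV_opp => //; exact: measurable_funepos.
- transitivity (\int[leb n]_x (f^\- (- x)%R))%E.
  by apply: eq_integral => x _; rewrite !funeneg.unlock.
  by apply: ge0_integral_rV_opp => //; exact: measurable_funeneg.
Qed.

Lemma integral_rV_reflect n (a : 'rV[R]_n) (f : 'rV[R]_n -> \bar R) :
  measurable_fun setT f ->
  (\int[leb n]_x f (a - x)%R = \int[leb n]_x f x)%E.
Proof.
move=> mf; rewrite -[RHS]integral_rV_opp// -[RHS](integral_rV_shift (- a)).
  by apply: eq_integral => x _; rewrite opprD opprK addrC.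
apply: measurableT_comp => //; have := @measurable_rV_affine n (-1) 0.
by under eq_fun do rewrite scaleN1r addr0.
Qed.

Lemma measurable_prod_coord n (f : 'I_n -> R -> R) :
  (forall i, measurable_fun setT (f i : measurableTypeR R -> measurableTypeR R)) ->
  measurable_fun setT (fun x : 'rV[R]_n => \prod_i f i (x 0 i) : measurableTypeR R).
Proof.
move=> mf; apply: measurable_prod => i _.
by apply: (measurableT_comp (mf i)); exact: measurable_rV_coord.
Qed.

Lemma integral_prod_coord n (f : 'I_n -> R -> R) :
  (forall i, measurable_fun setT (f i : measurableTypeR R -> measurableTypeR R)) ->
  (forall i t, 0 <= f i t) ->
  (\int[leb n]_x (\prod_i f i (x 0 i))%:E = \prod_i \int[mu]_t (f i t)%:E)%E.
Proof.
elim: n => [|n IH] in f * => mf f0.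
  rewrite integral_rV0 ?big_ord0//.
  apply/measurable_EFinP; exact: measurable_prod_coord.
have p0 m (g : 'I_m -> R) : (forall i, 0 <= g i) -> 0 <= \prod_i g i.
  by move=> g0; apply: prodr_ge0 => i _.
rewrite ge0_integral_rVS; last 2 first.
- by apply/measurable_EFinP; exact: measurable_prod_coord.
- by move=> x; rewrite lee_fin; exact: p0.
rewrite big_ord_recl.
transitivity (\int[mu]_s ((f ord0 s)%:E *
    \prod_i \int[mu]_t (f (lift ord0 i) t)%:E))%E.
  apply: eq_integral => s _; rewrite -IH//.
  rewrite -ge0_integralZl//; last 3 first.
  - apply/measurable_EFinP.
    exact: (measurable_prod_coord (f := fun i => f (lift ord0 i))).
  - by move=> x _; rewrite lee_fin; exact: p0.
  - by rewrite lee_fin.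
  apply: eq_integral => v _; rewrite big_ord_recl consrV0 -EFinM; congr (_ * _)%:E.
  by apply: eq_bigr => i _; rewrite consrVS.
rewrite ge0_integralZr//.
- by apply/measurable_EFinP; exact: mf.
- by move=> s _; rewrite lee_fin.
- by apply: prode_ge0 => i _; apply: integral_ge0 => t _; rewrite lee_fin.
Qed.

Lemma measurable_rV_box n (A : 'I_n -> set R) : (forall i, measurable (A i : set (measurableTypeR R))) ->
  measurable [set x : 'rV[R]_n | forall i, A i (x 0 i)].
Proof.
move=> mA; rewrite (_ : [set x | _] = \bigcap_(i in [set: 'I_n]) [set x : 'rV[R]_n | A i (x 0 i)]); last first.
  apply/seteqP; split => x /= h i; first by move=> _; exact: h.
  exact: h.
apply: fin_bigcap_measurable => // i _.
by have := @measurable_rV_coord R n i measurableT (A i) (mA i); rewrite setTI.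
Qed.

Lemma lebesgue_rV_box_lty n (L : R) :
  (leb n [set x : 'rV[R]_n | forall i, (`|x ord0 i| <= L)%R] < +oo)%E.
Proof.
have mI : measurable ([set t | `|t| <= L] : set (measurableTypeR R)).
  rewrite (_ : [set t | _] = `[- L, L]%classic); first exact: measurable_itv.
  by apply/seteqP; split => t /=; rewrite in_itv/= ler_norml.
have mB := @measurable_rV_box n (fun=> [set t | `|t| <= L]) (fun=> mI).
rewrite -[X in leb n X]setIT -integral_indic//.
rewrite (eq_integral (fun x : 'rV[R]_n => (\prod_i \1_[set t | `|t| <= L] (x 0 i))%:E)); last first.
  move=> x _; congr EFin; rewrite indicE; case: (boolP (x \in _)) => [/set_mem /= h|].
    by rewrite big1// => i _; rewrite indicE mem_set//=; exact: h.
  rewrite notin_setE/= -existsNE => -[i hi].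
  by rewrite (bigD1 i)//= indicE memNset// mul0r.
rewrite (integral_prod_coord (f := fun=> \1_[set t | `|t| <= L]))//.
  rewrite -ge0_fin_numE; last by apply: prode_ge0 => i _; apply: integral_ge0 => t _; rewrite lee_fin.
  apply: prode_fin_num => i _; rewrite integral_indic// setIT.
  rewrite ge0_fin_numE//; rewrite (_ : [set t | _] = `[- L, L]%classic).
    suff : (mu `[(- L)%R, L]%classic < +oo)%E by [].
    by rewrite lebesgue_measure_itv/=; case: ifP => //; rewrite ?ltry// -EFinB ltry.
  by apply/seteqP; split => t /=; rewrite in_itv/= ler_norml.
Qed.

Lemma rV_ballE n (x y : 'rV[R]_n) (e : R) : 0 < e ->
  ball x e y <-> forall i, `|x 0 i - y 0 i| < e.
Proof.
move=> e0; split=> [[_ h] i|h]; first exact: (h 0 i).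
by split => // i j; rewrite ord1; exact: h.
Qed.

Lemma measurable_rV_ball n (x : 'rV[R]_n) (e : R) : 0 < e -> measurable (ball x e).
Proof.
move=> e0; rewrite (_ : ball x e = [set y | forall i, ball (x 0 i) e (y 0 i)]); last first.
  by apply/seteqP; split => y /(rV_ballE _ _ e0).
by apply: (measurable_rV_box (A := fun i => ball (x 0 i) e)) => i; exact: measurable_ball.
Qed.

Lemma rat_approx (x e : R) : 0 < e -> exists q : rat, `|x - ratr q| < e.
Proof.
move=> e0; have xe : x < x + e by rewrite ltrDl.
have [q] := rat_in_itvoo xe; rewrite in_itv/= => /andP[q1 q2].
by exists q; rewrite ltr_norml; apply/andP; split; lra.
Qed.

(** The sigma-algebra is generated by the coordinates, so an open set has to be written as a
    countable union of boxes: sup-norm balls with rational centres and radii [1 / k.+1]. *)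
Lemma open_rV_measurable n (A : set 'rV[R]_n) : open A -> measurable A.
Proof.
move=> oA.
pose B (qk : 'rV[rat]_n * nat) := ball (map_mx ratr qk.1 : 'rV[R]_n) (qk.2.+1%:R^-1).
have e0 k : 0 < k.+1%:R^-1 :> R by rewrite invr_gt0.
rewrite (_ : A = \bigcup_(qk in [set qk | B qk `<=` A]) B qk).
  rewrite bigcup_mkcond; apply: countable_bigcupT_measurable => // qk.
  by case: ifP => // _; exact: measurable_rV_ball.
apply/seteqP; split => [x Ax|x [qk /= + ]]; last by apply.
have /nbhs_ballP[e /= e_gt0 eA] : nbhs x A by exact: open_nbhs_nbhs.
have [k hk] : exists k, 2 * k.+1%:R^-1 < e.
  have e2 : 0 < e / 2 by rewrite divr_gt0.
  have [k _ /(_ k (leqnn k)) hk] := near_infty_natSinv_lt (PosNum e2).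
  by exists k; rewrite -ltr_pdivlMl// mulrC.
have [q hq] := boolp.choice (fun i => rat_approx (x 0 i) (e0 k)).
have xq : B (\row_i q i, k) x.
  apply/(rV_ballE _ _ (e0 k)) => i; rewrite !mxE distrC; exact: hq.
exists (\row_i q i, k) => //= y yq; apply: eA; apply/(rV_ballE _ _ e_gt0) => i.
move/(rV_ballE _ _ (e0 k))/(_ i) : xq; move/(rV_ballE _ _ (e0 k))/(_ i) : yq => /=.
rewrite !mxE; set z := ratr _; move: hk; set d : R := k.+1%:R^-1 => hk; rewrite !ltr_norml => /andP[h1 h2] /andP[h3 h4].
by apply/andP; split; lra.
Qed.

Lemma continuous_rV_measurable n (f : 'rV[R]_n -> R) : continuous f ->
  measurable_fun setT (f : 'rV[R]_n -> measurableTypeR R).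
Proof.
move=> /continuousP cf; apply: (measurability _ (RGenOpens.measurableE R)).
move=> _ [_ [a [b ->] <-]]; rewrite setTI.
by apply: open_rV_measurable; apply: cf; exact: interval_open.
Qed.

End rV.

(** * Smooth bumps *)

Lemma scale_mulr (R : numFieldType) (a b : R) : a *: b = a * b.
Proof. by []. Qed.

Section flat.
Variable R : realType.
Implicit Types (p q : {poly R}) (t s : R).

(** This is [s / k <= expR (s / k)] raised to the power [k]. *)
Lemma pow_le_expR k s : 0 <= s -> s ^+ k <= k%:R ^+ k * expR s.
Proof.
move=> s0; case: k => [|k]; first by rewrite !expr0 mul1r -expR0 ler_expR.
have k0 : 0 < k.+1%:R :> R by rewrite ltr0n.
rewrite {2}(_ : s = (s / k.+1%:R) *+ k.+1); last by rewrite -mulr_natr divfK ?gt_eqF.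
rewrite -[X in expR X]mulr_natl expRM_natl -exprMn lerXn2r ?nnegrE ?mulr_ge0 ?expR_ge0//.
rewrite -ler_pdivrMl// mulrC; apply: le_trans (expR_ge1Dx _).
by rewrite lerDr.
Qed.

Lemma poly_le_expR p : exists2 C : R, 0 <= C & forall s, 0 <= s -> `|p.[s]| <= C * expR s.
Proof.
exists (\sum_(i < size p) `|p`_i| * i%:R ^+ i).
  by apply: sumr_ge0 => i _; rewrite mulr_ge0// exprn_ge0.
move=> s s0; rewrite horner_coef (le_trans (ler_norm_sum _ _ _))// mulr_suml.
apply: ler_sum => i _; rewrite normrM -mulrA ler_wpM2l// ger0_norm ?exprn_ge0//.
exact: pow_le_expR.
Qed.

(** The functions [p(1/t) exp(-1/t)], extended by 0, form a class stable under differentiation;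
    smoothness of the bump is tracked by polynomials alone. *)
Definition flat p t := if 0 < t then p.[t^-1] * expR (- t^-1) else 0.

(** From the chain rule: [p(1/t) exp(-1/t)] has derivative [t^-2 (p - p')(1/t) exp(-1/t)]. *)
Definition dflat p : {poly R} := 'X^2 * (p - p^`()).

(** Quadratic decay forces the difference quotient at the junction point 0 to vanish. It follows
    from [poly_le_expR] for ['X^2 * p] at [1 / t]. *)
Lemma flat_le p : exists C : R, forall t, `|flat p t| <= C * t ^+ 2.
Proof.
have [C C0 hC] := poly_le_expR ('X^2 * p).
exists C => t; rewrite /flat; case: ifPn => [t0|_]; last first.
  by rewrite normr0 mulr_ge0// sqr_ge0.
have := hC t^-1 (ltW (_ : 0 < t^-1)); rewrite invr_gt0 => /(_ t0).
have t1 : 0 < t^-1 by rewrite invr_gt0.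
rewrite hornerM hornerXn normrM ger0_norm ?exprn_ge0 ?(ltW t1)// => h.
rewrite normrM (ger0_norm (expR_ge0 _)) expRN -ler_pdivlMr ?invr_gt0 ?expR_gt0//.
rewrite invrK -(ler_pM2l (_ : 0 < t^-1 ^+ 2)); last by rewrite exprn_gt0 ?invr_gt0.
apply: (le_trans h); rewrite mulrA [_ * (C * _)]mulrCA -exprMn mulVf ?gt_eqF//.
by rewrite expr1n mulr1.
Qed.

Lemma flat_le0 p t : t <= 0 -> flat p t = 0.
Proof. by rewrite /flat leNgt => /negbTE ->. Qed.

End flat.

Lemma cvg_is_derive (R : numFieldType) (V W : normedModType R) (f : V -> W) x v l :
  h^-1 *: (f (h *: v + x) - f x) @[h --> (0 : R)^'] --> l -> is_derive x v f l.
Proof. by move=> h; apply: DeriveDef; [apply/cvg_ex; exists l|exact: cvg_lim]. Qed.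

Lemma is_derive_cvg (R : numFieldType) (V W : normedModType R) (f : V -> W) x v l :
  is_derive x v f l -> h^-1 *: (f (h *: v + x) - f x) @[h --> (0 : R)^'] --> l.
Proof. by move=> [fv <-]; exact: fv. Qed.

Section bump.
Variable R : realType.
Implicit Types (p q : {poly R}) (t : R) (s : seq ({poly R} * {poly R})).

Lemma is_derive_flat p t : is_derive t 1 (flat p) (flat (dflat p) t).
Proof.
have [t0|t0|->] := ltgtP t 0.
- rewrite [X in is_derive _ _ _ X]flat_le0 ?ltW//.
  have d0 : is_derive t 1 (cst 0 : R -> R) 0 by exact: is_derive_cst.
  apply: near_eq_is_derive d0.
  near=> y; rewrite flat_le0// ltW//.
  by near: y; exact: lt_nbhsl.
- suff d : is_derive t 1 (fun y : R => p.[y^-1] * expR (- y^-1)) (flat (dflat p) t).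
    apply: near_eq_is_derive d; near=> y; rewrite /flat ifT//.
    by near: y; exact: lt_nbhsr.
  have tn0 : t != 0 by rewrite gt_eqF.
  have dV : is_derive t 1 (fun y : R => y^-1) (- t ^- 2).
    have := @is_deriveV R id t 1 1 tn0 (is_derive_id _ _).
    by rewrite scaler1.
  have d1 : is_derive t 1 (horner p \o (fun y : R => y^-1)) (p^`().[t^-1] * - t ^- 2).
    exact: is_derive1_comp.
  have d2 : is_derive t 1 (expR \o (fun y : R => - y^-1)) (expR (- t^-1) * - - t ^- 2).
    exact: is_derive1_comp.
  have := is_deriveM d1 d2; congr is_derive.
  rewrite /flat t0 /dflat hornerM hornerXn hornerD hornerN /= !scale_mulr.
  by rewrite exprVn; ring.
- rewrite [X in is_derive _ _ _ X]flat_le0//; apply: cvg_is_derive.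
  have [C hC] := flat_le p.
  apply/norm_cvg0P.
  apply: (@squeeze_cvgr _ _ _ _ (fun=> 0) (fun h : R => C * `|h|)).
  + near=> h; rewrite normr_ge0/= addr0 (flat_le0 p (lexx 0)) subr0.
    have h0 : h != 0 by near: h; exact: nbhs_dnbhs_neq.
    have h1 : 0 < `|h| by rewrite normr_gt0.
    rewrite [h *: 1]mulr1 [_ *: _]/(_ * _) normrM normfV ler_pdivrMl// mulrCA -expr2.
    by rewrite real_normK ?num_real.
  + exact: cvg_cst.
  + rewrite -[X in _ --> X](mulr0 C); apply: cvgMr.
    rewrite -[X in _ --> X](normr0 R); apply: cvg_norm.
    exact: cvg_within.
Unshelve. all: by end_near.
Qed.

(** Sums of products of flat functions at the two endpoints are stable under the product rule;
    [dbump_seq] is that rule on the list of polynomial pairs. *)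
Definition bump_sum s t :=
  \sum_(pq <- s) flat pq.1 (1 + t) * flat pq.2 (1 - t).

Fixpoint dbump_seq (s : seq ({poly R} * {poly R})) :=
  if s is (p, q) :: s' then [:: (dflat p, q), (p, - dflat q) & dbump_seq s'] else [::].

Lemma flatN p t : flat (- p) t = - flat p t.
Proof. by rewrite /flat; case: ifP => _; rewrite ?oppr0// hornerN mulNr. Qed.

Lemma is_derive_bump_sum s t : is_derive t 1 (bump_sum s) (bump_sum (dbump_seq s) t).
Proof.
elim: s => [|[p q] s IH].
  rewrite (_ : bump_sum [::] = cst 0); last by apply/funext => y; rewrite /bump_sum big_nil.
  exact: is_derive_cst.
rewrite (_ : bump_sum ((p, q) :: s) =
    (fun y => flat p (1 + y) * flat q (1 - y)) \+ bump_sum s); last first.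
  by apply/funext => y; rewrite /bump_sum big_cons.
have d1 : is_derive t 1 (flat p \o (fun y => 1 + y)) (flat (dflat p) (1 + t) * (0 + 1)).
  apply: is_derive1_comp; first exact: is_derive_flat.
have d2 : is_derive t 1 (flat q \o (fun y => 1 - y)) (flat (dflat q) (1 - t) * (0 - 1)).
  apply: is_derive1_comp; first exact: is_derive_flat.
have := is_deriveD (is_deriveM d1 d2) IH; congr is_derive.
rewrite /bump_sum /dbump_seq -/dbump_seq !big_cons/= flatN !scale_mulr; ring.
Qed.

(** The [m]-th derivative of the standard bump [exp(-1/(1+t)) exp(-1/(1-t))] on []-1, 1[]. *)
Definition bump m := bump_sum (iter m dbump_seq [:: (1, 1)]).

Lemma is_derive_bump m t : is_derive t 1 (bump m) (bump m.+1 t).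
Proof. exact: is_derive_bump_sum. Qed.

Lemma continuous_bump m : continuous (bump m).
Proof.
move=> t; apply: differentiable_continuous; apply/derivable1_diffP.
by have [] := is_derive_bump m t.
Qed.

Lemma bump_eq0 m t : 1 <= `|t| -> bump m t = 0.
Proof.
move=> t1; rewrite /bump /bump_sum big1// => -[p q] _ /=.
have [t0|t0] := leP 0 t.
  by rewrite (@flat_le0 _ q) ?mulr0// subr_le0 -(ger0_norm t0).
by rewrite flat_le0 ?mul0r// -lerBrDl sub0r lerNr -(ltr0_norm t0).
Qed.

Lemma bump_bounded m : exists2 C, 0 < C & forall t, `|bump m t| <= C.
Proof.
suff [C hC] : exists C, forall t, `|bump m t| <= C.
  exists (`|C| + 1) => [|t]; first by rewrite ltr_wpDl.
  by rewrite (le_trans (hC t))// (le_trans (ler_norm C))// lerDl.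
suff [C hC] : exists C, forall t, `|t| < 1 -> `|bump m t| <= C.
  exists (Num.max 0 C) => t; have [t1|t1] := leP 1 `|t|.
    by rewrite bump_eq0// normr0 le_max lexx.
  by rewrite le_max hC ?orbT.
rewrite /bump; elim: (iter _ _ _) => [|[p q] s [C hC]].
  by exists 0 => t _; rewrite /bump_sum big_nil normr0.
have [Cp hp] := flat_le p; have [Cq hq] := flat_le q.
(* For [|t| < 1] both [1 + t] and [1 - t] lie in [[0, 2]], so the squares in [flat_le] are at most
   4. *)
exists (Cp * 4 * (Cq * 4) + C) => t t1; rewrite /bump_sum big_cons.
rewrite (le_trans (ler_normD _ _))// lerD ?hC//= normrM.
have Cp0 : 0 <= Cp by have := le_trans (normr_ge0 _) (hp 1); rewrite expr1n mulr1.
have Cq0 : 0 <= Cq by have := le_trans (normr_ge0 _) (hq 1); rewrite expr1n mulr1.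
move: t1; rewrite ltr_norml => /andP[t1 t2].
apply: ler_pM => //; [apply: le_trans (hp _) _|apply: le_trans (hq _) _];
  rewrite ler_wpM2l//; nra.
Qed.

Lemma bump0E t : bump 0 t = flat 1 (1 + t) * flat 1 (1 - t).
Proof. by rewrite /bump /bump_sum/= big_seq1. Qed.

Lemma bump0_ge0 t : 0 <= bump 0 t.
Proof.
rewrite bump0E /flat; case: ifP => _; last by rewrite mul0r.
by case: ifP => _; rewrite ?mulr0// !hornerC !mul1r mulr_ge0 ?expR_ge0.
Qed.

End bump.

Section smooth_prod.
Variables (R : realType) (n : nat).
Implicit Types (h : 'I_n -> nat -> R -> R) (m : 'I_n -> nat) (x y : 'rV[R]_n).

(** [h i k] stands for the [k]-th derivative of the factor in coordinate [i]. A partial derivative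
    of the tensor product only shifts the multi-index, so iterated partials stay in the class and
    are differentiable. *)
Definition smooth_family h := forall i k (t : R), is_derive t 1 (h i k) (h i k.+1 t).

Definition prod_coord h m x := \prod_i h i (m i) (x 0 i).

Definition incr m (j : 'I_n) := fun i => (m i + (i == j))%N.

Lemma partial_prod_coord h m j : smooth_family h ->
  partial j (prod_coord h m) = prod_coord h (incr m j).
Proof.
move=> sh; apply/funext => x; rewrite /partial.
have := is_derive_cvg (sh j (m j) (x 0 j)).
pose C := \prod_(i | i != j) h i (m i) (x 0 i).
rewrite /prod_coord (bigD1 j)//= /incr eqxx addn1 => hj.
rewrite (eq_bigr (fun i => h i (m i) (x 0 i))); last first.
  by move=> i /negbTE ->; rewrite addn0.
apply: cvg_lim => //.
rewrite (_ : (fun e : R => _) = fun e : R =>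
    (e^-1 *: (h j (m j) (e *: 1 + x 0 j) - h j (m j) (x 0 j))) * C); last first.
  apply/funext => e; rewrite /= (bigD1 j)//= [in X in _ - X](bigD1 j)//=.
  rewrite !mxE !eqxx mulr1 (eq_bigr (fun i => h i (m i) (x 0 i))); last first.
    by move=> i /negbTE ij; rewrite !mxE ij andbF mulr0 add0r.
  by rewrite -/C -mulrBl !scale_mulr mulr1 mulrA.
exact: cvgMl.
Qed.

Lemma differentiable_prod_coord h m x : smooth_family h ->
  differentiable (prod_coord h m) x.
Proof.
move=> sh; rewrite /prod_coord; elim: (index_enum _) => [|i r IH].
  rewrite (_ : (fun y => _) = cst 1); first exact: differentiable_cst.
  by apply/funext => y; rewrite big_nil.
rewrite (_ : (fun y => _) = (fun y : 'rV[R]_n => h i (m i) (y 0 i)) *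
    (fun y : 'rV[R]_n => \prod_(i <- r) h i (m i) (y 0 i))); last first.
  by apply/funext => y; rewrite big_cons.
apply: differentiableM => //.
apply: (@differentiable_comp _ _ _ _ (fun y : 'rV[R]_n => y 0 i) (h i (m i))).
  exact: differentiable_coord.
by apply/derivable1_diffP; have [] := sh i (m i) (x 0 i).
Qed.

Lemma iter_partial_prod_coord h m s : smooth_family h ->
  exists m', iter_partial s (prod_coord h m) = prod_coord h m'.
Proof.
move=> sh; elim: s => [|j s [m' IH]]; first by exists m.
by exists (incr m' j); rewrite /= IH partial_prod_coord.
Qed.

Lemma smooth_on_prod_coord h m U : smooth_family h -> smooth_on U (prod_coord h m).
Proof.
move=> sh s x _; have [m' ->] := iter_partial_prod_coord m s sh.
exact: differentiable_prod_coord.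
Qed.

Variables (a : R) (b : 'I_n -> R).

Definition bump_family (i : 'I_n) (k : nat) (t : R) := a ^+ k * bump k (a * t + b i).

Lemma smooth_bump_family : smooth_family bump_family.
Proof.
move=> i k t; rewrite /bump_family.
have d1 : is_derive t 1 (bump k \o (fun t : R => a * t + b i)) (bump k.+1 (a * t + b i) * (a * 1 + 0)).
  apply: is_derive1_comp; first exact: is_derive_bump.
have := is_deriveZ (a ^+ k) d1; congr is_derive.
by rewrite scale_mulr exprSr; ring.
Qed.

(* [prod_coord bump_family m] is the partial derivative of [bump_rV] of multi-index [m]. *)
Definition bump_rV : 'rV[R]_n -> R := prod_coord bump_family (fun=> 0%N).

Lemma bump_rVE x : bump_rV x = \prod_i bump 0 (a * x 0 i + b i).
Proof. by apply: eq_bigr => i _; rewrite /bump_family expr0 mul1r. Qed.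

Lemma prod_bump_eq0 m x i : 1 <= `|a * x 0 i + b i| -> prod_coord bump_family m x = 0.
Proof.
by move=> h; rewrite /prod_coord (bigD1 i)//= /bump_family bump_eq0// mulr0 mul0r.
Qed.

Lemma compact_bump_support : a != 0 -> compact [set x : 'rV[R]_n | forall i, `|a * x 0 i + b i| <= 1].
Proof.
move=> a0.
rewrite (_ : [set x | _] = [set x : 'rV[R]_n | forall i, `[(- b i) / a - `|a|^-1, (- b i) / a + `|a|^-1]%classic (x 0 i)]).
  exact: rV_compact (fun i => @segment_compact _ _ _).
have a1 : 0 < `|a| by rewrite normr_gt0.
apply/seteqP; split => x /= h i; have := h i; rewrite in_itv/= -ler_distl.
  rewrite (_ : x 0 i - _ = (a * x 0 i + b i) / a); last by field.
  by rewrite normrM normfV ler_pdivrMr// mulVf ?gt_eqF.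
rewrite (_ : x 0 i - _ = (a * x 0 i + b i) / a); last by field.
by rewrite normrM normfV ler_pdivrMr// mulVf ?gt_eqF.
Qed.

Lemma test_function_bump (A : set 'rV[R]_n) : a != 0 ->
  [set x : 'rV[R]_n | forall i, `|a * x 0 i + b i| <= 1] `<=` A -> test_function A bump_rV.
Proof.
move=> a0 sA; split; first by apply: smooth_on_prod_coord; exact: smooth_bump_family.
exists [set x : 'rV[R]_n | forall i, `|a * x 0 i + b i| <= 1]; split => //.
  exact: compact_bump_support.
move=> x /= /existsNP[i /negP]; rewrite -ltNge => h.
by apply: (@prod_bump_eq0 _ _ i); exact: ltW.
Qed.

Lemma partial_bump_rV j x : partial j bump_rV x =
  a * bump 1 (a * x 0 j + b j) * \prod_(i | i != j) bump 0 (a * x 0 i + b i).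
Proof.
rewrite /bump_rV partial_prod_coord; last exact: smooth_bump_family.
rewrite /prod_coord (bigD1 j)//= /incr eqxx /bump_family expr1; congr (_ * _).
by apply: eq_bigr => i /negbTE ->; rewrite expr0 mul1r.
Qed.

End smooth_prod.

(** * The Prekopa-Leindler inequality *)

Section prekopa_leindler_1d.
Variable R : realType.
Local Notation mu := (@lebesgue_measure R).

(** For compact [V] in [A] and [W] in [B], let [v] be the greatest point of [V] and [w] the least of
    [W]. The half-size copies [(V + w) / 2] and [(v + W) / 2] both lie in [C], on opposite sides of
    [(v + w) / 2], so their measures add up. *)
Lemma brunn_minkowski_1d (A B C : set R) :
  measurable A -> measurable B -> measurable C ->
  (mu A < +oo)%E -> (mu B < +oo)%E -> A !=set0 -> B !=set0 ->
  (forall a b, A a -> B b -> C ((a + b) / 2)) ->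
  (mu A + mu B <= 2%:E * mu C)%E.
Proof.
move=> mA mB mC fA fB [a0 Aa0] [b0 Bb0] AB.
apply/lee_addgt0Pr => e e0.
have e2 : 0 < e / 2 by rewrite divr_gt0.
have approx D d0 : measurable D -> (mu D < +oo)%E -> D d0 -> exists V : set R,
    [/\ compact V, V `<=` D, V !=set0 & (mu D <= mu V + (e / 2)%:E)%E].
  move=> mD fD Dd0; have [V [cV VD hV]] := lebesgue_regularity_inner mD fD e2.
  (* The added point keeps the compact set nonempty, so that it has extreme points. *)
  exists (V `|` [set d0]).
  have cV' : compact (V `|` [set d0]) by apply: compactU => //; exact: compact_set1.
  split => //; first by move=> x [/VD//|->].
    by exists d0; right.
  have mV : measurable V by exact: compact_measurable.
  have mV' : measurable (V `|` [set d0]) by exact: compact_measurable.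
  rewrite -(setDUK VD) measureU//; last 2 first.
  - exact: measurableD.
  - by rewrite setDE setICA setICr setI0.
  apply: leeD; last exact: ltW.
  by apply: le_measure; rewrite ?inE//; exact: subsetUl.
have [V [cV VA V0 hV]] := approx A a0 mA fA Aa0.
have [W [cW WB W0 hW]] := approx B b0 mB fB Bb0.
have mV : measurable V by exact: compact_measurable.
have mW : measurable W by exact: compact_measurable.
have [v Vv vmax] : exists2 v, V v & forall x, V x -> x <= v.
  have [v /set_mem Vv h] := compact_EVT_max V0 cV (@continuous_subspaceT _ _ V id (fun x => cvg_id)).
  by exists v => // x Vx; apply: h; rewrite inE.
have [w Ww wmin] : exists2 w, W w & forall x, W x -> w <= x.
  have [w /set_mem Ww h] := compact_EVT_min W0 cW (@continuous_subspaceT _ _ W id (fun x => cvg_id)).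
  by exists w => // x Wx; apply: h; rewrite inE.
pose S1 := (fun x => 2 * x + - w) @^-1` V.
pose S2 := (fun x => 2 * x + - v) @^-1` W.
have maff c : measurable_fun setT (fun x : R => 2 * x + c).
  by apply: measurable_funD => //; exact: measurable_funM.
have mS1 : measurable S1 by rewrite -[S1]setTI; exact: maff.
have mS2 : measurable S2 by rewrite -[S2]setTI; exact: maff.
pose c := (v + w) / 2.
have mS1' : measurable (S1 `\` [set c]) by exact: measurableD.
have S1c : mu (S1 `\` [set c]) = mu S1.
  apply/eqP; rewrite eq_le; apply/andP; split.
    by apply: le_measure; rewrite ?inE//; exact: subDsetl.
  apply: (@le_trans _ _ (mu ((S1 `\` [set c]) `|` [set c]))).
    apply: le_measure; rewrite ?inE//; first exact: measurableU.
    by move=> x S1x; have [->|xc] := eqVneq x c; [right|left; split => //; exact/eqP].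
  apply: (le_trans (measureU2 _ _ _)) => //.
  by rewrite [X in (_ + X)%E]lebesgue_measure_set1 adde0.
have S12 : S1 `\` [set c] `|` S2 `<=` C.
  move=> x [[S1x _]|S2x].
    by rewrite (_ : x = ((2 * x + - w) + w) / 2); [apply: AB; [exact: VA|exact: WB]|field].
  by rewrite (_ : x = (v + (2 * x + - v)) / 2); [apply: AB; [exact: VA|exact: WB]|field].
have dis : (S1 `\` [set c]) `&` S2 = set0.
  apply/seteqP; split => // x [[S1x xc] S2x]; apply: xc => /=.
  by have := vmax _ S1x; have := wmin _ S2x; rewrite /c; lra.
have two0 : 0 < 2 :> R by [].
have mC2 : (mu S1 + mu S2 <= mu C)%E.
  rewrite -S1c -measureU//; apply: le_measure; rewrite ?inE//; exact: measurableU.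
have h1 := lebesgue_measure_affine (- w) two0 mV.
have h2 := lebesgue_measure_affine (- v) two0 mW.
apply: (@le_trans _ _ (2%:E * (mu S1 + mu S2) + e%:E)%E); last first.
  by apply: leeD => //; apply: lee_wpmul2l.
rewrite h1 h2 -muleDr// ?ge0_adde_def ?inE ?measure_ge0//.
rewrite muleA -EFinM mulfV// mul1e.
apply: (le_trans (leeD hV hW)).
by rewrite addeACA -EFinD -splitr.
Qed.

Lemma lebesgue_segment_lty (a b : R) : (mu `[a, b]%classic < +oo)%E.
Proof. by rewrite lebesgue_measure_itv/=; case: ifP => // _; rewrite -EFinB ltry. Qed.

Let lebesgue_itvco0 (t : R) : 0 <= t -> mu `[0, t[%classic = t%:E.
Proof.
move=> t0; rewrite lebesgue_measure_itv/= lte_fin.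
case: ifPn => [_|]; first by rewrite oppr0 adde0.
by rewrite -leNgt => t1; congr EFin; apply/le_anti; rewrite t0 t1.
Qed.

Let hypograph (f : R -> R) :=
  [set z : measurableTypeR R * measurableTypeR R | 0 <= z.2 /\ z.2 < f z.1].

Let measurable_indic_hypograph f : measurable_fun setT f ->
  measurable_fun setT (fun z => (\1_(hypograph f) z)%:E : \bar R).
Proof.
move=> mf; apply/measurable_EFinP/measurable_indic.
have msnd : measurable_fun setT (snd : measurableTypeR R * measurableTypeR R -> measurableTypeR R).
  exact: measurable_snd.
have mfst : measurable_fun setT (f \o (fst : measurableTypeR R * measurableTypeR R -> measurableTypeR R)).
  by apply: measurableT_comp => //; exact: measurable_fst.
have m1 := measurable_fun_ler (@measurable_cst _ _ _ _ setT (0 : measurableTypeR R)) msnd.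
have m2 := measurable_fun_ltr msnd mfst.
have := measurableI _ _ (m1 measurableT [set true] I) (m2 measurableT [set true] I).
by rewrite !setTI; congr measurable.
Qed.

Let int_hypograph f r : measurable_fun setT f -> 0 <= r ->
  (\int[mu]_x (\1_(hypograph f) (x, r))%:E = mu [set x | (r < f x)%R])%E.
Proof.
move=> mf r0; rewrite -[X in mu X]setIT -integral_indic//.
  apply: eq_integral => x _; congr (_ %:E); rewrite !indicE; congr (nat_of_bool _)%:R.
  by apply/idP/idP => /set_mem /=; [move=> [_ h]; apply/mem_set|move=> h; apply/mem_set].
rewrite -[X in measurable X]setTI.
have := @measurable_lte _ _ R setT measurableT (cst r%:E) (EFin \o f) (@measurable_cst _ _ _ _ _ _) _.
by apply; exact/measurable_EFinP.
Qed.

Lemma measurable_level_measure (f : R -> R) : measurable_fun setT f ->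
  measurable_fun (`[0%R, +oo[%classic : set (measurableTypeR R)) (fun r => mu [set x | (r < f x)%R]).
Proof.
move=> mf.
have m1S0 z : (0 <= (\1_(hypograph f) z)%:E :> \bar R)%E by rewrite lee_fin.
have := measurable_fun_fubini_tonelli_G (m1 := mu) _ (measurable_indic_hypograph mf) m1S0.
move=> /(measurable_funS measurableT (@subsetT _ (`[0%R, +oo[%classic : set (measurableTypeR R)))).
apply: eq_measurable_fun => r; rewrite inE/= in_itv/= andbT => r0.
exact: int_hypograph.
Qed.

(** Tonelli for the indicator of the region under the graph. *)
Lemma layer_cake (f : R -> R) : measurable_fun setT f -> (forall x, 0 <= f x) ->
  (\int[mu]_x (f x)%:E = \int[mu]_(r in `[0%R, +oo[) mu [set x | (r < f x)%R])%E.
Proof.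
move=> mf f0.
have m1S0 z : (0 <= (\1_(hypograph f) z)%:E :> \bar R)%E by rewrite lee_fin.
have := fubini_tonelli (m1 := mu) (m2 := mu) _ (measurable_indic_hypograph mf) m1S0.
move=> H; transitivity (\int[mu]_x \int[mu]_y (\1_(hypograph f) (x, y))%:E)%E.
  apply: eq_integral => x _; apply/esym.
  transitivity (\int[mu]_r (\1_(`[0%R, f x[%classic) r)%:E)%E.
    apply: eq_integral => r _; congr (_ %:E); rewrite !indicE; congr (nat_of_bool _)%:R.
    by apply/idP/idP => /set_mem /=; [move=> h; apply/mem_set|move=> h; apply/mem_set];
      move: h; rewrite /= in_itv/= => /andP.
  by rewrite integral_indic// setIT; exact: lebesgue_itvco0.
rewrite H [RHS]integral_mkcond; apply: eq_integral => r _.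
rewrite patchE; case: ifPn => [/set_mem/=|]; rewrite ?notin_setE/= in_itv/= andbT.
  by move=> r0; exact: int_hypograph.
move=> r0; rewrite (eq_integral (cst 0%E)) ?integral0// => x _.
by rewrite indicE memNset//= => -[h]; rewrite h in r0.
Qed.

Lemma integrable_bounded_support d (T : measurableType d) (m : {measure set T -> \bar R})
    (B : set T) (f : T -> R) (C : R) : measurable B -> (m B < +oo)%E ->
  measurable_fun setT (f : T -> measurableTypeR R) -> (forall x, `|f x| <= C) ->
  (forall x, ~ B x -> f x = 0) -> m.-integrable setT (EFin \o f).
Proof.
move=> mB fB mf fC f0.
have h : EFin \o f = (EFin \o f) \_ B.
  apply/funext => x; rewrite patchE; case: ifPn => //; rewrite notin_setE => /f0 /= ->.
  by [].
rewrite h; apply/(integrable_mkcond (EFin \o f) mB).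
apply: measurable_bounded_integrable => //; first exact: measurable_funS mf.
by exists C; split; [exact: num_real|move=> M CM x _ /=; apply: le_trans (fC x) (ltW CM)].
Qed.

Let level_set (f : R -> R) r := [set x | r < f x].

Let measurable_level f r : measurable_fun setT f -> measurable (level_set f r).
Proof.
move=> mf; rewrite -[level_set f r]setTI.
have := @measurable_lte _ _ R setT measurableT (cst r%:E) (EFin \o f) (@measurable_cst _ _ _ _ _ _) _.
by apply; exact/measurable_EFinP.
Qed.

(** With both suprema normalised to 1, the level sets of [f] and [g] are nonempty at exactly the
    heights [r < 1]. There [f s > r] and [g t > r] force [h > r] at the midpoint, and
    [brunn_minkowski_1d] applies level by level. *)
Let layer_cake2 (f g h : R -> R) (L : R) :
  measurable_fun setT f -> measurable_fun setT g -> measurable_fun setT h ->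
  (forall x, 0 <= f x <= 1) -> (forall x, 0 <= g x <= 1) -> (forall x, 0 <= h x) ->
  (forall x, L < `|x| -> f x = 0) -> (forall x, L < `|x| -> g x = 0) ->
  (forall r, r < 1 -> exists x, r < f x) -> (forall r, r < 1 -> exists x, r < g x) ->
  (forall s t, f s * g t <= h ((s + t) / 2) ^+ 2) ->
  (\int[mu]_x (f x)%:E + \int[mu]_x (g x)%:E <= 2%:E * \int[mu]_x (h x)%:E)%E.
Proof.
move=> mf mg mh f01 g01 h0 fL gL fsup gsup fgh.
have f0 x : 0 <= f x by case/andP : (f01 x).
have g0 x : 0 <= g x by case/andP : (g01 x).
rewrite !layer_cake//.
have mf' := measurable_level_measure mf; have mg' := measurable_level_measure mg.
have mh' := measurable_level_measure mh.
rewrite -ge0_integralD//.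
rewrite -ge0_integralZl//.
apply: ge0_le_integral => //.
- by move=> r _; rewrite adde_ge0.
- exact: emeasurable_funD.
- exact: measurable_funeM.
move=> r /=; rewrite in_itv/= andbT => r0.
have [r1|r1] := ltP r 1; last first.
  rewrite (_ : [set x | _] = set0); last first.
    by apply/seteqP; split => // x /=; rewrite ltNge (le_trans _ r1)//; case/andP : (f01 x).
  rewrite (_ : [set x | _] = set0); last first.
    by apply/seteqP; split => // x /=; rewrite ltNge (le_trans _ r1)//; case/andP : (g01 x).
  by rewrite !measure0 adde0 mule_ge0.
have lev_fin (k : R -> R) : measurable_fun setT k -> (forall x, L < `|x| -> k x = 0) ->
    (mu (level_set k r) < +oo)%E.
  move=> mk kL; apply: (@le_lt_trans _ _ (mu `[(- L)%R, L]%classic)).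
    apply: le_measure; rewrite ?inE//; first exact: measurable_level.
    move=> x; rewrite /level_set/= in_itv/= -ler_norml leNgt => rk.
    by apply/negP => /kL k0; move: rk; rewrite k0 ltNge r0.
  exact: lebesgue_segment_lty.
apply: brunn_minkowski_1d.
- exact: measurable_level.
- exact: measurable_level.
- exact: measurable_level.
- exact: lev_fin.
- exact: lev_fin.
- by have [x hx] := fsup _ r1; exists x.
- by have [x hx] := gsup _ r1; exists x.
- move=> s t /= rs rt; have := fgh s t; have := h0 ((s + t) / 2).
  move: rs rt; set A := f s; set B := g t; set H := h _ => rs rt H0 AB.
  nra.
Qed.

(** Dividing [f], [g], [h] by [a], [b] and [sqrt (a * b)], with [a] and [b] the suprema, preserves
    the pointwise hypothesis. The additive inequality of [layer_cake2] becomes multiplicative by the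
    arithmetic-geometric mean. *)
Lemma prekopa_leindler_1d (f g h : R -> R) (C L : R) :
  measurable_fun setT f -> measurable_fun setT g -> measurable_fun setT h ->
  (forall x, 0 <= f x <= C) -> (forall x, 0 <= g x <= C) -> (forall x, 0 <= h x <= C) ->
  (forall x, L < `|x| -> f x = 0) -> (forall x, L < `|x| -> g x = 0) ->
  (forall x, L < `|x| -> h x = 0) ->
  (forall s t, f s * g t <= h ((s + t) / 2) ^+ 2) ->
  (\int[mu]_x f x) * (\int[mu]_x g x) <= (\int[mu]_x h x) ^+ 2.
Proof.
move=> mf mg mh f0C g0C h0C fL gL hL fgh.
have h0 x : 0 <= h x by case/andP : (h0C x).
have Ih : 0 <= \int[mu]_x h x by exact: Rintegral_ge0.
(* A function that vanishes identically has no positive supremum to divide by; its integral makes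
   the left side 0. *)
have zero_or_sup (k : R -> R) : (forall x, 0 <= k x <= C) ->
    k = (fun=> 0) \/ exists2 a, 0 < a & (forall x, k x <= a) /\ forall r, r < a -> exists x, r < k x.
  move=> k0C; have [->|k0] := pselect (k = fun=> 0); [by left|right].
  have [x kx] : exists x, 0 < k x.
    apply: contrapT => /forallNP kN; apply: k0; apply/funext => x.
    have /andP[k0 _] := k0C x; apply/eqP; rewrite eq_le k0 andbT leNgt; apply/negP; exact: kN.
  have hs : has_sup (range k).
    by split; [exists (k x); exists x|exists C => _ [y _ <-]; case/andP : (k0C y)].
  exists (sup (range k)); first by apply: lt_le_trans kx _; apply: ub_le_sup; [case: hs|exists x].
  split=> [y|r rs]; first by apply: ub_le_sup; [case: hs|exists y].
  have rs' : 0 < sup (range k) - r by rewrite subr_gt0.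
  have [_ [y _ <-]] := sup_adherent rs' hs.
  by rewrite subKr => ry; exists y.
have [f0|[a a0 [fa asup]]] := zero_or_sup f f0C.
  by rewrite f0 (_ : \int[mu]_x 0 = 0) ?mul0r ?sqr_ge0//; rewrite /Rintegral integral0.
have [g0|[b b0 [gb bsup]]] := zero_or_sup g g0C.
  by rewrite g0 (_ : \int[mu]_x 0 = 0) ?mulr0 ?sqr_ge0//; rewrite /Rintegral integral0.
pose c := Num.sqrt (a * b).
have c0 : 0 < c by rewrite sqrtr_gt0 mulr_gt0.
have cc : c ^+ 2 = a * b by rewrite sqr_sqrtr// ltW// mulr_gt0.
have intk (k : R -> R) : measurable_fun setT k -> (forall x, 0 <= k x <= C) ->
    (forall x, L < `|x| -> k x = 0) -> mu.-integrable setT (EFin \o k).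
  move=> mk k0C kL; apply: (@integrable_bounded_support _ _ mu `[- L, L]%classic k C) => //.
  - exact: lebesgue_segment_lty.
  - by move=> x; have /andP[k0 kC] := k0C x; rewrite ger0_norm.
  - by move=> x /= /negP; rewrite in_itv/= -ler_norml -ltNge; exact: kL.
have If := intk f mf f0C fL; have Ig := intk g mg g0C gL; have Ih' := intk h mh h0C hL.
have norm1 (k : R -> R) (a' : R) : 0 < a' -> mu.-integrable setT (EFin \o k) ->
    (\int[mu]_x (a'^-1 * k x)%:E)%E = (a'^-1 * \int[mu]_x k x)%:E.
  move=> a'0 Ik; rewrite EFinM /Rintegral fineK; last exact: integrable_fin_num.
  by rewrite -integralZl//; apply: eq_integral => x _; rewrite EFinM.
have := @layer_cake2 (fun x => a^-1 * f x) (fun x => b^-1 * g x) (fun x => c^-1 * h x) L.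
rewrite !norm1// -EFinM -EFinD lee_fin => H.
have {H} : a^-1 * (\int[mu]_x f x) + b^-1 * (\int[mu]_x g x) <= 2 * (c^-1 * \int[mu]_x h x).
  apply: H.
  - by apply: measurable_funM => //; exact: measurable_cst.
  - by apply: measurable_funM => //; exact: measurable_cst.
  - by apply: measurable_funM => //; exact: measurable_cst.
  - move=> x; have /andP[f0 _] := f0C x; rewrite mulr_ge0 ?invr_ge0 ?(ltW a0)//=.
    by rewrite ler_pdivrMl// mulr1.
  - move=> x; have /andP[g0 _] := g0C x; rewrite mulr_ge0 ?invr_ge0 ?(ltW b0)//=.
    by rewrite ler_pdivrMl// mulr1.
  - by move=> x; rewrite mulr_ge0 ?invr_ge0 ?(ltW c0).
  - by move=> x /fL ->; rewrite mulr0.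
  - by move=> x /gL ->; rewrite mulr0.
  - move=> r r1; have [|x hx] := asup (a * r); first by rewrite gtr_pMr.
    by exists x; rewrite ltr_pdivlMl.
  - move=> r r1; have [|x hx] := bsup (b * r); first by rewrite gtr_pMr.
    by exists x; rewrite ltr_pdivlMl.
  - move=> s t; rewrite exprMn exprVn cc invfM mulrACA.
    by rewrite ler_pM2l ?mulr_gt0 ?invr_gt0.
set X := \int[mu]_x f x; set Y := \int[mu]_x g x; set Z := \int[mu]_x h x => H.
have X0 : 0 <= X by apply: Rintegral_ge0 => x _; case/andP : (f0C x).
have Y0 : 0 <= Y by apply: Rintegral_ge0 => x _; case/andP : (g0C x).
have Z0 : 0 <= Z by [].
have p0 : 0 <= a^-1 * X by rewrite mulr_ge0 ?invr_ge0 ?(ltW a0).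
have q0 : 0 <= b^-1 * Y by rewrite mulr_ge0 ?invr_ge0 ?(ltW b0).
have : (a^-1 * X) * (b^-1 * Y) <= (c^-1 * Z) ^+ 2.
  by have := sqr_ge0 (a^-1 * X - b^-1 * Y); nra.
by rewrite exprMn exprVn cc invfM mulrACA ler_pM2l ?mulr_gt0 ?invr_gt0.
Qed.

End prekopa_leindler_1d.

Section prekopa_leindler.
Variable R : realType.
Local Notation mu := (@lebesgue_measure R).
Local Notation leb n := (lebesgue_rV R n).

Definition rV_box n (L : R) := [set x : 'rV[R]_n | forall i, `|x 0 i| <= L].

Lemma measurable_rV_cube n L : measurable (@rV_box n L).
Proof.
apply: (measurable_rV_box (A := fun=> [set t | `|t| <= L])) => i.
rewrite (_ : [set t | _] = `[- L, L]%classic); first exact: measurable_itv.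
by apply/seteqP; split => t /=; rewrite in_itv/= ler_norml.
Qed.

Lemma integrable_box_supported n C L (f : 'rV[R]_n -> R) :
  measurable_fun setT (f : 'rV[R]_n -> measurableTypeR R) -> (forall x, `|f x| <= C) ->
  (forall x, ~ rV_box L x -> f x = 0) -> (leb n).-integrable setT (EFin \o f).
Proof.
move=> mf fC fL.
exact: (integrable_bounded_support (measurable_rV_cube L) (lebesgue_rV_box_lty n L) mf fC fL).
Qed.

(** The constants are parameters rather than existentials because every slice inherits them
    unchanged, which gives the inner integrals a uniform bound. *)
Definition bounded_supported n C L (f : 'rV[R]_n -> R) :=
  [/\ measurable_fun setT (f : 'rV[R]_n -> measurableTypeR R),
      forall x, 0 <= f x <= C & forall x, ~ rV_box L x -> f x = 0].

Lemma integrable_bounded_supported n C L (f : 'rV[R]_n -> R) :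
  bounded_supported C L f -> (leb n).-integrable setT (EFin \o f).
Proof.
move=> [mf f0C fL].
apply: (integrable_box_supported (C := C) mf _ fL).
by move=> x; have /andP[f0 fC] := f0C x; rewrite ger0_norm.
Qed.

Lemma Rintegral_bounded_supported n C L (f : 'rV[R]_n -> R) : bounded_supported C L f ->
  0 <= \int[leb n]_x f x <= C * fine (leb n (rV_box L)).
Proof.
move=> bf; have If := integrable_bounded_supported bf; have [mf f0C fL] := bf.
rewrite Rintegral_ge0 => [|x _]; last by case/andP : (f0C x).
rewrite /= -Rintegral_cst; last exact: measurable_rV_cube.
rewrite [leRHS]Rintegral_mkcond; apply: le_Rintegral => //.
  rewrite (_ : EFin \o _ = (EFin \o cst C) \_ (rV_box L)); last first.
    by apply/funext => x; rewrite /= !patchE; case: ifP.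
  apply/(integrable_mkcond (EFin \o cst C) (measurable_rV_cube L)).
  apply: measurable_bounded_integrable.
  - exact: measurable_rV_cube.
  - exact: lebesgue_rV_box_lty.
  - exact: measurable_cst.
  - by exists `|C|; split; [exact: num_real|move=> M CM x _ /=; exact: ltW].
move=> x _; rewrite patchE; case: ifPn => [_|]; first by case/andP : (f0C x).
by rewrite notin_setE => /fL ->.
Qed.

Lemma bounded_supported_slice n C L (f : 'rV[R]_n.+1 -> R) s : bounded_supported C L f ->
  bounded_supported C L (fun v : 'rV[R]_n => f (consrV (s, v))).
Proof.
move=> [mf f0C fL]; split=> [|v|v vL]; [|exact: f0C|].
  by apply/measurable_EFinP; apply: (@measurable_slice R n (EFin \o f)); exact/measurable_EFinP.
apply: fL => h; apply: vL => i; have := h (lift ord0 i); rewrite consrVS; exact.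
Qed.

Lemma slice_eq0 n C L (f : 'rV[R]_n.+1 -> R) s v : bounded_supported C L f -> L < `|s| ->
  f (consrV (s, v)) = 0.
Proof.
by move=> [_ _ fL] Ls; apply: fL => /(_ ord0); rewrite consrV0/= leNgt Ls.
Qed.

Lemma Rintegral_rVS n C L (f : 'rV[R]_n.+1 -> R) : bounded_supported C L f ->
  measurable_fun setT (fun s : R => \int[leb n]_v f (consrV (s, v)) : R) /\
  \int[leb n.+1]_x f x = \int[mu]_s \int[leb n]_v f (consrV (s, v)).
Proof.
move=> bf; have [mf f0C _] := bf.
have mEf : measurable_fun setT (EFin \o f) by exact/measurable_EFinP.
have f0 x : (0 <= (EFin \o f) x)%E by rewrite lee_fin; case/andP : (f0C x).
have e s : (\int[leb n]_v (f (consrV (s, v)))%:E = (\int[leb n]_v f (consrV (s, v)))%:E)%E.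
  rewrite /Rintegral fineK//; apply: integrable_fin_num => //.
  exact: integrable_bounded_supported (bounded_supported_slice s bf).
split.
  apply/measurable_EFinP; have := measurable_int_slice mEf f0.
  by apply: eq_measurable_fun => s _ /=; rewrite e.
rewrite /Rintegral ge0_integral_rVS//; congr fine.
by apply: eq_integral => s _; rewrite /= e.
Qed.

(** Induction on the dimension: the slices at [s], [t] and [(s + t) / 2] satisfy the hypothesis, so
    the inner integrals satisfy the one-dimensional one, with bound [C] times the volume of the
    box. *)
Lemma prekopa_leindler n (f g h : 'rV[R]_n -> R) (C L : R) :
  bounded_supported C L f -> bounded_supported C L g -> bounded_supported C L h ->
  (forall x y, f x * g y <= h (2^-1 *: (x + y)) ^+ 2) ->
  (\int[leb n]_x f x) * (\int[leb n]_x g x) <= (\int[leb n]_x h x) ^+ 2.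
Proof.
elim: n => [|n IH] in f g h * => bf bg bh fgh.
  have [mf _ _] := bf; have [mg _ _] := bg; have [mh _ _] := bh.
  rewrite /Rintegral !integral_rV0; try exact/measurable_EFinP.
  by have := fgh 0 0; rewrite addr0 scaler0.
have [mF ->] := Rintegral_rVS bf; have [mG ->] := Rintegral_rVS bg.
have [mH ->] := Rintegral_rVS bh.
have bnd k s (bk : bounded_supported C L k) :=
  Rintegral_bounded_supported (bounded_supported_slice s bk).
have zero k s : bounded_supported C L k -> L < `|s| -> \int[leb n]_v k (consrV (s, v)) = 0.
  move=> bk Ls; rewrite (@eq_Rintegral _ _ _ _ _ (cst 0)); last first.
    by move=> v _; exact: slice_eq0 bk Ls.
  by rewrite /Rintegral integral0.
apply: (@prekopa_leindler_1d R _ _ _ (C * fine (leb n (rV_box L))) L) => //.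
- by move=> s; exact: bnd.
- by move=> s; exact: bnd.
- by move=> s; exact: bnd.
- by move=> s; exact: zero.
- by move=> s; exact: zero.
- by move=> s; exact: zero.
move=> s t; apply: IH; try exact: bounded_supported_slice.
move=> v w; rewrite (_ : consrV ((s + t) / 2, _) = 2^-1 *: (consrV (s, v) + consrV (t, w))) //.
by rewrite consrVD consrVZ mulrC.
Qed.

End prekopa_leindler.

(** * Poincare inequalities on convex sets *)

(** The passage to the limit in the exponent, when the estimate is available for small [e] only. *)
Lemma le0_of_le_eps (R : realFieldType) (A C e0 : R) : 0 < e0 ->
  (forall e, 0 < e -> e <= e0 -> A <= e * C) -> A <= 0.
Proof.
move=> e00 H; rewrite leNgt; apply/negP => A0.
have C0 : 0 < C.
  have := lt_le_trans A0 (H _ e00 (lexx _)); by rewrite pmulr_rgt0.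
have [h|h] := leP e0 (A / (2 * C)).
  have := H _ e00 (lexx _); move: h; rewrite ler_pdivlMr ?mulr_gt0//; nra.
have p : 0 < A / (2 * C) by rewrite divr_gt0 ?mulr_gt0.
have := H _ p (ltW h); rewrite (_ : A / (2 * C) * C = A / 2); last by field; rewrite gt_eqF.
lra.
Qed.

Section poincare.
Variables (R : realType) (n : nat).
Local Notation leb := (lebesgue_rV R n).
Implicit Types x y : 'rV[R]_n.

Definition sqdist x y : R := \sum_i (x 0 i - y 0 i) ^+ 2.

Lemma sqdist_ge0 x y : 0 <= sqdist x y.
Proof. by apply: sumr_ge0 => i _; rewrite sqr_ge0. Qed.

Lemma sqdist_parallelogram x y z :
  sqdist x z + sqdist y z = 2 * sqdist (2^-1 *: (x + y)) z + sqdist x y / 2.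
Proof.
rewrite /sqdist mulr_sumr mulr_suml -!big_split/=; apply: eq_bigr => i _.
by rewrite !mxE; field.
Qed.

Variables (K : set 'rV[R]_n) (L D M : R) (psi : 'rV[R]_n -> R) (G : 'I_n -> 'rV[R]_n -> R).
Hypotheses (mK : measurable K) (KL : K `<=` rV_box L) (D0 : 0 < D).
Hypothesis midK : forall x y, K x -> K y -> K (2^-1 *: (x + y)).
Hypothesis diamK : forall x y, K x -> K y -> sqdist x y <= D ^+ 2.

Let bfun (k : 'rV[R]_n -> R) := measurable_fun setT (k : 'rV[R]_n -> measurableTypeR R) /\
  exists2 B : R, 0 < B & forall x, K x -> `|k x| <= B.

Hypotheses (bpsi : bfun psi) (bG : forall i, bfun (G i)) (M0 : 0 < M).
Hypothesis taylor : forall x y, K x -> K y ->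
  `|psi y - psi x - \sum_i G i x * (y 0 i - x 0 i)| <= M * sqdist x y.

Let bcst c : bfun (fun=> c).
Proof. by split; [exact: measurable_cst|exists (`|c| + 1) => [|x _]; rewrite ?ltr_wpDl// lerDl]. Qed.

Let bD k l : bfun k -> bfun l -> bfun (fun x => k x + l x).
Proof.
move=> [mk [B B0 hk]] [ml [C C0 hl]]; split; first exact: measurable_funD.
exists (B + C) => [|x Kx]; first exact: addr_gt0.
by rewrite (le_trans (ler_normD _ _))// lerD ?hk ?hl.
Qed.

Let bM k l : bfun k -> bfun l -> bfun (fun x => k x * l x).
Proof.
move=> [mk [B B0 hk]] [ml [C C0 hl]]; split; first exact: measurable_funM.
exists (B * C) => [|x Kx]; first exact: mulr_gt0.
by rewrite normrM ler_pM ?hk ?hl.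
Qed.

Let bexp k : bfun k -> bfun (fun x => expR (k x)).
Proof.
move=> [mk [B B0 hk]]; split; first by apply: measurableT_comp => //; exact: measurable_expR.
exists (expR B) => [|x Kx]; first exact: expR_gt0.
by rewrite ger0_norm ?expR_ge0// ler_expR (le_trans (ler_norm _))// hk.
Qed.

Let bsum I (r : seq I) (k : I -> 'rV[R]_n -> R) : (forall i, bfun (k i)) ->
  bfun (fun x => \sum_(i <- r) k i x).
Proof.
move=> bk; elim: r => [|i r IH].
  by rewrite (_ : (fun x => _) = fun=> 0)//; apply/funext => x; rewrite big_nil.
rewrite (_ : (fun x => _) = fun x => k i x + \sum_(i <- r) k i x); first exact: bD.
by apply/funext => x; rewrite big_cons.
Qed.

Section weighted.
Variable x0 : 'rV[R]_n.
Hypothesis Kx0 : K x0.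

(** With the diameter as width, the Gaussian stays between [expR (-1)] and 1 on [K]. *)
Let a := (D ^+ 2)^-1.
Let a0 : 0 < a. Proof. by rewrite invr_gt0 exprn_gt0. Qed.
Let w x := \1_K x * expR (- (a * sqdist x x0)).

Let w_ge0 x : 0 <= w x.
Proof. by rewrite mulr_ge0 ?expR_ge0. Qed.

Let w_notin x : ~ K x -> w x = 0.
Proof. by move=> h; rewrite /w indicE memNset// mul0r. Qed.

Let w_in x : K x -> w x = expR (- (a * sqdist x x0)).
Proof. by move=> h; rewrite /w indicE mem_set// mul1r. Qed.

Let measurable_w : measurable_fun setT (w : 'rV[R]_n -> measurableTypeR R).
Proof.
apply: measurable_funM; first exact: measurable_indic.
apply: measurableT_comp; first exact: measurable_expR.
apply: measurable_funN; apply: measurable_funM; first exact: measurable_cst.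
apply: measurable_sum => i; apply: measurable_funX; apply: measurable_funB.
  exact: measurable_rV_coord.
exact: measurable_cst.
Qed.

Let w_le1 x : w x <= 1.
Proof.
have [/w_in ->|/w_notin ->//] := pselect (K x).
by rewrite -expR0 ler_expR oppr_le0 mulr_ge0 ?(ltW a0)// sqdist_ge0.
Qed.

Let w_ge x : K x -> expR (-1) <= w x.
Proof.
move=> Kx; rewrite w_in// ler_expR lerN2 /a mulrC ler_pdivrMr ?exprn_gt0// mul1r.
exact: diamK.
Qed.

Let W k := \int[leb]_x (w x * k x).

Let integrable_w k : bfun k -> leb.-integrable setT (EFin \o (fun x => w x * k x)).
Proof.
move=> [mk [B B0 hk]].
apply: (integrable_box_supported (C := B) (L := L)).
- exact: measurable_funM.
- move=> x; have [Kx|Kx] := pselect (K x); last by rewrite w_notin// mul0r normr0 ltW.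
  by rewrite normrM ger0_norm// -[B]mul1r ler_pM ?hk.
- by move=> x /= nx; rewrite w_notin ?mul0r// => /KL.
Qed.

Let W_le k l : bfun k -> bfun l -> (forall x, K x -> k x <= l x) -> W k <= W l.
Proof.
move=> bk bl kl; apply: le_Rintegral; [exact: measurableT|exact: integrable_w|exact: integrable_w|].
move=> x _; have [Kx|Kx] := pselect (K x); last by rewrite w_notin// !mul0r.
by rewrite ler_wpM2l// kl.
Qed.

Let WD k l : bfun k -> bfun l -> W (fun x => k x + l x) = W k + W l.
Proof.
move=> bk bl; rewrite /W -RintegralD//; [|exact: integrable_w|exact: integrable_w].
by apply: eq_Rintegral => x _; rewrite mulrDr.
Qed.

Let WZ c k : bfun k -> W (fun x => c * k x) = c * W k.
Proof.
move=> bk; rewrite /W -RintegralZl//; last exact: integrable_w.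
by apply: eq_Rintegral => x _; rewrite mulrCA.
Qed.

Let W_ge0 k : (forall x, K x -> 0 <= k x) -> 0 <= W k.
Proof.
move=> k0; apply: Rintegral_ge0 => x _.
have [Kx|Kx] := pselect (K x); last by rewrite w_notin// mul0r.
by rewrite mulr_ge0// k0.
Qed.

Let bsupp k C : bfun k -> (forall x, K x -> 0 <= k x <= C) -> 0 <= C ->
  bounded_supported C L (fun x => w x * k x).
Proof.
move=> [mk _] hk C0; split; first exact: measurable_funM.
- move=> x; have [Kx|Kx] := pselect (K x); last by rewrite w_notin// mul0r lexx.
  have /andP[k0 kC] := hk _ Kx; rewrite mulr_ge0//=.
  by apply: le_trans kC; rewrite ler_piMl.
- by move=> x nx; rewrite w_notin ?mul0r// => /KL.
Qed.

Let Gam x := \sum_i G i x ^+ 2.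

Let bGam : bfun Gam.
Proof. by apply: bsum => i; under eq_fun do rewrite expr2; exact: bM. Qed.

Let Gam_ge0 x : 0 <= Gam x.
Proof. by apply: sumr_ge0 => i _; rewrite sqr_ge0. Qed.

(* The exponents are chosen so that the Gaussian factor absorbs the second-order
   Taylor expansion of [psi]. *)
Let PL_exponents c e : 0 < e -> e * M <= a / 4 ->
  W (fun x => expR (e * (psi x - c) - e ^+ 2 / a * Gam x)) *
  W (fun x => expR (- (e * (psi x - c)))) <= W (fun=> 1) ^+ 2.
Proof.
move=> e0 eM.
have bpc : bfun (fun x => psi x - c) by apply: bD => //; exact: bcst.
have bf : bfun (fun x => expR (e * (psi x - c) - e ^+ 2 / a * Gam x)).
  apply: bexp; under eq_fun do rewrite -mulNr.
  by apply: bD; apply: bM => //; exact: bcst.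
have bg : bfun (fun x => expR (- (e * (psi x - c)))).
  by apply: bexp; under eq_fun do rewrite -mulNr; apply: bM => //; exact: bcst.
have [_ [B B0 hB]] := bf; have [_ [C C0 hC]] := bg.
pose T := B + C + 1.
have T0 : 0 <= T by rewrite /T; lra.
have hf x : K x -> 0 <= expR (e * (psi x - c) - e ^+ 2 / a * Gam x) <= T.
  by move=> Kx; rewrite expR_ge0/=; have := hB _ Kx; rewrite ger0_norm ?expR_ge0// /T; lra.
have hg x : K x -> 0 <= expR (- (e * (psi x - c))) <= T.
  by move=> Kx; rewrite expR_ge0/=; have := hC _ Kx; rewrite ger0_norm ?expR_ge0// /T; lra.
have hh x : K x -> 0 <= (1 : R) <= T by move=> _; rewrite ler01/= /T; lra.
apply: (prekopa_leindler (bsupp bf hf T0) (bsupp bg hg T0) (bsupp (bcst 1) hh T0)).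
move=> x y.
have [Kx|Kx] := pselect (K x); last by rewrite (w_notin Kx) !mul0r sqr_ge0.
have [Ky|Ky] := pselect (K y); last by rewrite (w_notin Ky) mul0r mulr0 sqr_ge0.
rewrite !w_in//; last exact: midK.
rewrite mulr1 -!expRD -expRM_natl ler_expR.
(* The parallelogram law leaves a spare [a / 2 * sqdist x y] in the exponent. Half of it pays for
   the Taylor remainder, by [e * M <= a / 4], and half for the linear term, by completing the square
   in [amgm]. *)
have par := sqdist_parallelogram x y x0.
have tay : psi x - psi y <= \sum_i G i x * (x 0 i - y 0 i) + M * sqdist x y.
  have := taylor Kx Ky; rewrite ler_norml => /andP[h _].
  have : \sum_i G i x * (y 0 i - x 0 i) = - \sum_i G i x * (x 0 i - y 0 i).
    by rewrite -sumrN; apply: eq_bigr => i _; ring.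
  by move=> h2; rewrite h2 in h; lra.
have amgm : e * (\sum_i G i x * (x 0 i - y 0 i)) <= e ^+ 2 / a * Gam x + a / 4 * sqdist x y.
  rewrite /Gam /sqdist !mulr_sumr -big_split/=; apply: ler_sum => i _.
  set g := G i x; set t := x 0 i - y 0 i.
  rewrite -subr_ge0 (_ : _ - _ = a * (e / a * g - t / 2) ^+ 2).
    by rewrite mulr_ge0 ?sqr_ge0// ltW.
  by field; rewrite gt_eqF.
have q0 := sqdist_ge0 x y.
have eMq : e * M * sqdist x y <= a / 4 * sqdist x y by rewrite ler_wpM2r.
have par' : a * sqdist x x0 + a * sqdist y x0 = a * (2 * sqdist (2^-1 *: (x + y)) x0) + a * sqdist x y / 2.
  by rewrite -mulrDr par; ring.
have tay' : e * (psi x - psi y) <= e * (\sum_i G i x * (x 0 i - y 0 i)) + e * M * sqdist x y.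
  by rewrite -mulrA -mulrDr ler_pM2l.
move: par' tay' amgm eMq; set A1 := a * sqdist x x0; set A2 := a * sqdist y x0.
set A3 := e ^+ 2 / a * Gam x; set A4 := sqdist _ x0; set A5 := sqdist x y.
set A6 := \sum_i _; move=> h1 h2 h3 h4.
have e1 : e * (psi x - c) - e * (psi y - c) = e * (psi x - psi y) by ring.
have e2 : a * A5 / 2 = a / 4 * A5 + a / 4 * A5 by field.
have e3 : a * (2 * A4) = 2 * (a * A4) by ring.
lra.
Qed.

(** The square of [1 + t / 2 <= expR (t / 2)], valid as long as the left side is nonnegative. The
    quadratic coefficient 1/4 is the source of the factor 2 in [weighted_poincare]. *)
Let expR_ge_sqr (t : R) : -2 <= t -> 1 + t + t ^+ 2 / 4 <= expR t.
Proof.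
move=> t2; rewrite (_ : t = 2%:R * (t / 2)); last by field.
rewrite expRM_natl (_ : 1 + _ + _ = (1 + t / 2) ^+ 2); last by field.
by rewrite lerXn2r ?nnegrE ?expR_ge0 ?expR_ge1Dx//; lra.
Qed.

Let weighted_poincare : exists c,
  W (fun x => (psi x - c) ^+ 2) <= 2 / a * W Gam.
Proof.
(* If the weight has total mass 0 there is no mean to subtract, but every weighted integral of a
   bounded function is then at most 0. *)
have [W0|Wn0] := eqVneq (W (fun=> 1)) 0.
  exists 0.
  have b2 : bfun (fun x => (psi x - 0) ^+ 2).
    by under eq_fun do rewrite expr2; apply: bM; (apply: bD => //; exact: bcst).
  have [_ [B B0 hB]] := b2.
  apply: (@le_trans _ _ (W (fun=> B * 1))).
    by apply: W_le => // x Kx; rewrite mulr1 (le_trans (ler_norm _))// hB.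
  rewrite WZ; last exact: bcst.
  by rewrite W0 mulr0 mulr_ge0 ?W_ge0// divr_ge0// ltW.
have Wgt0 : 0 < W (fun=> 1) by rewrite lt_neqAle eq_sym Wn0 W_ge0.
pose c := W psi / W (fun=> 1); exists c.
pose p x := psi x - c.
have bp : bfun p by apply: bD => //; exact: bcst.
have bp2 : bfun (fun x => p x ^+ 2) by under eq_fun do rewrite expr2; exact: bM.
have Wp : W p = 0.
  rewrite /p WD//.
  rewrite (_ : W (fun=> - c) = W (fun=> - c * 1)); last by congr W; apply/funext => x; rewrite mulr1.
  by rewrite WZ ?mulNr ?divfK ?subrr//; exact: bcst.
have [_ [B B0 hB]] := bp; have [_ [C C0 hC]] := bGam.
set Y := W (fun x => p x ^+ 2); set Z := W Gam; set W1 := W (fun=> 1).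
have Y0 : 0 <= Y by apply: W_ge0 => x _; rewrite sqr_ge0.
have Z0 : 0 <= Z by apply: W_ge0 => x _.
(* This is the coefficient of [e ^+ 2] left after expanding both factors of [PL_exponents]: each
   contributes [Y / 4], the first also [- Z / a], and the terms linear in [e] vanish by the choice
   of [c]. *)
suff : W1 * (Y / 2 - Z / a) <= 0.
  rewrite pmulr_rle0// => h.
  have -> : 2 / a * Z = 2 * (Z / a) by ring.
  lra.
pose S := B * C / a.
have S0 : 0 < S by rewrite divr_gt0// mulr_gt0.
(* The four bounds on [e] serve to compare powers of [e], to apply [PL_exponents], to have
   [|e * p x| <= 1], and to have [e ^+ 2 / a * Gam x <= e]. The last two keep the exponents above
   -2, as [expR_ge_sqr] demands. *)
pose e0 := Num.min 1 (Num.min (a / (4 * M)) (Num.min (B^-1) (a / C))).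
have e00 : 0 < e0 by rewrite !lt_min ltr01 invr_gt0 B0 !divr_gt0// mulr_gt0.
apply: (@le0_of_le_eps _ _ (S * W1 * W1 + Z / a * Y + S * W1 * Y) e0 e00) => e ep ee.
have : e <= 1 /\ e <= a / (4 * M) /\ e <= B^-1 /\ e <= a / C.
  by move: ee; rewrite !le_min => /andP[-> /andP[-> /andP[-> ->]]].
move=> [e1 [eM [eB eC]]].
have eM' : e * M <= a / 4.
  by move: eM; rewrite ler_pdivlMr ?mulr_gt0// => eM; rewrite ler_pdivlMr//; lra.
have eB' : e * B <= 1 by move: eB; rewrite -[B^-1]mul1r ler_pdivlMr.
have eC' : e / a * C <= 1.
  by rewrite mulrAC ler_pdivrMr// mul1r; move: eC; rewrite ler_pdivlMr.
have := PL_exponents c ep eM'; rewrite -/W1.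
set F := W _; set H := W _ => FH.
have bt : bfun (fun x => e * p x + (- (e ^+ 2 / a)) * Gam x).
  by apply: bD; apply: bM => //; exact: bcst.
have b1 : bfun (fun x => e * p x) := bM (bcst e) bp.
have b1' : bfun (fun x => - e * p x) := bM (bcst (- e)) bp.
have b2 : bfun (fun x => - (e ^+ 2 / a) * Gam x) := bM (bcst _) bGam.
have b3 : bfun (fun x => e ^+ 2 / 4 * p x ^+ 2) := bM (bcst _) bp2.
have b4 : bfun (fun x => - (e ^+ 3 * S) * 1) := bM (bcst _) (bcst 1).
have hp x : K x -> `|e * p x| <= 1.
  by move=> Kx; rewrite normrM gtr0_norm// (le_trans _ eB')// ler_pM2l// hB.
have hG x : K x -> 0 <= e ^+ 2 / a * Gam x <= e.
  move=> Kx; rewrite mulr_ge0 ?divr_ge0 ?sqr_ge0 ?(ltW a0)//=.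
  rewrite expr2 -!mulrA -[leRHS]mulr1 ler_pM2l// mulrA.
  apply: le_trans eC'; rewrite ler_pM2l ?divr_gt0//.
  by rewrite (le_trans (ler_norm _))// hC.
have hF : W1 - e ^+ 2 * (Z / a) + e ^+ 2 * (Y / 4) - e ^+ 3 * (S * W1) <= F.
  apply: (@le_trans _ _ (W (fun x => 1 + (e * p x + ((- (e ^+ 2 / a)) * Gam x +
      (e ^+ 2 / 4 * p x ^+ 2 + (- (e ^+ 3 * S)) * 1)))))).
    rewrite (WD (bcst 1) (bD b1 (bD b2 (bD b3 b4)))) (WD b1 (bD b2 (bD b3 b4))).
    rewrite (WD b2 (bD b3 b4)) (WD b3 b4) (WZ _ bp) (WZ _ bGam) (WZ _ bp2) (WZ _ (bcst 1)).
    rewrite Wp -/W1 -/Y -/Z mulr0 le_eqVlt; apply/orP; left; apply/eqP.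
    by field; rewrite gt_eqF.
  apply: W_le.
  - exact: (bD (bcst 1) (bD b1 (bD b2 (bD b3 b4)))).
  - rewrite (_ : (fun x => expR (_ - _)) = fun x => expR (e * p x + - (e ^+ 2 / a) * Gam x)).
      exact: bexp bt.
    by apply/funext => x; rewrite mulNr.
  move=> x Kx; have /andP[g0 g1] := hG _ Kx; have := hp _ Kx; rewrite ler_norml => /andP[p1 p2].
  apply: le_trans (expR_ge_sqr _); last by rewrite -/(p x); lra.
  rewrite -/(p x); set t := e * p x in p1 p2 *; set g := e ^+ 2 / a * Gam x in g0 g1 *.
  have tg : t * g <= e ^+ 3 * S.
    apply: (@le_trans _ _ (e * B * (e ^+ 2 / a * C))).
      apply: (@le_trans _ _ (`|t| * g)); first by rewrite ler_wpM2r// ler_norm.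
      rewrite ler_pM//; first by rewrite /t normrM gtr0_norm// ler_pM2l// hB.
      rewrite /g ler_pM2l ?divr_gt0 ?exprn_gt0//.
      by rewrite (le_trans (ler_norm _))// hC.
    by rewrite /S le_eqVlt; apply/orP; left; apply/eqP; field; rewrite gt_eqF.
  have tt : e ^+ 2 / 4 * p x ^+ 2 = t ^+ 2 / 4 by rewrite /t; field.
  rewrite tt !mulNr -/g mulr1.
  have := sqr_ge0 g; have S3 : 0 <= e ^+ 3 * S by rewrite mulr_ge0 ?exprn_ge0 ?ltW.
  nra.
have hH : W1 + e ^+ 2 * (Y / 4) <= H.
  apply: (@le_trans _ _ (W (fun x => 1 + ((- e) * p x + e ^+ 2 / 4 * p x ^+ 2)))).
    rewrite (WD (bcst 1) (bD b1' b3)) (WD b1' b3) (WZ _ bp) (WZ _ bp2).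
    by rewrite Wp -/W1 -/Y mulr0 add0r le_eqVlt; apply/orP; left; apply/eqP; field.
  apply: W_le.
  - exact: (bD (bcst 1) (bD b1' b3)).
  - rewrite (_ : (fun x => expR (- _)) = fun x => expR (- e * p x)); first exact: bexp b1'.
    by apply/funext => x; rewrite mulNr.
  move=> x Kx; have := hp _ Kx; rewrite ler_norml => /andP[p1 p2].
  apply: le_trans (expR_ge_sqr _); last by rewrite -/(p x); lra.
  by rewrite -/(p x) le_eqVlt; apply/orP; left; apply/eqP; field.
have F0 : 0 <= F by apply: W_ge0 => x _; exact: expR_ge0.
have H0 : 0 <= W1 + e ^+ 2 * (Y / 4) by rewrite addr_ge0 ?(ltW Wgt0)// mulr_ge0 ?sqr_ge0// divr_ge0.
have : (W1 - e ^+ 2 * (Z / a) + e ^+ 2 * (Y / 4) - e ^+ 3 * (S * W1)) * (W1 + e ^+ 2 * (Y / 4)) <= W1 ^+ 2.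
  apply: le_trans FH; apply: (@le_trans _ _ (F * (W1 + e ^+ 2 * (Y / 4)))).
    by rewrite ler_wpM2r.
  by rewrite ler_wpM2l.
have e2 : 0 < e ^+ 2 by rewrite exprn_gt0.
have Za : 0 <= Z / a by rewrite divr_ge0// ltW.
have SW : 0 <= S * W1 by rewrite mulr_ge0 ?ltW.
move=> hh; rewrite -(ler_pM2l e2); move: Za SW hh; set z := Z / a; set s := S * W1 => Za SW.
have e43 : e ^+ 4 <= e ^+ 3 by rewrite [e ^+ 4]exprS ler_piMl// exprn_ge0// ltW.
have e53 : e ^+ 5 <= e ^+ 3.
  by apply: le_trans e43; rewrite [e ^+ 5]exprS ler_piMl// exprn_ge0// ltW.
have m1 : 0 <= e ^+ 4 * (Y * Y) by rewrite mulr_ge0 ?exprn_ge0 ?mulr_ge0// ltW.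
have m2 : e ^+ 4 * (z * Y) <= e ^+ 3 * (z * Y) := ler_wpM2r (mulr_ge0 Za Y0) e43.
have m3 : e ^+ 5 * (s * Y) <= e ^+ 3 * (s * Y) := ler_wpM2r (mulr_ge0 SW Y0) e53.
have e3 : 0 <= e ^+ 3 by rewrite exprn_ge0// ltW.
have m2' : 0 <= e ^+ 3 * (z * Y) := mulr_ge0 e3 (mulr_ge0 Za Y0).
have m3' : 0 <= e ^+ 3 * (s * Y) := mulr_ge0 e3 (mulr_ge0 SW Y0).
(* The gap to be shown nonnegative is the slack in [hh] plus terms whose sign follows from
   [e ^+ 4 <= e ^+ 3] and [e ^+ 5 <= e ^+ 3]. *)
rewrite -subr_ge0 => hh; rewrite -subr_ge0.
rewrite (_ : _ - _ = (W1 ^+ 2 - (W1 - e ^+ 2 * z + e ^+ 2 * (Y / 4) - e ^+ 3 * s) *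
    (W1 + e ^+ 2 * (Y / 4))) + (e ^+ 4 * (Y * Y) / 16
    + (e ^+ 3 * (z * Y) - e ^+ 4 * (z * Y)) / 4 + 3 / 4 * (e ^+ 3 * (z * Y))
    + (e ^+ 3 * (s * Y) - e ^+ 5 * (s * Y)) / 4 + 3 / 4 * (e ^+ 3 * (s * Y)))); last by field.
by apply: addr_ge0 => //; lra.
Qed.

(** Of the constant, [2 * D ^+ 2] is [2 / a] from the weighted inequality, and [expR 1] is the price
    of removing the weight on the left; on the right the weight is at most 1. *)
Lemma poincare_C11_aux : exists c,
  \int[leb]_(x in K) (psi x - c) ^+ 2 <=
  2 * expR 1 * D ^+ 2 * \int[leb]_(x in K) \sum_i G i x ^+ 2.
Proof.
have [c hc] := weighted_poincare; exists c.
have bp2 : bfun (fun x => (psi x - c) ^+ 2).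
  by under eq_fun do rewrite expr2; apply: bM; (apply: bD => //; exact: bcst).
have integrable_K k : bfun k -> leb.-integrable setT (EFin \o (k \_ K)).
  move=> [mk [B B0 hk]].
  apply: (integrable_box_supported (C := B) (L := L)).
  - by apply/(measurable_restrictT _ _).1 => //; exact: measurable_funS mk.
  - by move=> x; rewrite patchE; case: ifPn => [/set_mem/hk//|_]; rewrite normr0 ltW.
  - by move=> x /= nx; rewrite patchE; case: ifPn => // /set_mem /KL.
apply: (@le_trans _ _ (expR 1 * W (fun x => (psi x - c) ^+ 2))).
  rewrite Rintegral_mkcond -WZ//; apply: le_Rintegral => //.
  - exact: integrable_K.
  - by apply: integrable_w; apply: bM => //; exact: bcst.
  - move=> x _; rewrite patchE; case: ifPn => [/set_mem Kx|]; last first.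
      by rewrite notin_setE => /w_notin ->; rewrite mul0r.
    rewrite mulrA ler_peMl ?sqr_ge0// -(@ler_pM2l _ (expR (-1))) ?expR_gt0//.
    by rewrite mulr1 mulrC -mulrA -expRD subrr expR0 mulr1 w_ge.
rewrite mulrAC [2 * _]mulrC -!mulrA ler_pM2l ?expR_gt0//.
apply: (le_trans hc); rewrite /a invrK -mulrA ler_pM2l// [leRHS]mulrC ler_pM2l ?exprn_gt0//.
rewrite [leRHS]Rintegral_mkcond; apply: le_Rintegral => //.
- exact: integrable_w.
- exact: integrable_K.
- move=> x _; rewrite patchE; case: ifPn => [/set_mem Kx|]; last first.
    by rewrite notin_setE => /w_notin ->; rewrite mul0r.
  by rewrite ler_piMl.
Qed.

End weighted.

Lemma poincare_C11 : exists c,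
  \int[leb]_(x in K) (psi x - c) ^+ 2 <=
  2 * expR 1 * D ^+ 2 * \int[leb]_(x in K) \sum_i G i x ^+ 2.
Proof.
have [[x Kx]|K0] := pselect (K !=set0); first exact: poincare_C11_aux Kx.
have -> : K = set0 by apply/seteqP; split => // x Kx; apply: K0; exists x.
by exists 0; rewrite !Rintegral_set0 mulr0.
Qed.

End poincare.

(** * Second-order Taylor bounds for products of one-variable functions *)

Section taylor.
Variables (R : realType) (n : nat).
Implicit Types (x y : 'rV[R]_n) (f k : 'rV[R]_n -> R).

Lemma mean_value (h h' : R -> R) (t s : R) : (forall t : R, is_derive t 1 h (h' t)) ->
  exists2 xi, `|xi - t| <= `|s - t| & h s - h t = h' xi * (s - t).
Proof.
move=> hh.
have ch (z : R) : {for z, continuous h}.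
  by apply: differentiable_continuous; apply/derivable1_diffP; have [] := hh z.
have [ts|st|->] := ltgtP t s.
- have [xi] := MVT ts (fun z _ => hh z) (continuous_subspaceT ch).
  rewrite in_itv/= => /andP[h1 h2] ->; exists xi => //.
  by rewrite !gtr0_norm ?subr_gt0// lerD2r ltW.
- have [xi] := MVT st (fun z _ => hh z) (continuous_subspaceT ch).
  rewrite in_itv/= => /andP[h1 h2] e; exists xi; first by rewrite !ltr0_norm ?subr_lt0// lerN2 lerD2r ltW.
  by rewrite -[LHS]opprB e; ring.
- by exists s; rewrite ?subrr ?normr0// mulr0.
Qed.

Lemma taylor_1d (h0 h1 h2 : R -> R) (M : R) : (forall t : R, is_derive t 1 h0 (h1 t)) ->
  (forall t : R, is_derive t 1 h1 (h2 t)) -> (forall t, `|h2 t| <= M) ->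
  forall t s, `|h0 s - h0 t - h1 t * (s - t)| <= M * (s - t) ^+ 2.
Proof.
move=> d1 d2 hM t s; have [xi xit ->] := mean_value t s d1.
have [eta _ e] := mean_value t xi d2.
rewrite -mulrBl e !normrM -[(s - t) ^+ 2]real_normK ?num_real// expr2 -mulrA.
by rewrite ler_pM// ?mulr_ge0// ler_wpM2r.
Qed.

Definition l1dist x y : R := \sum_i `|y 0 i - x 0 i|.

Lemma l1dist_ge0 x y : 0 <= l1dist x y.
Proof. exact: sumr_ge0. Qed.

Lemma l1dist_coord x y i : `|y 0 i - x 0 i| <= l1dist x y.
Proof. by rewrite /l1dist (bigD1 i)//= lerDl sumr_ge0. Qed.

(** Cauchy-Schwarz against the constant vector, read off the discriminant of the sum of
    [(1 + t * d) ^+ 2] over the coordinate distances [d]. *)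
Lemma l1dist_sqr x y : l1dist x y ^+ 2 <= n%:R * sqdist x y.
Proof.
have h := @quadratic_ge0_discr R (\sum_(i < n) 1) (l1dist x y) (sqdist x y).
rewrite (_ : n%:R = \sum_(i < n) 1 :> R); last by rewrite sumr_const card_ord.
apply: h => t; rewrite /l1dist /sqdist !mulr_sumr -!big_split/=.
apply: sumr_ge0 => i _.
rewrite (_ : (x 0 i - y 0 i) ^+ 2 = `|y 0 i - x 0 i| ^+ 2); last first.
  by rewrite real_normK ?num_real// -sqrrN opprB.
set d := `|_|; rewrite (_ : _ + _ = (1 + t * d) ^+ 2) ?sqr_ge0//; ring.
Qed.

(* [Phi] is the gradient of [f] and [M] bounds [f] and its derivatives up to order two. *)
Definition taylor_bound M f (Phi : 'I_n -> 'rV[R]_n -> R) := [/\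
  forall x, `|f x| <= M, forall i x, `|Phi i x| <= M &
  forall x y, `|f y - f x - \sum_i Phi i x * (y 0 i - x 0 i)| <= M * l1dist x y ^+ 2].

Lemma taylor_bound_linear M f Phi x y : taylor_bound M f Phi ->
  `|\sum_i Phi i x * (y 0 i - x 0 i)| <= M * l1dist x y.
Proof.
move=> [_ h _]; rewrite (le_trans (ler_norm_sum _ _ _))// /l1dist mulr_sumr.
by apply: ler_sum => i _; rewrite normrM ler_wpM2r.
Qed.

Lemma taylor_bound_ge0 M f Phi : taylor_bound M f Phi -> 0 <= M.
Proof. by move=> [h _ _]; exact: le_trans (h 0). Qed.

(** At distance at most 1 the Taylor remainder is dominated by the distance itself; beyond 1 the
    uniform bound on [f] is enough. *)
Lemma taylor_bound_lip M f Phi x y : taylor_bound M f Phi ->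
  `|f y - f x| <= 3 * M * l1dist x y.
Proof.
move=> h; have M0 := taylor_bound_ge0 h; have := taylor_bound_linear x y h.
have d0 := l1dist_ge0 x y.
case: h => [h1 h2 h3] h4; have [d1|d1] := leP (l1dist x y) 1.
  have := h3 x y; set L := \sum_i _ in h4 * => h5.
  have : `|f y - f x| <= M * l1dist x y ^+ 2 + M * l1dist x y.
    rewrite -[f y - f x](subrK L) (le_trans (ler_normD _ _))//.
    exact: lerD.
  by have : l1dist x y ^+ 2 <= l1dist x y by [rewrite expr2 ler_piMl]; nra.
have : `|f y - f x| <= M + M by rewrite (le_trans (ler_normB _ _))// lerD.
by nra.
Qed.

Lemma taylor_boundM M N f k Phi Psi : taylor_bound M f Phi -> taylor_bound N k Psi ->
  taylor_bound (5 * M * N) (fun x => f x * k x) (fun i x => Phi i x * k x + f x * Psi i x).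
Proof.
move=> hf hk; have M0 := taylor_bound_ge0 hf; have N0 := taylor_bound_ge0 hk.
have MN : 0 <= M * N by exact: mulr_ge0.
have [f1 f2 f3] := hf; have [k1 k2 k3] := hk; split.
- by move=> x; rewrite normrM (@le_trans _ _ (M * N))// ?ler_pM//; lra.
- move=> i x; rewrite (le_trans (ler_normD _ _))// !normrM.
  by rewrite (@le_trans _ _ (M * N + M * N))// ?lerD ?ler_pM//; lra.
- move=> x y; set d := l1dist x y.
  have d0 : 0 <= d := l1dist_ge0 x y.
  pose F := \sum_i Phi i x * (y 0 i - x 0 i); pose K := \sum_i Psi i x * (y 0 i - x 0 i).
  (* The remainder of a product splits into three terms, of sizes 1, 1 and 3 times [M * N * d ^+ 2],
     whence the factor 5. *)
  rewrite (_ : _ - _ = (f y - f x - F) * k y + f x * (k y - k x - K) + F * (k y - k x)); last first.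
    rewrite (_ : \sum_i _ = F * k x + f x * K).
      by ring.
    by rewrite /F /K mulr_suml mulr_sumr -big_split/=; apply: eq_bigr => i _; ring.
  have a1 : `|(f y - f x - F) * k y| <= M * d ^+ 2 * N by rewrite normrM ler_pM.
  have a2 : `|f x * (k y - k x - K)| <= M * (N * d ^+ 2) by rewrite normrM ler_pM.
  have a3 : `|F * (k y - k x)| <= (M * d) * (3 * N * d).
    by rewrite normrM ler_pM//; [exact: taylor_bound_linear hf|exact: taylor_bound_lip hk].
  rewrite (le_trans (ler_normD _ _))// (le_trans (lerD (ler_normD _ _) (lexx _)))//.
  by rewrite (le_trans (lerD (lerD a1 a2) a3))// le_eqVlt; apply/orP; left; apply/eqP; ring.
Qed.

(** The first-order term of a Taylor bound is forced, so a [Phi] built factor by factor can be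
    recognised afterwards as the gradient. *)
Lemma taylor_bound_partial M f Phi i x : taylor_bound M f Phi -> partial i f x = Phi i x.
Proof.
move=> hf; have M0 := taylor_bound_ge0 hf; have [_ _ h] := hf.
suff : is_derive x (delta_mx 0 i : 'rV[R]_n) f (Phi i x) by move=> [_ <-].
apply: cvg_is_derive; apply/cvgrPdist_le => /= e e0.
have e' : 0 < e / (M + 1) by rewrite divr_gt0// ltr_wpDl.
near=> t.
have t0 : t != 0 by near: t; exact: nbhs_dnbhs_neq.
have te : `|t| <= e / (M + 1).
  near: t; have := @dnbhs0_le R R _ e'; exact.
have := h x (t *: delta_mx 0 i + x).
rewrite (_ : \sum_j _ = Phi i x * t); last first.
  rewrite (bigD1 i)//= big1 ?addr0.
    by rewrite !mxE !eqxx mulr1 addrK.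
  by move=> j ji; rewrite !mxE eqxx/= (negbTE ji) mulr0 add0r subrr mulr0.
rewrite (_ : l1dist _ _ = `|t|); last first.
  rewrite /l1dist (bigD1 i)//= big1 ?addr0.
    by rewrite !mxE !eqxx mulr1 addrK.
  by move=> j ji; rewrite !mxE eqxx/= (negbTE ji) mulr0 add0r subrr normr0.
move=> h'.
rewrite scale_mulr distrC -(@ler_pM2l _ `|t|) ?normr_gt0// -normrM mulrBr mulrA divff// mul1r.
rewrite [t * _]mulrC (le_trans h')// expr2 mulrCA ler_pM2l ?normr_gt0//.
apply: (@le_trans _ _ ((M + 1) * `|t|)); first by rewrite ler_wpM2r// lerDl.
by move: te; rewrite ler_pdivlMr ?ltr_wpDl// mulrC.
Unshelve. all: by end_near.
Qed.

Lemma taylor_bound_prod_coord (h : 'I_n -> nat -> R -> R) (m : 'I_n -> nat) : smooth_family h ->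
  (forall i (j : nat), exists C : R, forall t, `|h i j t| <= C) ->
  exists M : R, taylor_bound M (prod_coord h m) (fun i => partial i (prod_coord h m)).
Proof.
move=> sh bh.
suff : forall r : seq 'I_n, exists M Phi, taylor_bound M (fun x => \prod_(i <- r) h i (m i) (x 0 i)) Phi.
  move=> /(_ (index_enum _))[M [Phi hM]]; exists M.
  have -> : (fun i => partial i (prod_coord h m)) = Phi.
    by apply/funext => i; apply/funext => x; exact: taylor_bound_partial hM.
  exact: hM.
elim=> [|i r [M [Phi IH]]].
  exists 1, (fun _ _ => 0); split => [x|i x|x y].
  - by rewrite big_nil normr1.
  - by rewrite normr0.
  - by rewrite !big_nil subrr big1 ?subrr ?normr0 ?mul1r ?sqr_ge0// => j _; rewrite mul0r.
have [C0 hC0] := bh i (m i); have [C1 hC1] := bh i (m i).+1; have [C2 hC2] := bh i (m i).+2.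
have C00 : 0 <= C0 := le_trans (normr_ge0 _) (hC0 0).
have C10 : 0 <= C1 := le_trans (normr_ge0 _) (hC1 0).
have C20 : 0 <= C2 := le_trans (normr_ge0 _) (hC2 0).
pose C := C0 + C1 + C2.
have hi : taylor_bound C (fun x => h i (m i) (x 0 i)) (fun j x => h i (m i).+1 (x 0 i) *+ (i == j)).
  split => [x|j x|x y].
  - by rewrite (le_trans (hC0 _))// /C; lra.
  - case: (i == j); rewrite ?mulr1n ?mulr0n ?normr0; last by rewrite /C; lra.
    by rewrite (le_trans (hC1 _))// /C; lra.
  - rewrite (bigD1 i)//= big1 ?addr0 ?eqxx ?mulr1n; last first.
      by move=> j; rewrite eq_sym => /negbTE ->; rewrite mulr0n mul0r.
    apply: le_trans (taylor_1d (sh i (m i)) (sh i (m i).+1) hC2 _ _) _.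
    rewrite ler_pM ?sqr_ge0//; first by rewrite /C; lra.
    by rewrite -[leLHS]real_normK ?num_real// lerXn2r ?nnegrE ?l1dist_ge0// l1dist_coord.
have h2 := taylor_boundM hi IH; eexists; eexists.
rewrite (_ : (fun x => _) = fun x => h i (m i) (x 0 i) * \prod_(i <- r) h i (m i) (x 0 i)).
  exact: h2.
by apply/funext => x; rewrite big_cons.
Qed.

Lemma taylor_bound_bump (a : R) (b : 'I_n -> R) :
  exists M : R, taylor_bound M (bump_rV a b) (fun i => partial i (bump_rV a b)).
Proof.
apply: taylor_bound_prod_coord; first exact: smooth_bump_family.
move=> i k; have [C C0 hC] := bump_bounded R k; exists (`|a ^+ k| * C) => t.
by rewrite /bump_family normrM ler_wpM2l.
Qed.

End taylor.

(** * Continuity of translations and mollification *)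

Section translation.
Variables (R : realType) (n : nat).
Local Notation leb := (lebesgue_rV R n).
Local Notation mu := (@lebesgue_measure R).
Implicit Types (x z : 'rV[R]_n) (A B : set 'rV[R]_n) (u v : 'rV[R]_n -> R).

Lemma measurable_shift z : measurable_fun setT (fun x : 'rV[R]_n => x + z).
Proof.
have := measurable_rV_affine 1 z; congr measurable_fun.
by apply/funext => x; rewrite scale1r.
Qed.

Definition shift_set z A := [set x | A (x + z)].

Lemma measurable_shift_set z A : measurable A -> measurable (shift_set z A).
Proof.
by move=> mA; have := measurable_shift z measurableT mA; rewrite setTI.
Qed.

Lemma lebesgue_shift_set z A : measurable A -> leb (shift_set z A) = leb A.
Proof.
move=> mA.
transitivity (\int[leb]_x (\1_A (x + z))%:E)%E.
  transitivity (\int[leb]_x (\1_(shift_set z A) x)%:E)%E.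
    by rewrite integral_indic ?setIT//; exact: measurable_shift_set.
  apply: eq_integral => x _; rewrite !indicE.
  by have -> : (x \in shift_set z A) = (x + z \in A) by apply/idP/idP => /set_mem h; apply/mem_set.
rewrite (ge0_integral_rV_shift z (f := fun x => (\1_A x)%:E))//.
  by rewrite integral_indic// setIT.
by apply/measurable_EFinP; exact: measurable_indic.
Qed.

Lemma lebesgue_rV_prod (A : 'I_n -> set R) :
  (forall i, measurable (A i : set (measurableTypeR R))) ->
  leb [set x : 'rV[R]_n | forall i, A i (x 0 i)] = (\prod_i mu (A i))%E.
Proof.
move=> mA.
have mB := measurable_rV_box mA.
transitivity (\int[leb]_x (\prod_i \1_(A i) (x 0 i))%:E)%E.
  rewrite -[[set x | _]]setIT -integral_indic//.
  apply: eq_integral => x _; rewrite indicE; have [h|h] := boolP (_ \in _).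
    by move/set_mem : h => /= h; rewrite big1// => i _; rewrite indicE mem_set.
  rewrite notin_setE/= -existsNE in h; case: h => i hi.
  by rewrite (bigD1 i)//= indicE memNset// mul0r.
rewrite (integral_prod_coord (f := fun i => \1_(A i)))//.
by apply: eq_bigr => i _; rewrite integral_indic// setIT.
Qed.

Definition osc_set z B := (B `\` shift_set z B) `|` (shift_set z B `\` B).

Lemma measurable_osc_set z B : measurable B -> measurable (osc_set z B).
Proof.
by move=> mB; apply: measurableU; apply: measurableD => //; exact: measurable_shift_set.
Qed.

(** Continuity of translation in measure, localised to boxes so that complements stay in the class
    and the class becomes a sigma-algebra. *)
Definition small_osc B := measurable B /\ forall L e : R, 0 < e ->
  exists2 d : R, 0 < d & forall z, (forall i, `|z 0 i| <= d) ->
    (leb (rV_box L `&` osc_set z B) <= e%:E)%E.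

Lemma small_osc0 : small_osc set0.
Proof.
split=> // L e e0; exists 1 => // z _.
rewrite (_ : _ `&` _ = set0) ?measure0 ?lee_fin ?ltW//.
by apply/seteqP; split => // x [_ [[]|[]]].
Qed.

Lemma small_oscC B : small_osc B -> small_osc (~` B).
Proof.
move=> [mB h]; split; first exact: measurableC.
move=> L e e0; have [d d0 hd] := h L e e0; exists d => // z zd.
rewrite (_ : osc_set z (~` B) = osc_set z B); first exact: hd.
apply/seteqP; split => x [[/= h1 h2]|[/= h1 h2]].
- by right; split => //; exact: contrapT.
- by left; split => //; exact: contrapT.
- by right; split => // /(_ h1).
- by left; split => // /(_ h1).
Qed.

(** Up to a tail of small measure, only finitely many of the sets can distinguish [x] from [x + z].
    The budget is [e / 2] for these and [e / 4] each for the tail and its translate. *)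
Lemma small_osc_bigcup (F : nat -> set 'rV[R]_n) : (forall k, small_osc (F k)) ->
  small_osc (\bigcup_k F k).
Proof.
move=> hF; have mF k : measurable (F k) by have [] := hF k.
have mU : measurable (\bigcup_k F k) by exact: bigcup_measurable.
split => // L e e0.
(* The larger box still contains [x + z] for [x] in the box [L] and [z] with coordinates at most
   1. *)
pose T N := rV_box (L + 1) `&` (\bigcup_k F k `\` \bigcup_(k < N) F k).
have mS N : measurable (\bigcup_(k < N) F k) by apply: bigcup_measurable.
have mT N : measurable (T N).
  by apply: measurableI; [exact: measurable_rV_cube|exact: measurableD].
have [N hN] : exists N, (leb (T N) <= (e / 4)%:E)%E.
  have := @nonincreasing_cvg_mu _ _ _ leb T _ mT _ _.
  rewrite (_ : \bigcap_n T n = set0); last first.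
    apply/seteqP; split => // x hx; have [_ [[k _ Fk] _]] := hx 0%N I.
    by have [_ [_]] := hx k.+1 I; apply; exists k => /=.
  rewrite measure0 => h.
  have {}h : leb (T N) @[N --> \oo] --> (0 : \bar R)%E.
    apply: h => //.
    - apply: le_lt_trans (lebesgue_rV_box_lty n (L + 1)).
      by apply: le_measure => //; rewrite ?inE//; [exact: measurable_rV_cube|move=> x []].
    - move=> a b ab; apply/subsetPset => x [bx [Ux nx]]; split => //; split => // -[k /= ka Fk].
      by apply: nx; exists k => //=; exact: leq_trans ab.
  have e4 : (0 < (e / 4)%:E)%E by rewrite lte_fin divr_gt0.
  have /fine_cvgP[fT hT] := h.
  have /cvgrPdist_le/(_ (e / 4)) := hT; rewrite divr_gt0// => /(_ isT) hT'.
  have [N _ hN] : \forall N \near \oo, leb (T N) \is a fin_num /\ `|0 - fine (leb (T N))| <= e / 4.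
    by near=> N; split; near: N.
  have [fN dN] := hN _ (leqnn N); exists N.
  by rewrite -(fineK fN) lee_fin; move: dN; rewrite sub0r normrN; apply: le_trans; exact: ler_norm.
have [d d0 hd] : exists2 d : R, 0 < d & forall z, (forall i, `|z 0 i| <= d) -> forall k, (k < N)%N ->
    (leb (rV_box L `&` osc_set z (F k)) <= (e / (2 * (N.+1)%:R))%:E)%E.
  have h k : exists d : R, 0 < d /\ forall z, (forall i, `|z 0 i| <= d) ->
      (leb (rV_box L `&` osc_set z (F k)) <= (e / (2 * (N.+1)%:R))%:E)%E.
    have [d d0 hd] := (hF k).2 L (e / (2 * N.+1%:R)) (divr_gt0 e0 (mulr_gt0 (ltr0Sn _ 1) (ltr0Sn _ N))).
    by exists d.
  have [f hf] := boolp.choice h.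
  exists (\big[Num.min/1]_(k < N) f k).
    by apply: (big_ind (fun t : R => 0 < t)) => //; [move=> a b a0 b0; rewrite lt_min a0|move=> i _; have [] := hf i].
  move=> z hz k kN; have [_] := hf k; apply => i; apply: (le_trans (hz i)).
  exact: (bigmin_le 1 (Ordinal kN) (fun k : 'I_N => f k)).
exists (Num.min d 1); first by rewrite lt_min d0 ltr01.
move=> z hz.
have zd i : `|z 0 i| <= d by have := hz i; rewrite le_min => /andP[].
have z1 i : `|z 0 i| <= 1 by have := hz i; rewrite le_min => /andP[].
apply: (@le_trans _ _ (leb (\big[setU/set0]_(k < N) (rV_box L `&` osc_set z (F k)) `|`
    (T N `|` shift_set z (T N))))).
  apply: le_measure; rewrite ?inE.
  - by apply: measurableI; [exact: measurable_rV_cube|exact: measurable_osc_set].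
  - apply: measurableU.
      by apply: bigsetU_measurable => k _; apply: measurableI; [exact: measurable_rV_cube|exact: measurable_osc_set].
    by apply: measurableU => //; exact: measurable_shift_set.
  move=> x [bx osc].
  have bx' i : `|x 0 i| <= L + 1 by rewrite (le_trans (bx i))// lerDl.
  have bxz i : `|(x + z) 0 i| <= L + 1.
    by rewrite mxE (le_trans (ler_normD _ _))// lerD.
  have [[k [kN ok]]|no] := pselect (exists k, (k < N)%N /\ osc_set z (F k) x).
    by left; rewrite -(bigcup_mkord N (fun k => rV_box L `&` osc_set z (F k))); exists k.
  have same k : (k < N)%N -> F k x <-> F k (x + z).
    move=> kN; split => h; apply: contrapT => h'; apply: no; exists k; split => //.
      by left.
    by right.
  right; case: osc => [[[k _ Fk] nU]|[[k _ Fk] nU]].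
  - left; split => //; split; first by exists k.
    move=> [j /= jN] /(same j jN) Fj; apply: nU; by exists j.
  - right; split => //; split; first by exists k.
    move=> [j /= jN] /(same j jN) Fj; apply: nU; by exists j.
apply: le_trans; first by apply: measureU2;
  [apply: bigsetU_measurable => k _; apply: measurableI; [exact: measurable_rV_cube|exact: measurable_osc_set]|
   apply: measurableU => //; exact: measurable_shift_set].
rewrite (_ : e = e / 2 + (e / 4 + e / 4)); last by field.
rewrite EFinD; apply: leeD.
  apply: (@le_trans _ _ (\sum_(k < N) leb (rV_box L `&` osc_set z (F k)))%E).
    apply: (@Boole_inequality _ _ _ leb (fun k => rV_box L `&` osc_set z (F k)) N) => k kN.
    by apply: measurableI; [exact: measurable_rV_cube|exact: measurable_osc_set].
  apply: (@le_trans _ _ (\sum_(k < N) (e / (2 * (N.+1)%:R))%:E)%E).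
    by apply: lee_sum => k _; exact: hd.
  rewrite sumEFin lee_fin sumr_const card_ord -[_ *+ N]mulr_natl.
  set m := N.+1%:R; have m0 : 0 < m by rewrite ltr0n.
  rewrite (_ : N%:R * _ = e / 2 * (N%:R / m)); last by rewrite invfM [2^-1 * _]mulrC; ring.
  rewrite ler_piMr ?divr_ge0 ?(ltW e0)// ler_pdivrMr// mul1r ler_nat.
  exact: leqnSn.
apply: le_trans; first by apply: measureU2 => //; exact: measurable_shift_set.
have hN' : (leb (shift_set z (T N)) <= (e / 4)%:E)%E by rewrite lebesgue_shift_set.
by rewrite EFinD; exact: leeD.
Unshelve. all: by end_near.
Qed.

Lemma measurable_slab (a d : R) (i : 'I_n) : measurable [set x : 'rV[R]_n | `|x 0 i - a| <= d].
Proof.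
rewrite (_ : [set x | _] = (fun x : 'rV[R]_n => x 0 i : measurableTypeR R) @^-1` `[a - d, a + d]%classic).
  by rewrite -[X in measurable X]setTI; apply: measurable_rV_coord => //; exact: measurable_itv.
by apply/seteqP; split => x /=; rewrite in_itv/= ler_distl.
Qed.

Lemma lebesgue_slab (L a : R) (i : 'I_n) (e : R) : 0 < e -> exists2 d : R, 0 < d &
  (leb (rV_box L `&` [set x | (`|x 0 i - a| <= d)%R]) <= e%:E)%E.
Proof.
move=> e0.
pose Y d (j : 'I_n) := if j == i then `[a - d, a + d]%classic else `[- L, L]%classic.
(* [Num.max 0] covers a negative [L], and the [+ 1] makes [C] positive. *)
pose C : R := (\prod_(j < n | j != i) Num.max 0 (2 * L)) + 1.
have C0 : 0 < C by rewrite ltr_wpDl//; apply: prodr_ge0 => j _; rewrite le_max lexx.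
exists (e / (2 * C)); first by rewrite divr_gt0// mulr_gt0.
set d := e / _; have d0 : 0 < d by rewrite divr_gt0// mulr_gt0.
have seg (b c : R) : (mu `[b, c]%classic <= (Num.max 0 (c - b))%:E)%E.
  rewrite lebesgue_measure_itv/= lte_fin; case: ifPn => _; rewrite -?EFinB lee_fin le_max ?lexx ?orbT//.
apply: (@le_trans _ _ (leb [set x : 'rV[R]_n | forall j, Y d j (x 0 j)])).
  apply: le_measure; rewrite ?inE.
  - apply: measurableI; first exact: measurable_rV_cube.
    exact: measurable_slab.
  - by apply: measurable_rV_box => j; rewrite /Y; case: ifP => _; exact: measurable_itv.
  - move=> x [bx xi] j; rewrite /Y; case: ifPn => [/eqP ->|_] /=.
      by rewrite in_itv/= -ler_distl.
    by rewrite in_itv/= -ler_norml; exact: bx.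
rewrite lebesgue_rV_prod; last by move=> j; rewrite /Y; case: ifP => _; exact: measurable_itv.
apply: (@le_trans _ _ (\prod_j (if j == i then 2 * d else Num.max 0 (2 * L))%:E)%E).
  elim: (index_enum _) => [|j r IH]; first by rewrite !big_nil.
  rewrite !big_cons lee_pmul//.
    by apply: prode_ge0.
  rewrite /Y; case: ifP => _; apply: le_trans (seg _ _) _; rewrite lee_fin.
    rewrite ge_max; apply/andP; split; first by rewrite mulr_ge0// ltW.
    lra.
  by rewrite ge_max !le_max lexx/=; apply/orP; right; lra.
rewrite prodEFin lee_fin (bigD1 i)//= eqxx (eq_bigr (fun=> Num.max 0 (2 * L))); last first.
  by move=> j /negbTE ->.
set P := \prod_(j < n | j != i) _; rewrite /d -/P.
rewrite (_ : 2 * (e / (2 * C)) * P = e * P / C); last by field; rewrite gt_eqF.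
by rewrite ler_pdivrMr// ler_pM2l// /C lerDl.
Qed.

(** A half-space and its translate differ only in a thin slab around the bounding hyperplane. *)
Lemma small_osc_ray (a : R) (i : 'I_n) : small_osc [set x | a < x 0 i].
Proof.
have mB : measurable [set x : 'rV[R]_n | a < x 0 i].
  rewrite (_ : [set x | _] = (fun x : 'rV[R]_n => x 0 i : measurableTypeR R) @^-1` `]a, +oo[%classic).
    by rewrite -[X in measurable X]setTI; apply: measurable_rV_coord => //; exact: measurable_itv.
  by apply/seteqP; split => x /=; rewrite in_itv/= andbT.
split => // L e e0; have [d d0 hd] := lebesgue_slab L a i e0.
exists d => // z zd; apply: le_trans hd; apply: le_measure; rewrite ?inE.
- by apply: measurableI; [exact: measurable_rV_cube|exact: measurable_osc_set].
- apply: measurableI; first exact: measurable_rV_cube.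
  exact: measurable_slab.
- move=> x [bx ox]; split => //=; have := zd i; rewrite !ler_norml.
  move: ox; rewrite /osc_set /shift_set /= mxE.
by case=> -[h1 /negP]; rewrite -leNgt => h2 h3; lra.
Qed.

(** Two generation arguments are nested: row-vector sets are generated by preimages under
    coordinates, and Borel sets of the line by open rays. *)
Lemma small_osc_measurable B : measurable B -> small_osc B.
Proof.
suff : g_sigma_preimage (fun i (x : 'rV[R]_n) => x 0 i : measurableTypeR R) `<=` small_osc.
  by move=> h mB; exact: h.
apply: smallest_sub.
  split => /=; first exact: small_osc0.
  - by move=> A mA; rewrite setTD; exact: small_oscC.
  - exact: small_osc_bigcup.
rewrite -bigcup_seq/=; apply: bigcup_sub => i _ _ [Y mY <-] /=; rewrite setTI.
suff : (@ocitv R).-sigma.-measurable `<=` [set Y | small_osc ((fun x : 'rV[R]_n => x 0 i) @^-1` Y)].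
  by apply.
rewrite RGenOInfty.measurableE; apply: smallest_sub.
  split => /=.
  - by rewrite preimage_set0; exact: small_osc0.
  - by move=> A mA; rewrite setTD preimage_setC; exact: small_oscC.
  - by move=> F mF; rewrite preimage_bigcup; exact: small_osc_bigcup.
move=> _ [a ->] /=; have := small_osc_ray a i; congr small_osc.
by apply/seteqP; split => x /=; rewrite in_itv/= andbT.
Qed.

Local Notation L2 := (sqint leb setT).
Local Notation ip2 := (ip leb setT).

Definition translate z u := fun x => u (x + z).

Lemma measurable_fun_shift z u : measurable_fun setT (u : 'rV[R]_n -> measurableTypeR R) ->
  measurable_fun setT (translate z u : 'rV[R]_n -> measurableTypeR R).
Proof. by move=> mu'; apply: measurableT_comp => //; exact: measurable_shift. Qed.

Lemma integral_sqr_shift z u : measurable_fun setT (u : 'rV[R]_n -> measurableTypeR R) ->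
  (\int[leb]_x (translate z u x ^+ 2)%:E = \int[leb]_x (u x ^+ 2)%:E)%E.
Proof.
move=> mu'; rewrite -(integral_rV_shift z (f := fun x => (u x ^+ 2)%:E))//.
by apply/measurable_EFinP; exact: measurable_funX.
Qed.

Lemma sqint_shift z u : L2 u -> L2 (translate z u).
Proof.
move=> su; have [mu' _] := su; apply: sqint_ltyP.
  exact: measurable_fun_shift.
by rewrite integral_sqr_shift// (ip_EFin measurableT su) ltry.
Qed.

Lemma ip_shift z u : L2 u -> ip2 (translate z u) (translate z u) = ip2 u u.
Proof.
move=> su; apply: EFin_inj; rewrite -!ip_EFin//; last exact: sqint_shift.
by rewrite integral_sqr_shift//; have [] := su.
Qed.

(** This class is a linear space closed in L2, so indicators of bounded measurable sets suffice:
    simple functions, nonnegative functions and differences follow. *)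
Definition translation_cont u := L2 u /\ forall e : R, 0 < e ->
  exists2 d : R, 0 < d & forall z, (forall i, `|z 0 i| <= d) ->
    ip2 (translate z u \- u) (translate z u \- u) <= e.

Let formL2 := psd_ip leb (@measurableT _ 'rV[R]_n).
Let subL2 := subspace_sqint leb (@measurableT _ 'rV[R]_n).

Lemma ip2_sqrD_le u v : L2 u -> L2 v -> ip2 (u \+ v) (u \+ v) <= 2 * ip2 u u + 2 * ip2 v v.
Proof.
move=> su sv.
have := form_sqrB_le subL2 formL2 su (subspZ subL2 (-1) sv).
rewrite (form_sqrZ subL2 formL2)// sqrrN expr1n mul1r scaleN1r opprK; exact.
Qed.

Lemma ip2_sqrZ (c : R) u : L2 u -> ip2 (fun x => c * u x) (fun x => c * u x) = c ^+ 2 * ip2 u u.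
Proof. by move=> su; have := form_sqrZ subL2 formL2 c su. Qed.

Lemma ip2_sqrBC u v : ip2 (u \- v) (u \- v) = ip2 (v \- u) (v \- u).
Proof. by apply: eq_Rintegral => x _ /=; ring. Qed.

Lemma translation_cont0 : translation_cont (fun=> 0).
Proof.
split; first exact: sqint0.
move=> e e0; exists 1 => // z _; rewrite /ip.
under eq_Rintegral do rewrite /= subrr mul0r.
by rewrite /Rintegral integral0 ltW.
Qed.

Lemma translation_contZD (c : R) u v : translation_cont u -> translation_cont v ->
  translation_cont (fun x => c * u x + v x).
Proof.
move=> [su hu] [sv hv]; split; first exact: sqintZD.
move=> e e0; have c0 : 0 < 4 * (c ^+ 2 + 1) by rewrite mulr_gt0// ltr_wpDl ?sqr_ge0.
have [d d0 hd] := hu (e / (4 * (c ^+ 2 + 1))) (divr_gt0 e0 c0).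
have [d' d'0 hd'] := hv (e / 4) (divr_gt0 e0 (ltr0Sn _ 3)).
exists (Num.min d d'); first by rewrite lt_min d0.
move=> z zd.
have su' : L2 (translate z u \- u) by apply: sqintB => //; exact: sqint_shift.
have sv' : L2 (translate z v \- v) by apply: sqintB => //; exact: sqint_shift.
rewrite (_ : _ \- _ = (fun x => c * (translate z u \- u) x) \+ (translate z v \- v)); last first.
  by apply/funext => x; rewrite /translate /=; ring.
apply: le_trans (ip2_sqrD_le (sqintZ measurableT c su') sv') _.
rewrite ip2_sqrZ//.
have := hd z; rewrite ler_pdivlMr// => /(_ _)/wrap[|h1].
  by move=> i; have := zd i; rewrite le_min => /andP[].
have := hd' z; move=> /(_ _)/wrap[|h2].
  by move=> i; have := zd i; rewrite le_min => /andP[].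
have := ip_ge0 leb setT (translate z u \- u).
move: h1 h2; set a := ip2 _ _; set b := ip2 _ _ => h1 h2 h3; nra.
Qed.

(** Translation is an isometry, so the error of approximating [u] by [v] is counted before and after
    the shift. Splitting squares twice weights the three terms by 2, 4 and 4, hence the tolerance
    [e / 10]. *)
Lemma translation_cont_closed u : L2 u ->
  (forall e : R, 0 < e -> exists2 v, translation_cont v & ip2 (u \- v) (u \- v) <= e) ->
  translation_cont u.
Proof.
move=> su h; split => // e e0; have [v [sv hv] uv] := h (e / 10) (divr_gt0 e0 (ltr0Sn _ 9)).
have [d d0 hd] := hv (e / 10) (divr_gt0 e0 (ltr0Sn _ 9)); exists d => // z zd.
have suv : L2 (u \- v) by exact: sqintB.
have s1 : L2 (translate z (u \- v)) by exact: sqint_shift.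
have s2 : L2 (translate z v \- v) by apply: sqintB => //; exact: sqint_shift.
have s3 : L2 (v \- u) by exact: sqintB.
rewrite (_ : _ \- _ = translate z (u \- v) \+ ((translate z v \- v) \+ (v \- u))); last first.
  by apply/funext => x; rewrite /translate /=; ring.
have s4 : L2 ((translate z v \- v) \+ (v \- u)) := sqintD measurableT s2 s3.
apply: le_trans (ip2_sqrD_le s1 s4) _.
have := ip2_sqrD_le s2 s3; have := hd z zd.
rewrite ip_shift// [ip2 (v \- u) _]ip2_sqrBC; lra.
Qed.

Lemma translation_cont_indic L B : measurable B -> B `<=` rV_box L -> translation_cont \1_B.
Proof.
move=> mB BL.
have s1 : L2 \1_B.
  split; first exact: measurable_indic.
  apply: (integrable_box_supported (C := 1) (L := L)).
  - by apply: measurable_funX; exact: measurable_indic.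
  - by move=> x; rewrite indicE; case: (_ \in _); rewrite ?expr1n ?expr0n/= ?normr1 ?normr0.
  - by move=> x nx; rewrite indicE memNset ?expr0n// => /BL.
split => // e e0; have [_ /(_ (L + 1) e e0)[d d0 hd]] := small_osc_measurable mB.
exists (Num.min d 1); first by rewrite lt_min d0 ltr01.
move=> z zd.
have zd1 i : `|z 0 i| <= d by have := zd i; rewrite le_min => /andP[].
have z1 i : `|z 0 i| <= 1 by have := zd i; rewrite le_min => /andP[].
rewrite -lee_fin -ip_EFin//; last by apply: sqintB => //; exact: sqint_shift.
apply: le_trans (hd z zd1).
have mO : measurable (rV_box (L + 1) `&` osc_set z B).
  by apply: measurableI; [exact: measurable_rV_cube|exact: measurable_osc_set].
rewrite -[X in (_ <= leb X)%E]setIT -integral_indic//.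
apply: ge0_le_integral => //.
- by move=> x _; rewrite lee_fin sqr_ge0.
- apply/measurable_EFinP; apply: measurable_funX; apply: measurable_funB; last exact: measurable_indic.
  by apply: measurable_fun_shift; exact: measurable_indic.
- by apply/measurable_EFinP; exact: measurable_indic.
move=> x _; rewrite lee_fin /translate /=.
have inb : B x \/ B (x + z) -> rV_box (L + 1) x.
  case=> [/BL h i|/BL h i]; first by rewrite (le_trans (h i))// lerDl.
  have := h i; rewrite mxE => h'.
  have -> : x 0 i = (x 0 i + z 0 i) - z 0 i by rewrite addrK.
  by rewrite (le_trans (ler_normB _ _))// lerD.
rewrite !indicE.
have [/set_mem h1|h1] := boolP (x + z \in B); have [/set_mem h2|h2] := boolP (x \in B).
- by rewrite subrr expr0n.
- rewrite mem_set ?subr0 ?expr1n//; split; first by apply: inb; right.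
  by right; split => //; rewrite notin_setE in h2.
- rewrite mem_set ?sub0r ?sqrrN ?expr1n//; split; first by apply: inb; left.
  by left; split => //; rewrite notin_setE in h1.
- by rewrite subrr expr0n.
Qed.

Lemma translation_cont_nnsfun L (f : {nnsfun 'rV[R]_n >-> R}) : (forall x, ~ rV_box L x -> f x = 0) ->
  translation_cont f.
Proof.
move=> fL.
rewrite (_ : (f : 'rV[R]_n -> R) =
  fun x => \sum_(y <- finmap.enum_fset (fset_set (range f))) y * \1_(f @^-1` [set y]) x); last first.
  by apply/funext => x; rewrite fimfunE fsbig_finite.
elim: (finmap.enum_fset _) => [|y r IH].
  rewrite (_ : (fun _ => _) = fun=> 0); first exact: translation_cont0.
  by apply/funext => x; rewrite big_nil.
rewrite (_ : (fun _ => _) = fun x => y * \1_(f @^-1` [set y]) x + \sum_(y <- r) y * \1_(f @^-1` [set y]) x); last first.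
  by apply/funext => x; rewrite big_cons.
have [->|y0] := eqVneq y 0.
  by under eq_fun do rewrite mul0r add0r.
apply: translation_contZD => //; apply: (@translation_cont_indic L).
  exact: measurable_sfunP.
by move=> x /= fx; apply: contrapT => /fL; rewrite fx => /eqP; rewrite (negbTE y0).
Qed.

Lemma translation_cont_ge0 L u : L2 u -> (forall x, 0 <= u x) -> (forall x, ~ rV_box L x -> u x = 0) ->
  translation_cont u.
Proof.
move=> su u0 uL; have [mu' iu] := su.
have mEu : measurable_fun setT (EFin \o u) by apply/measurable_EFinP.
have [|g [ndg gu]] := approximation (@measurableT _ 'rV[R]_n) mEu.
  by move=> x _; rewrite lee_fin.
have gu' x : g k x @[k --> \oo] --> u x.
  by have /fine_cvgP[_] := gu x I.
have gle k x : g k x <= u x.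
  have nd : nondecreasing_seq (fun k => g k x).
    by move=> a b ab; have /lefP := ndg _ _ ab; apply.
  rewrite -(cvg_lim _ (gu' x))//; apply: nondecreasing_cvgn_le => //.
  by apply/cvg_ex; exists (u x); exact: gu'.
have g0 k x : 0 <= g k x by [].
have mg k : measurable_fun setT (g k : 'rV[R]_n -> measurableTypeR R) by move=> _ Y mY; rewrite setTI; exact: measurable_funPTI.
have sg k : L2 (g k).
  split => //; apply: (integrable_le_fun measurableT (v := fun x => u x ^+ 2)) => //.
    exact: measurable_funX.
  by move=> x _; rewrite ger0_norm ?sqr_ge0// lerXn2r ?nnegrE.
apply: translation_cont_closed => // e e0.
have dc := @dominated_convergence _ _ _ leb setT measurableT
  (fun k x => ((u x - g k x) ^+ 2)%:E) (fun=> 0%E) (fun x => (u x ^+ 2)%:E).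
have [] := dc.
- by move=> k; apply/measurable_EFinP; apply: measurable_funX; exact: measurable_funB.
- exact: measurable_cst.
- apply: aeW => x _; apply/fine_cvgP; split; first by near=> k.
  rewrite (_ : _ \o _ = fun k => (u x - g k x) ^+ 2)//.
  have h : u x - g k x @[k --> \oo] --> 0.
    by rewrite -(subrr (u x)); apply: cvgB; [exact: cvg_cst|exact: gu'].
  by rewrite -(mulr0 0); under eq_fun do rewrite expr2; exact: cvgM.
- exact: iu.
- apply: aeW => x k _; rewrite lee_fin ger0_norm ?sqr_ge0// lerXn2r ?nnegrE ?subr_ge0//.
  by rewrite gerBl.
move=> _ _; rewrite integral0 => h.
have s k : L2 (u \- g k) by apply: sqintB => //; exact: measurableT.
have {}h : ip2 (u \- g k) (u \- g k) @[k --> \oo] --> 0.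
  have /fine_cvgP[_] := h.
  rewrite (_ : fine \o _ = fun k => ip2 (u \- g k) (u \- g k))//.
have /cvgrPdist_le/(_ e e0)[N _ hN] := h.
exists (g N).
  apply: (@translation_cont_nnsfun L) => x /uL ux; apply/le_anti.
  by rewrite g0 andbT -ux.
by have := hN N (leqnn N); rewrite /= sub0r normrN; apply: le_trans; exact: ler_norm.
Unshelve. all: by end_near.
Qed.

Lemma sqint_translation_cont L u : L2 u -> (forall x, ~ rV_box L x -> u x = 0) -> translation_cont u.
Proof.
move=> su uL; have [mu' iu] := su.
have part v : measurable_fun setT (v : 'rV[R]_n -> measurableTypeR R) -> (forall x, 0 <= v x <= `|u x|) ->
    translation_cont v.
  move=> mv hv; apply: (@translation_cont_ge0 L).
  - split => //; apply: (integrable_le_fun measurableT (v := fun x => u x ^+ 2)) => //.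
      exact: measurable_funX.
    move=> x _; have /andP[v0 vu] := hv x.
    by rewrite ger0_norm ?sqr_ge0// -[leRHS]real_normK ?num_real// lerXn2r ?nnegrE.
  - by move=> x; have /andP[] := hv x.
  - by move=> x /uL ux; apply/le_anti; have := hv x; rewrite ux normr0 andbC.
have -> : u = fun x => -1 * Num.max (- u x) 0 + Num.max (u x) 0.
  apply/funext => x; rewrite !maxEle oppr_le0; case: (leP (u x) 0) => h.
    by case: (leP 0 (u x)) => h'; lra.
  by rewrite ltW//; lra.
apply: translation_contZD; apply: part.
- by apply: measurable_maxr; [exact: measurable_funN|exact: measurable_cst].
- by move=> x; rewrite le_max lexx orbT ge_max normr_ge0 andbT -normrN ler_norm.
- by apply: measurable_maxr => //; exact: measurable_cst.
- by move=> x; rewrite le_max lexx orbT ge_max normr_ge0 andbT ler_norm.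
Qed.

End translation.

(** On the middle half both [1 / (1 + t)] and [1 / (1 - t)] are at most 2. It makes the integrals of
    the bump and of its square strictly positive. *)
Lemma bump0_lower_bound (R : realType) (t : R) : `|t| <= 2^-1 -> expR (-4) <= bump 0 t.
Proof.
rewrite ler_norml => /andP[t1 t2].
have flat_ge (s : R) : 2^-1 <= s -> expR (-2) <= flat 1 s.
  move=> s2; have s0 : 0 < s by apply: lt_le_trans s2.
  rewrite /flat s0 hornerC mul1r ler_expR lerN2 -[leRHS]invrK lef_pV2 ?posrE ?invr_gt0//.
rewrite bump0E (_ : -4 = -2 + -2); last by ring.
by rewrite expRD ler_pM ?expR_ge0// flat_ge//; lra.
Qed.

Lemma integrable_scale d (T : measurableType d) (R : realType)
    (m : {measure set T -> \bar R}) (D : set T) (c : R) (f : T -> R) : measurable D ->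
  m.-integrable D (EFin \o f) -> m.-integrable D (EFin \o (fun x => c * f x)).
Proof. by move=> mD /(integrableZl mD c); apply: eq_integrable. Qed.

(** * Mollification by a compactly supported smooth kernel *)

Section mollifier.
Variables (R : realType) (n : nat).
Local Notation leb := (lebesgue_rV R n).
Implicit Types (x y z : 'rV[R]_n) (u v g : 'rV[R]_n -> R).
Local Notation L2 := (sqint leb setT).
Local Notation ip2 := (ip leb setT).

Lemma lipschitz_continuous (f : 'rV[R]_n -> R) C :
  (forall x y, `|f x - f y| <= C * l1dist y x) -> continuous f.
Proof.
move=> lip x; apply/(@cvgrPdist_le _ _ _ (nbhs x) (nbhs_filter x)) => /= e e0.
have lip' z y : `|f z - f y| <= (`|C| + 1) * l1dist y z.
  apply: le_trans (lip z y) _; rewrite ler_wpM2r ?l1dist_ge0//.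
  by rewrite (le_trans (ler_norm C))// lerDl.
have C1 : 0 < `|C| + 1 by rewrite ltr_wpDl.
move: {lip} (`|C| + 1) C1 lip' => K K0 lip.
have e1 : 0 < e / (K * n.+1%:R) by rewrite divr_gt0// mulr_gt0.
near=> y; apply: le_trans (lip x y) _.
have ld : l1dist y x <= n%:R * (e / (K * n.+1%:R)).
  rewrite /l1dist (le_trans (ler_sum _ (_ : forall i, true -> _ <= e / (K * n.+1%:R))))//.
    move=> i _; have : ball x (e / (K * n.+1%:R)) y by near: y; exact: nbhsx_ballx.
    by move/(rV_ballE _ _ e1) => /(_ i); rewrite distrC => /ltW; rewrite distrC.
  by rewrite sumr_const card_ord mulr_natl.
apply: (@le_trans _ _ (K * (n%:R * (e / (K * n.+1%:R))))); first by rewrite ler_pM2l.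
set m := n.+1%:R; have m0 : 0 < m by rewrite ltr0n.
rewrite (_ : K * _ = e * (n%:R / m)); last by field; rewrite !gt_eqF.
rewrite ler_piMr ?(ltW e0)// ler_pdivrMr// mul1r ler_nat; exact: leqnSn.
Unshelve. all: by end_near.
Qed.

Lemma measurable_smooth_prod (h : 'I_n -> nat -> R -> R) m : smooth_family h ->
  measurable_fun setT (prod_coord h m : 'rV[R]_n -> measurableTypeR R).
Proof.
move=> sh; apply: continuous_rV_measurable => x.
by apply: differentiable_continuous; exact: differentiable_prod_coord.
Qed.

Lemma sqint_integrable L u : L2 u -> (forall x, ~ rV_box L x -> u x = 0) ->
  leb.-integrable setT (EFin \o u).
Proof.
move=> su uL.
have s1 : L2 (\1_(rV_box L) : 'rV[R]_n -> R).
  have [] := @translation_cont_indic R n L (rV_box L) (measurable_rV_cube L) _ => //.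
have := sqint_mul measurableT su s1; congr integrable.
apply/funext => x /=; congr EFin; rewrite indicE; have [_|] := boolP (x \in _); first by rewrite mulr1.
by rewrite notin_setE => /uL ->; rewrite mul0r.
Qed.

Section bounded_kernel.
Variables (u : 'rV[R]_n -> R).
Hypothesis iu : leb.-integrable setT (EFin \o u).

Lemma integrable_mul_bounded (k : 'rV[R]_n -> R) B : measurable_fun setT (k : 'rV[R]_n -> measurableTypeR R) ->
  (forall y, `|k y| <= B) -> leb.-integrable setT (EFin \o (fun y => u y * k y)).
Proof.
move=> mk kB; have mu' := measurable_int _ iu; move/measurable_EFinP : mu' => mu'.
apply: (integrable_le_fun measurableT (v := fun y => B * `|u y|)).
- exact: measurable_funM.
- by move=> y _; rewrite normrM mulrC ler_wpM2r.
- apply: integrable_scale => //; exact: (integrable_abse iu).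
Qed.

Lemma Rintegral_mul_bounded (k : 'rV[R]_n -> R) B : measurable_fun setT (k : 'rV[R]_n -> measurableTypeR R) ->
  (forall y, `|k y| <= B) -> `|\int[leb]_y (u y * k y)| <= B * \int[leb]_y `|u y|.
Proof.
move=> mk kB; have i1 := integrable_mul_bounded mk kB.
apply: (le_trans (le_normr_Rintegral measurableT i1)).
have ia : leb.-integrable setT (EFin \o (fun y => `|u y|)) by exact: (integrable_abse iu).
rewrite -RintegralZl//; apply: le_Rintegral => //.
- exact: (integrable_abse i1).
- exact: integrable_scale.
- by move=> y _; rewrite normrM mulrC ler_wpM2r.
Qed.

End bounded_kernel.

Variables (d : R) (d0 : 0 < d).

(** Left unnormalised, with support in the cube of half-side [d]; [moll] divides by the total
    mass. *)
Definition kern : 'rV[R]_n -> R := bump_rV d^-1 (fun=> 0).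

Lemma kern_ge0 z : 0 <= kern z.
Proof. by rewrite /kern bump_rVE; apply: prodr_ge0 => i _; exact: bump0_ge0. Qed.

Lemma measurable_kern : measurable_fun setT (kern : 'rV[R]_n -> measurableTypeR R).
Proof. by apply: measurable_smooth_prod; exact: smooth_bump_family. Qed.

Lemma measurable_kern_partial i : measurable_fun setT (partial i kern : 'rV[R]_n -> measurableTypeR R).
Proof.
rewrite /kern /bump_rV partial_prod_coord; last exact: smooth_bump_family.
by apply: measurable_smooth_prod; exact: smooth_bump_family.
Qed.

Lemma kern_eq0 z : ~ rV_box d z -> kern z = 0.
Proof.
move=> /existsNP[i /negP]; rewrite -ltNge => h.
apply: (@prod_bump_eq0 _ _ _ _ _ _ i).
by rewrite addr0 normrM gtr0_norm ?invr_gt0// mulrC ler_pdivlMr// mul1r ltW.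
Qed.

Lemma integrable_kern : leb.-integrable setT (EFin \o kern).
Proof.
have [M [hM _ _]] := taylor_bound_bump d^-1 (fun _ : 'I_n => 0).
exact: (integrable_box_supported measurable_kern hM kern_eq0).
Qed.

Definition kern_mass := \int[leb]_z kern z.

Lemma kern_mass_gt0 : 0 < kern_mass.
Proof.
pose q : R := \prod_(i < n) expR (-4).
have q0 : 0 < q by apply: prodr_gt0 => i _; exact: expR_gt0.
have mB := @measurable_rV_cube R n (d / 2).
have vB : leb (rV_box (d / 2)) = (\prod_(i < n) d)%:E.
  rewrite (_ : rV_box _ = [set x : 'rV[R]_n | forall i : 'I_n, `[- (d / 2), d / 2]%classic (x 0 i)]).
    rewrite (lebesgue_rV_prod (A := fun=> `[- (d / 2), d / 2]%classic)); last by move=> i; exact: measurable_itv.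
    rewrite -[RHS]prodEFin; apply: eq_bigr => i _.
    suff h : @lebesgue_measure R `[- (d / 2), d / 2]%classic = d%:E by exact: h.
    rewrite lebesgue_measure_itv/= lte_fin ifT; first by rewrite -EFinB; congr EFin; field.
    by rewrite -subr_gt0 opprK -splitr.
  by apply/seteqP; split => x /= h i; have := h i; rewrite in_itv/= ler_norml.
apply: (@lt_le_trans _ _ (q * \prod_(i < n) d)).
  by rewrite mulr_gt0//; apply: prodr_gt0.
rewrite -lee_fin /kern_mass /Rintegral fineK; last by apply: integrable_fin_num => //; exact: integrable_kern.
rewrite EFinM -vB -[X in (_ * leb X)%E]setIT -integral_indic// -ge0_integralZl//; last 2 first.
- by apply/measurable_EFinP; exact: measurable_indic.
- by rewrite lee_fin ltW.
apply: ge0_le_integral => //.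
- by move=> x _; rewrite -EFinM lee_fin mulr_ge0// ltW.
- apply/measurable_EFinP; apply: measurable_funM; first exact: measurable_cst.
  exact: measurable_indic.
- by apply/measurable_EFinP; exact: measurable_kern.
move=> x _; rewrite lee_fin indicE; have [/set_mem xB|_] := boolP (x \in _); last by rewrite mulr0 kern_ge0.
rewrite mulr1 /q /kern bump_rVE; apply: ler_prod => i _; rewrite expR_ge0/= bump0_lower_bound//.
rewrite addr0 normrM gtr0_norm ?invr_gt0// mulrC ler_pdivrMr// mulrC.
exact: xB.
Qed.

Definition moll u x := kern_mass^-1 * \int[leb]_y (u y * kern (x - y)).

Definition moll_partial i u x := kern_mass^-1 * \int[leb]_y (u y * partial i kern (x - y)).

Lemma measurable_reflect x (k : 'rV[R]_n -> R) : measurable_fun setT (k : 'rV[R]_n -> measurableTypeR R) ->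
  measurable_fun setT (fun y => k (x - y) : measurableTypeR R).
Proof.
move=> mk; apply: measurableT_comp => //.
have := measurable_rV_affine (-1) x; congr measurable_fun.
by apply/funext => y; rewrite scaleN1r addrC.
Qed.

Section regularity.
Variable u : 'rV[R]_n -> R.
Hypothesis iu : leb.-integrable setT (EFin \o u).

Let c := kern_mass.
Let c0 : 0 < c := kern_mass_gt0.

(** The Taylor bound of the kernel is integrated against [u], so mere integrability of [u] yields
    the second-order estimate that [poincare_C11] asks for. *)
Lemma moll_taylor : exists2 M, 0 < M & forall x y,
  `|moll u y - moll u x - \sum_i moll_partial i u x * (y 0 i - x 0 i)| <= M * sqdist x y.
Proof.
have [M hM] := taylor_bound_bump d^-1 (fun _ : 'I_n => 0).
have M0 := taylor_bound_ge0 hM; have [h1 h2 h3] := hM.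
pose I := \int[leb]_y `|u y|; have I0 : 0 <= I by apply: Rintegral_ge0.
exists (c^-1 * (M * n%:R * I) + 1).
  by rewrite ltr_wpDl// !mulr_ge0 ?invr_ge0 ?(ltW c0).
move=> x y.
have i1 w : leb.-integrable setT (EFin \o (fun z => u z * kern (w - z))).
  by apply: (integrable_mul_bounded iu (B := M)) => //; apply: measurable_reflect; exact: measurable_kern.
have i2 i w : leb.-integrable setT (EFin \o (fun z => u z * partial i kern (w - z))).
  by apply: (integrable_mul_bounded iu (B := M)) => //; apply: measurable_reflect; exact: measurable_kern_partial.
pose k z := kern (y - z) - kern (x - z) - \sum_i partial i kern (x - z) * (y 0 i - x 0 i).
have mk : measurable_fun setT (k : 'rV[R]_n -> measurableTypeR R).
  apply: measurable_funB; first by apply: measurable_funB; apply: measurable_reflect; exact: measurable_kern.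
  apply: measurable_sum => i; apply: measurable_funM; last exact: measurable_cst.
  by apply: measurable_reflect; exact: measurable_kern_partial.
have kB z : `|k z| <= M * l1dist x y ^+ 2.
  have := h3 (x - z) (y - z).
  rewrite (_ : l1dist _ _ = l1dist x y); last first.
    by apply: eq_bigr => i _; rewrite !mxE opprB addrA subrK.
  congr (`| _ - _ | <= _); apply: eq_bigr => i _; rewrite !mxE; ring.
have sumI (r : seq 'I_n) : leb.-integrable setT
    (EFin \o (fun z => \sum_(i <- r) (y 0 i - x 0 i) * (u z * partial i kern (x - z)))) /\
  \int[leb]_z (\sum_(i <- r) (y 0 i - x 0 i) * (u z * partial i kern (x - z))) =
  \sum_(i <- r) (y 0 i - x 0 i) * \int[leb]_z (u z * partial i kern (x - z)).
  elim: r => [|i r [IH1 IH2]].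
    rewrite (_ : (fun z => _) = fun=> 0); last by apply/funext => z; rewrite big_nil.
    by split; [exact: integrable0|rewrite /Rintegral integral0 big_nil].
  have iZ : leb.-integrable setT (EFin \o (fun z => (y 0 i - x 0 i) * (u z * partial i kern (x - z)))).
    exact: integrable_scale.
  rewrite (_ : (fun z => _) = (fun z => (y 0 i - x 0 i) * (u z * partial i kern (x - z))) \+
      (fun z => \sum_(j <- r) (y 0 j - x 0 j) * (u z * partial j kern (x - z)))); last first.
    by apply/funext => z; rewrite big_cons.
  by split; [apply: eq_integrable (integrableD measurableT iZ IH1)|rewrite RintegralD// RintegralZl// IH2 big_cons].
have e : moll u y - moll u x - \sum_i moll_partial i u x * (y 0 i - x 0 i) =
    c^-1 * \int[leb]_z (u z * k z).
  have [s1 s2] := sumI (index_enum _).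
  rewrite (_ : \int[leb]_z (u z * k z) = \int[leb]_z ((u z * kern (y - z) - u z * kern (x - z)) -
      \sum_i (y 0 i - x 0 i) * (u z * partial i kern (x - z)))); last first.
    apply: eq_Rintegral => z _; rewrite /k 2!mulrBr; congr (_ - _).
    by rewrite mulr_sumr; apply: eq_bigr => i _; ring.
  rewrite RintegralB//; last by apply: eq_integrable (integrableB measurableT (i1 y) (i1 x)).
  rewrite RintegralB// s2 /moll -/c 2!mulrBr; congr (_ - _).
  by rewrite mulr_sumr; apply: eq_bigr => i _; rewrite /moll_partial -/c; ring.
rewrite e normrM gtr0_norm ?invr_gt0//.
apply: (@le_trans _ _ (c^-1 * (M * l1dist x y ^+ 2 * I))).
  by rewrite ler_pM2l ?invr_gt0//; exact: Rintegral_mul_bounded.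
rewrite mulrDl mul1r; apply: ler_wpDr; first exact: sqdist_ge0.
rewrite -[leRHS]mulrA ler_pM2l ?invr_gt0// mulrAC -[leRHS]mulrA.
have h : M * I * l1dist x y ^+ 2 <= M * I * (n%:R * sqdist x y).
  by apply: ler_wpM2l; [exact: mulr_ge0|exact: l1dist_sqr].
by rewrite (le_trans h)// le_eqVlt; apply/orP; left; apply/eqP; ring.
Qed.

Lemma moll_bounded : exists2 B, 0 < B & forall x, `|moll u x| <= B.
Proof.
have [M [h1 _ _]] := taylor_bound_bump d^-1 (fun _ : 'I_n => 0).
have M0 : 0 <= M := le_trans (normr_ge0 _) (h1 0).
exists (c^-1 * (M * \int[leb]_y `|u y|) + 1).
  by rewrite ltr_wpDl// !mulr_ge0 ?invr_ge0 ?(ltW c0)//; apply: Rintegral_ge0.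
move=> x; rewrite normrM gtr0_norm ?invr_gt0// (@le_trans _ _ (c^-1 * (M * \int[leb]_y `|u y|)))// ?lerDl//.
rewrite ler_pM2l ?invr_gt0//; apply: Rintegral_mul_bounded => //.
by apply: measurable_reflect; exact: measurable_kern.
Qed.

Lemma measurable_moll : measurable_fun setT (moll u : 'rV[R]_n -> measurableTypeR R).
Proof.
have [M hM] := taylor_bound_bump d^-1 (fun _ : 'I_n => 0).
have M0 := taylor_bound_ge0 hM.
pose I := \int[leb]_y `|u y|; have I0 : 0 <= I by apply: Rintegral_ge0.
apply: continuous_rV_measurable; apply: (@lipschitz_continuous _ (c^-1 * (3 * M * I))) => x y.
  have i1 w : leb.-integrable setT (EFin \o (fun z => u z * kern (w - z))).
    by apply: (integrable_mul_bounded iu (B := M)) => //; [apply: measurable_reflect; exact: measurable_kern|case: hM].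
  rewrite /moll -mulrBr -RintegralB// normrM gtr0_norm ?invr_gt0// -[leRHS]mulrA ler_pM2l ?invr_gt0//.
  rewrite [X in `|X|](_ : _ = \int[leb]_z (u z * (kern (x - z) - kern (y - z)))); last first.
    by apply: eq_Rintegral => z _; rewrite mulrBr.
  apply: (@le_trans _ _ (3 * M * l1dist y x * I)); last by rewrite mulrAC.
  apply: Rintegral_mul_bounded => //.
    by apply: measurable_funB; apply: measurable_reflect; exact: measurable_kern.
  move=> z; have := taylor_bound_lip (y - z) (x - z) hM.
  rewrite (_ : l1dist _ _ = l1dist y x)//.
  by apply: eq_bigr => i _; rewrite !mxE opprB addrA subrK.
Qed.

End regularity.

Lemma sqint_reflect x u : L2 u -> L2 (fun z => u (x - z)).
Proof.
move=> su; have [mu' _] := su; apply: sqint_ltyP; first exact: measurable_reflect.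
rewrite (integral_rV_reflect x (f := fun z => (u z ^+ 2)%:E)).
  by rewrite (ip_EFin measurableT su) ltry.
by apply/measurable_EFinP; exact: measurable_funX.
Qed.

(** [moll u x - u x] is the average of [u (x - z) - u x] with weight [kern z], and the square of an
    average is at most the average of the squares. *)
Lemma moll_sub_sqr L u x : L2 u -> (forall y, ~ rV_box L y -> u y = 0) ->
  (((moll u x - u x) ^+ 2)%:E <=
   (kern_mass^-1)%:E * \int[leb]_z (kern z * (u (x - z) - u x) ^+ 2)%:E)%E.
Proof.
move=> su uL; have iu := sqint_integrable su uL; have c0 := kern_mass_gt0.
have [M [h1 _ _]] := taylor_bound_bump d^-1 (fun _ : 'I_n => 0).
have M0 : 0 <= M := le_trans (normr_ge0 _) (h1 0).
have mk := measurable_kern; have ik := integrable_kern.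
pose w z := u (x - z) - u x.
have mu' : measurable_fun setT (fun z => u (x - z) : measurableTypeR R).
  by apply: measurable_reflect; have [] := su.
have mw : measurable_fun setT (w : 'rV[R]_n -> measurableTypeR R).
  by apply: measurable_funB => //; exact: measurable_cst.
have iur : leb.-integrable setT (EFin \o (fun z => u (x - z))).
  apply/integrableP; split; first by apply/measurable_EFinP.
  have := integral_rV_reflect x (f := fun z => `|(u z)%:E|%E) => /= ->; last first.
    by apply/measurable_EFinP; apply: measurableT_comp => //; have [] := su.
  by have /integrableP[] := iu.
have iuk : leb.-integrable setT (EFin \o (fun z => u (x - z) * kern z)).
  exact: (integrable_mul_bounded iur mk h1).
have iukk : leb.-integrable setT (EFin \o (fun z => u x * kern z)) by exact: integrable_scale.
have ikw : leb.-integrable setT (EFin \o (fun z => kern z * w z)).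
  by apply: eq_integrable (integrableB measurableT iuk iukk) => // z _ /=; congr EFin; rewrite /w; ring.
have ikw2 : leb.-integrable setT (EFin \o (fun z => kern z * w z ^+ 2)).
  have i2 : leb.-integrable setT (EFin \o (fun z => u (x - z) ^+ 2)).
    by have [] := sqint_reflect x su.
  apply: (integrable_le_fun measurableT (v := fun z => 2 * M * u (x - z) ^+ 2 + 2 * u x ^+ 2 * kern z)).
  - by apply: measurable_funM => //; exact: measurable_funX.
  - move=> z _; rewrite ger0_norm /w; last by apply: mulr_ge0; [exact: kern_ge0|exact: sqr_ge0].
    have k0 := kern_ge0 z; have k1 : kern z <= M := le_trans (ler_norm _) (h1 z).
    have : kern z * (2 * u (x - z) ^+ 2) <= M * (2 * u (x - z) ^+ 2).
      by rewrite ler_wpM2r// mulr_ge0// sqr_ge0.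
    have : 0 <= kern z * (u (x - z) + u x) ^+ 2 by rewrite mulr_ge0 ?sqr_ge0.
    set a := u (x - z); set b := u x; set k := kern z; lra.
  - apply: eq_integrable (integrableD measurableT (integrable_scale (2 * M) measurableT i2)
      (integrable_scale (2 * u x ^+ 2) measurableT ik)) => //.
pose B := \int[leb]_z (kern z * w z); pose C := \int[leb]_z (kern z * w z ^+ 2).
have e1 : moll u x - u x = kern_mass^-1 * B.
  rewrite /moll -[X in _ - X](mulKf (lt0r_neq0 c0)) -mulrBr; congr (_ * _).
  rewrite (_ : \int[leb]_y (u y * kern (x - y)) = \int[leb]_z (u (x - z) * kern z)); last first.
    rewrite /Rintegral -(integral_rV_reflect x (f := fun y => (u y * kern (x - y))%:E)).
      by apply: (congr1 fine); apply: eq_integral => z _; rewrite subKr.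
    apply/measurable_EFinP; apply: measurable_funM; first by have [] := su.
    exact: measurable_reflect.
  rewrite /kern_mass mulrC -RintegralZl// -RintegralB//; apply: eq_Rintegral => z _.
  by rewrite /w; ring.
(* Cauchy-Schwarz for the weight [kern], through the discriminant of the integral of
   [kern z * (1 + t * w z) ^+ 2]. *)
have CS : B ^+ 2 <= kern_mass * C.
  apply: quadratic_ge0_discr => t.
  have -> : kern_mass + 2 * t * B + t ^+ 2 * C = \int[leb]_z (kern z * (1 + t * w z) ^+ 2).
    rewrite /kern_mass /B /C -RintegralZl// -RintegralZl// -RintegralD//; last exact: integrable_scale.
    rewrite -RintegralD//; last 2 first.
    - by apply: eq_integrable (integrableD measurableT ik (integrable_scale (2 * t) measurableT ikw)).
    - exact: integrable_scale.
    by apply: eq_Rintegral => z _; ring.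
  by apply: Rintegral_ge0 => z _; rewrite mulr_ge0 ?kern_ge0 ?sqr_ge0.
rewrite e1 (_ : (\int[leb]_z _)%E = C%:E); last by rewrite /C /Rintegral fineK//; exact: integrable_fin_num.
rewrite -EFinM lee_fin exprMn -ler_pdivlMl ?exprn_gt0 ?invr_gt0//.
rewrite (_ : _ * (_ * C) = kern_mass * C)//; first by field; rewrite gt_eqF.
Qed.

(** After Tonelli the inner integral is the L2 distance between [u] and its translate by [- z]; only
    [z] in the support of the kernel contribute. *)
Lemma moll_dist L u e : L2 u -> (forall y, ~ rV_box L y -> u y = 0) ->
  (forall z, (forall i, `|z 0 i| <= d) -> ip2 (translate z u \- u) (translate z u \- u) <= e) ->
  (\int[leb]_x ((moll u x - u x) ^+ 2)%:E <= e%:E)%E.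
Proof.
move=> su uL ue; have c0 := kern_mass_gt0; have iu := sqint_integrable su uL.
have mu' : measurable_fun setT (u : 'rV[R]_n -> measurableTypeR R) by have [] := su.
have mk := measurable_kern.
pose F (p : 'rV[R]_n * 'rV[R]_n) := (kern p.2 * (u (p.1 - p.2) - u p.1) ^+ 2)%:E.
have mF : measurable_fun setT F.
  apply/measurable_EFinP; apply: measurable_funM.
    by apply: measurableT_comp => //; exact: measurable_snd.
  apply: measurable_funX; apply: measurable_funB; last first.
    by apply: measurableT_comp => //; exact: measurable_fst.
  apply: measurableT_comp => //; apply: measurable_fun_rVP => i.
  rewrite (_ : (fun p => _) = fun p : 'rV[R]_n * 'rV[R]_n => p.1 0 i - p.2 0 i); last first.
    by apply/funext => p; rewrite !mxE.
  by apply: measurable_funB; apply: (measurableT_comp (measurable_rV_coord i));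
    [exact: measurable_fst|exact: measurable_snd].
have F0 p : (0 <= F p)%E by rewrite lee_fin mulr_ge0 ?kern_ge0 ?sqr_ge0.
apply: (@le_trans _ _ (\int[leb]_x ((kern_mass^-1)%:E * \int[leb]_z F (x, z)))%E).
  apply: ge0_le_integral => //.
  - by move=> x _; rewrite lee_fin sqr_ge0.
  - by apply/measurable_EFinP; apply: measurable_funX; apply: measurable_funB => //; exact: measurable_moll.
  - apply: emeasurable_funM; first exact: measurable_cst.
    exact: (measurable_fun_fubini_tonelli_F (m2 := leb) F mF F0).
  - by move=> x _; exact: (moll_sub_sqr x su uL).
rewrite ge0_integralZl//; last 3 first.
- exact: (measurable_fun_fubini_tonelli_F (m2 := leb) F mF F0).
- by move=> x _; exact: integral_ge0.
- by rewrite lee_fin invr_ge0 ltW.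
rewrite fubini_tonelli//.
apply: (@le_trans _ _ ((kern_mass^-1)%:E * \int[leb]_z (e%:E * (kern z)%:E))%E).
  rewrite lee_pmul2l ?lte_fin ?invr_gt0//.
  apply: ge0_le_integral => //.
  - by move=> z _; exact: integral_ge0.
  - exact: (measurable_fun_fubini_tonelli_G (m1 := leb) F mF F0).
  - by apply: emeasurable_funM; [exact: measurable_cst|apply/measurable_EFinP].
  move=> z _; have [zd|zd] := pselect (rV_box d z); last first.
    rewrite (kern_eq0 zd) mule0 (eq_integral (fun=> 0%E)) ?integral0// => x _.
    by rewrite /F /= (kern_eq0 zd) mul0r.
  have s1 : L2 (translate (- z) u \- u) by apply: sqintB => //; exact: sqint_shift.
  rewrite (eq_integral (fun x => (kern z)%:E * ((translate (- z) u \- u) x ^+ 2)%:E)%E); last by [].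
  rewrite ge0_integralZl//; last 3 first.
  - apply/measurable_EFinP; apply: measurable_funX; by have [] := s1.
  - by move=> x _; rewrite lee_fin sqr_ge0.
  - by rewrite lee_fin kern_ge0.
  rewrite (ip_EFin measurableT s1) muleC -!EFinM lee_fin ler_wpM2r ?kern_ge0// ue// => i.
  by rewrite mxE normrN; exact: zd.
have e0 : 0 <= e by apply: le_trans (ue 0 _); [exact: ip_ge0|move=> i; rewrite mxE normr0 ltW].
rewrite ge0_integralZl//; last 2 first.
- by apply/measurable_EFinP.
- by move=> z _; rewrite lee_fin kern_ge0.
rewrite (_ : (\int[leb]_z (kern z)%:E)%E = kern_mass%:E); last first.
  by rewrite /kern_mass /Rintegral fineK//; apply: integrable_fin_num => //; exact: integrable_kern.
by rewrite -!EFinM lee_fin mulrCA mulVf ?mulr1// gt_eqF.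
Qed.

(** The reflected kernel [kern (x - y)] is a test function in [y] once the box of half-side [d]
    around [x] lies in [A]. The sign produced by the reflection cancels the one in the definition of
    the weak gradient. *)
Lemma moll_weak_gradient A u (g : 'I_n -> 'rV[R]_n -> R) x i : measurable A -> sobolev_H1 A u g ->
  leb.-integrable setT (EFin \o (u \_ A)) ->
  (forall y, (forall i, `|y 0 i - x 0 i| <= d) -> A y) ->
  moll_partial i (u \_ A) x = moll (g i \_ A) x.
Proof.
move=> mA [_ /(_ i)[_ hg]] iu xA; rewrite /moll_partial /moll; congr (_ * _).
have [f [fE dfE tf]] : exists f, [/\ forall y, f y = kern (x - y),
    forall y, partial i f y = - partial i kern (x - y) & test_function A f].
  exists (bump_rV (- d^-1) (fun i => d^-1 * x 0 i)); split.
  - by move=> y; rewrite /kern !bump_rVE; apply: eq_bigr => j _; congr bump; rewrite !mxE; ring.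
  - move=> y; rewrite /kern !partial_bump_rV !mulNr; congr (- (_ * bump _ _ * _)).
      by rewrite !mxE; ring.
    by apply: eq_bigr => j _; congr bump; rewrite !mxE; ring.
  - apply: test_function_bump; first by rewrite oppr_eq0 invr_eq0 gt_eqF.
    move=> y /= hy; apply: xA => j; have := hy j.
    rewrite (_ : _ + _ = - (d^-1 * (y 0 j - x 0 j))); last by ring.
    by rewrite normrN normrM gtr0_norm ?invr_gt0// mulrC ler_pdivrMr// mul1r.
have := hg f tf.
have -> : \int[leb]_(y in A) (u y * partial i f y) =
    \int[leb]_y (-1 * ((u \_ A) y * partial i kern (x - y))).
  rewrite [LHS]Rintegral_mkcond; apply: eq_Rintegral => y _.
  by rewrite !patchE; case: ifP => _; rewrite ?dfE; [ring|rewrite mul0r mulr0].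
have -> : \int[leb]_(y in A) (g i y * f y) = \int[leb]_y ((g i \_ A) y * kern (x - y)).
  rewrite [LHS]Rintegral_mkcond; apply: eq_Rintegral => y _.
  by rewrite !patchE; case: ifP => _; rewrite ?fE// mul0r.
rewrite RintegralZl//; last first.
  have [M [_ h2 _]] := taylor_bound_bump d^-1 (fun _ : 'I_n => 0).
  apply: (integrable_mul_bounded iu (B := M)) => //.
  by apply: measurable_reflect; exact: measurable_kern_partial.
by rewrite mulN1r => /oppr_inj.
Qed.

End mollifier.

(** * The weak Poincare inequality *)

Section ip_restrict.
Context d (T : measurableType d) (R : realType) (mu : {measure set T -> \bar R}).
Implicit Types (D K A : set T) (u v : T -> R).

Lemma sqint_subset D K u : measurable D -> measurable K -> K `<=` D -> sqint mu D u -> sqint mu K u.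
Proof.
move=> mD mK KD [mu' iu]; split; first exact: measurable_funS mu'.
exact: integrableS iu.
Qed.

Lemma sqint_restrict D u : measurable D -> sqint mu D u <-> sqint mu setT (u \_ D).
Proof.
move=> mD; rewrite /sqint.
have e : (fun x => ((u \_ D) x ^+ 2)%:E) = (fun x => (u x ^+ 2)%:E) \_ D.
  by apply/funext => x; rewrite !patchE; case: ifP => // _; rewrite expr0n.
rewrite e; split=> -[h1 h2]; split.
- by apply/(measurable_restrictT _ _).1.
- exact/(integrable_mkcond _ mD).
- by apply/(measurable_restrictT _ _).2.
- exact/(integrable_mkcond _ mD).
Qed.

Lemma ip_restrict K A u v : K `<=` A -> ip mu K (u \_ A) (v \_ A) = ip mu K u v.
Proof.
by move=> KA; apply: eq_Rintegral => x /set_mem Kx; rewrite !patchE mem_set//; exact: KA.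
Qed.

Lemma ip_le_subset K D u : measurable K -> measurable D -> K `<=` D -> sqint mu D u ->
  ip mu K u u <= ip mu D u u.
Proof.
move=> mK mD KD su; rewrite -lee_fin -!ip_EFin//; last exact: sqint_subset su.
apply: ge0_subset_integral => //; last by move=> x _; rewrite lee_fin sqr_ge0.
by have [_ /integrableP[]] := su.
Qed.

Lemma cvg_Rintegral_bigcup (K_ : nat -> set T) (f : T -> R) :
  (forall k, measurable (K_ k)) -> nondecreasing_seq K_ ->
  mu.-integrable (\bigcup_k K_ k) (EFin \o f) ->
  \int[mu]_(x in K_ k) f x @[k --> \oo] --> \int[mu]_(x in \bigcup_k K_ k) f x.
Proof.
move=> mK nd iF; set K := \bigcup_k K_ k in iF *.
have mKU : measurable K by exact: bigcup_measurable.
have KS k : K_ k `<=` K by move=> x Kx; exists k.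
have [] := @dominated_convergence _ _ _ mu setT measurableT
  (fun k => (EFin \o f) \_ (K_ k)) ((EFin \o f) \_ K) (abse \o (EFin \o f) \_ K).
- move=> k; apply/(measurable_restrictT _ _).1 => //.
  by apply: measurable_funS (measurable_int _ iF).
- by apply/(measurable_restrictT _ _).1 => //; exact: measurable_int iF.
- apply: aeW => x _; have [[j _ Kj]|nK] := pselect (K x).
    apply: cvg_near_cst; near=> k; rewrite !patchE !mem_set//; first by exists j.
    have /subsetPset : (K_ j <= K_ k)%O by apply: nd; near: k; exact: nbhs_infty_ge.
    exact.
  apply: cvg_near_cst; near=> k; rewrite !patchE !memNset//.
  by move=> /KS.
- by apply: integrable_abse; apply/(integrable_mkcond _ mKU).
- apply: aeW => x k _ /=; rewrite !patchE; case: ifPn => [/set_mem h|_]; last by rewrite abse0 abse_ge0.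
  by rewrite mem_set//; exact: KS h.
move=> _ _ h.
suff h' : (\int[mu]_(x in K_ k) (f x)%:E)%E @[k --> \oo] --> (fine (\int[mu]_(x in K) (f x)%:E))%:E.
  by have /fine_cvgP[_] := h'.
rewrite fineK; last exact: integrable_fin_num.
rewrite (_ : (fun k => _) = (fun k => \int[mu]_x ((EFin \o f) \_ (K_ k)) x)%E); last first.
  by apply/funext => k; rewrite [LHS]integral_mkcond.
by rewrite [X in _ --> X]integral_mkcond.
Unshelve. all: by end_near.
Qed.

Lemma Rintegral_sum_sqr K n (g : 'I_n -> T -> R) : measurable K -> (forall i, sqint mu K (g i)) ->
  \int[mu]_(x in K) \sum_i g i x ^+ 2 = \sum_i ip mu K (g i) (g i).
Proof.
move=> mK sg; elim: (index_enum _) => [|i r IH].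
  rewrite big_nil (_ : (fun x => _) = fun=> 0); first by rewrite /Rintegral integral0.
  by apply/funext => x; rewrite big_nil.
have ir : mu.-integrable K (EFin \o (fun x => \sum_(j <- r) g j x ^+ 2)).
  rewrite (_ : _ \o _ = (fun x => \sum_(j <- r) (g j x ^+ 2)%:E)%E).
    by apply: integrable_sum => // j _; have [] := sg j.
  by apply/funext => x /=; rewrite sumEFin.
rewrite big_cons -IH -RintegralD//; last first.
  by apply: eq_integrable (sg i).2.
by apply: eq_Rintegral => x _; rewrite big_cons.
Qed.

End ip_restrict.

Lemma cvg_sumr (R : realType) (I : Type) (r : seq I) (f : I -> nat -> R) (l : I -> R) :
  (forall i, f i k @[k --> \oo] --> l i) ->
  \sum_(i <- r) f i k @[k --> \oo] --> \sum_(i <- r) l i.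
Proof.
move=> h; elim: r => [|i r IH].
  rewrite big_nil (_ : (fun k => _) = fun=> 0); first exact: cvg_cst.
  by apply/funext => k; rewrite big_nil.
rewrite big_cons (_ : (fun k => _) = fun k => f i k + \sum_(j <- r) f j k); first exact: cvgD.
by apply/funext => k; rewrite big_cons.
Qed.

Section weak_poincare.
Variables (R : realType) (n : nat).
Local Notation leb := (lebesgue_rV R n).
Implicit Types (x y z : 'rV[R]_n) (A K Q : set 'rV[R]_n) (u : 'rV[R]_n -> R) (g : 'I_n -> 'rV[R]_n -> R).

(** The variance inequality multiplied by the volume [ip leb K 1 1]: it is meaningful for null [K],
    and every term passes to the limit separately. *)
Definition poincare_on K D u g :=
  ip leb K (fun=> 1) (fun=> 1) * ip leb K u u - ip leb K u (fun=> 1) ^+ 2 <=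
  ip leb K (fun=> 1) (fun=> 1) * (2 * expR 1 * D ^+ 2 * \sum_i ip leb K (g i) (g i)).

Lemma sqint_cst L K (c : R) : measurable K -> K `<=` rV_box L -> sqint leb K (fun=> c).
Proof.
move=> mK KL; apply/sqint_restrict => //; split.
  by apply/(measurable_restrictT _ _).1 => //; exact: measurable_cst.
apply: (integrable_box_supported (C := c ^+ 2) (L := L)).
- by apply: measurable_funX; apply/(measurable_restrictT _ _).1 => //; exact: measurable_cst.
- by move=> x; rewrite patchE; case: ifP => _; rewrite ?expr0n ?normr0 ?sqr_ge0// ger0_norm ?sqr_ge0.
- by move=> x nx; rewrite patchE memNset ?expr0n// => /KL.
Qed.

(** The mean is the best constant: the two sides differ by the square of
    [ip leb K u 1 - c * volume]. *)
Lemma ip_sqr_sub_cst L K u (c : R) : measurable K -> K `<=` rV_box L -> sqint leb K u ->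
  ip leb K (fun=> 1) (fun=> 1) * ip leb K u u - ip leb K u (fun=> 1) ^+ 2 <=
  ip leb K (fun=> 1) (fun=> 1) * \int[leb]_(x in K) (u x - c) ^+ 2.
Proof.
move=> mK KL su; have s1 := sqint_cst 1 mK KL.
have subK := subspace_sqint leb mK; have formK := psd_ip leb mK.
pose o : 'rV[R]_n -> R^o := fun=> 1.
have e : \int[leb]_(x in K) (u x - c) ^+ 2 =
    ip leb K u u + 2 * (- c * ip leb K u (fun=> 1)) + c ^+ 2 * ip leb K (fun=> 1) (fun=> 1).
  have := form_sqrD subK formK su (subspZ subK (- c) s1 : sqint leb K (- c *: o)).
  rewrite (formZr subK formK)// (form_sqrZ subK formK)// sqrrN => <-.
  by apply: eq_Rintegral => x _; rewrite expr2 /= /o; congr (_ * _); rewrite [RHS]/GRing.add/= [X in _ = _ + X]scale_mulr mulr1.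
rewrite e; set a := ip leb K u _; set b := ip leb K u _; set w := ip leb K _ _.
by rewrite -subr_ge0 (_ : _ - _ = (b - c * w) ^+ 2) ?sqr_ge0//; ring.
Qed.

(** On a set whose [e]-neighbourhood stays in [A], mollifying at scale at most [e] commutes with the
    weak gradient. The smooth inequality for the mollified functions then passes to the limit in
    L2. *)
Lemma poincare_inner A K L (D e : R) u g : measurable A -> A `<=` rV_box L -> sobolev_H1 A u g ->
  measurable K -> K `<=` A -> 0 < D -> 0 < e ->
  (forall x y, K x -> K y -> K (2^-1 *: (x + y))) ->
  (forall x y, K x -> K y -> sqdist x y <= D ^+ 2) ->
  (forall x y, K x -> (forall i, `|y 0 i - x 0 i| <= e) -> A y) ->
  poincare_on K D u g.
Proof.
move=> mA AL ug mK KA D0 e0 midK diamK inK.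
have KL : K `<=` rV_box L by move=> x /KA /AL.
have [su hg] := ug.
pose u0 := u \_ A; pose g0 i := g i \_ A.
have sq0 (v : 'rV[R]_n -> R) : sqint leb A v -> sqint leb setT (v \_ A) by move=> h; exact: (sqint_restrict leb v mA).1.
have su0 : sqint leb setT u0 by exact: sq0.
have sg0 i : sqint leb setT (g0 i) by apply: sq0; have [] := hg i.
have supp (v : 'rV[R]_n -> R) x : ~ rV_box L x -> (v \_ A) x = 0.
  by move=> nx; rewrite patchE memNset// => /AL.
have iu0 : leb.-integrable setT (EFin \o u0) := sqint_integrable su0 (supp u).
have ig0 i : leb.-integrable setT (EFin \o g0 i) := sqint_integrable (sg0 i) (supp (g i)).
suff : poincare_on K D u0 g0.
  rewrite /poincare_on !ip_restrict//.
  have -> : ip leb K u0 (fun=> 1) = ip leb K u (fun=> 1).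
    by apply: eq_Rintegral => x /set_mem Kx; rewrite /u0 patchE mem_set//; exact: KA.
  by under eq_bigr do rewrite ip_restrict//.
(* One mollification scale that works for [u] and for all components of its gradient at once. *)
have scale (eta : R) : 0 < eta -> exists d, [/\ 0 < d, d <= e &
    forall v, v = u0 \/ (exists i, v = g0 i) ->
    forall z, (forall i, `|z 0 i| <= d) -> ip leb setT (translate z v \- v) (translate z v \- v) <= eta].
  move=> eta0.
  have [_ /(_ eta eta0)[du du0 hdu]] := sqint_translation_cont su0 (supp u).
  have hgi i : exists d, 0 < d /\ forall z, (forall i, `|z 0 i| <= d) ->
      ip leb setT (translate z (g0 i) \- g0 i) (translate z (g0 i) \- g0 i) <= eta.
    by have [_ /(_ eta eta0)[d d0 hd]] := sqint_translation_cont (sg0 i) (supp (g i)); exists d.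
  have [f hf] := boolp.choice hgi.
  exists (Num.min (Num.min e du) (\big[Num.min/1]_i f i)); split.
  - rewrite !lt_min e0 du0/=; apply: (big_ind (fun t : R => 0 < t)) => //.
      by move=> a b a0 b0; rewrite lt_min a0.
    by move=> i _; have [] := hf i.
  - by rewrite !ge_min lexx.
  - move=> v [->|[i ->]] z hz.
      by apply: hdu => i; rewrite (le_trans (hz i))// !ge_min lexx orbT.
    apply: (hf i).2 => j; rewrite (le_trans (hz j))// ge_min; apply/orP; right.
    exact: (bigmin_le 1 i f).
have {scale}/boolp.choice[d hd] : forall k : nat, exists d, [/\ 0 < d, d <= e &
    forall v, v = u0 \/ (exists i, v = g0 i) ->
    forall z, (forall i, `|z 0 i| <= d) -> ip leb setT (translate z v \- v) (translate z v \- v) <= k.+1%:R^-1].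
  by move=> k; apply: scale; rewrite invr_gt0 ltr0n.
pose psi k := moll (d k) u0; pose G k i := moll (d k) (g0 i).
have mollK k v : sqint leb setT v -> (forall x, ~ rV_box L x -> v x = 0) ->
    sqint leb K (moll (d k) v).
  move=> sv vL; have [dk0 _ _] := hd k; have iv := sqint_integrable sv vL.
  have mv := measurable_moll dk0 iv; have [B B0 hB] := moll_bounded dk0 iv.
  have := sqint_cst B mK KL => -[_ iB]; split; first exact: measurable_funS mv.
  apply: (integrable_le_fun mK (v := fun=> B ^+ 2)) => //.
    by apply: measurable_funX; exact: measurable_funS mv.
  by move=> x _; rewrite ger0_norm ?sqr_ge0// -[leLHS]real_normK ?num_real// lerXn2r ?nnegrE ?(ltW B0).
have sKT v : sqint leb setT v -> sqint leb K v by move=> sv; exact: (sqint_subset measurableT mK).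
have cvgK v : sqint leb setT v -> (forall x, ~ rV_box L x -> v x = 0) -> v = u0 \/ (exists i, v = g0 i) ->
    ip leb K (moll (d k) v \- v) (moll (d k) v \- v) @[k --> \oo] --> (0 : R).
  move=> sv vL hv; have iv := sqint_integrable sv vL.
  have h k : 0 <= ip leb K (moll (d k) v \- v) (moll (d k) v \- v) <= k.+1%:R^-1.
    rewrite ip_ge0/=; have [dk0 _ hk] := hd k.
    have sk : sqint leb K (moll (d k) v \- v) by apply: sqintB => //; [exact: mollK|exact: sKT].
    rewrite -lee_fin -ip_EFin//; apply: le_trans (moll_dist dk0 sv vL (hk v hv)).
    apply: ge0_subset_integral => //; last by move=> x _; rewrite lee_fin sqr_ge0.
    apply/measurable_EFinP; apply: measurable_funX; apply: measurable_funB; first exact: measurable_moll.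
    by have [] := sv.
  apply: (@squeeze_cvgr _ _ _ _ (fun=> 0) (fun k => k.+1%:R^-1)).
  - by near=> k; exact: h.
  - exact: cvg_cst.
  - exact: cvg_harmonic.
have subK := subspace_sqint leb mK; have formK := psd_ip leb mK.
have s1 : sqint leb K (fun=> 1) := sqint_cst 1 mK KL.
have cu := cvgK u0 su0 (supp u) (or_introl erefl).
have cg i := cvgK (g0 i) (sg0 i) (supp (g i)) (or_intror (ex_intro _ i erefl)).
set o := ip leb K (fun=> 1) (fun=> 1).
have spsi k : sqint leb K (psi k) := mollK k u0 su0 (supp u).
have sG i k : sqint leb K (G k i) := mollK k (g0 i) (sg0 i) (supp (g i)).
apply: (@ler_cvg_to nat \oo _ R
  (fun k => o * ip leb K (psi k) (psi k) - ip leb K (psi k) (fun=> 1) * ip leb K (psi k) (fun=> 1))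
  (fun k => o * (2 * expR 1 * D ^+ 2 * \sum_i ip leb K (G k i) (G k i)))).
- rewrite expr2; apply: cvgB.
    apply: cvgM; first exact: cvg_cst.
    exact: (cvg_form_sqr subK formK spsi (sKT _ su0) cu).
  have := cvg_form subK formK spsi (sKT _ su0) cu s1 => h; exact: cvgM.
- apply: cvgM; first exact: cvg_cst.
  apply: cvgM; first exact: cvg_cst.
  apply: cvg_sumr => i.
  exact: (cvg_form_sqr subK formK (sG i) (sKT _ (sg0 i)) (cg i)).
- near=> k; rewrite -expr2; have [dk0 dke _] := hd k.
  have [M M0 hM] := moll_taylor dk0 iu0.
  have [B B0 hB] := moll_bounded dk0 iu0.
  have [|||c hc] := @poincare_C11 R n K L D M (psi k) (G k) mK KL D0 midK diamK _ _ M0.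
  - by split; [exact: measurable_moll|exists B => // x _; exact: hB].
  - move=> i; split; first exact: measurable_moll.
    by have [B' B'0 hB'] := moll_bounded dk0 (ig0 i); exists B' => // x _; exact: hB'.
  - move=> x y Kx Ky; have := hM x y; congr (`| _ - _ | <= _).
    apply: eq_bigr => i _; congr (_ * _); apply: moll_weak_gradient => // z hz.
    by apply: (inK x) => // j; rewrite (le_trans (hz j)).
  apply: le_trans (ip_sqr_sub_cst c mK KL (spsi k)) _.
  apply: ler_wpM2l; first exact: ip_ge0.
  by rewrite (le_trans hc)// Rintegral_sum_sqr.
Unshelve. all: by end_near.
Qed.

(** The piece is exhausted by its points having a ball of fixed radius inside [A]. Only the boundary
    of [A] is avoided: mollification may cross the boundary of [Q]. *)
Lemma poincare_convex_piece A Q L (D : R) u g : open A -> A `<=` rV_box L -> sobolev_H1 A u g ->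
  measurable Q -> 0 < D ->
  (forall x y, A x -> A y -> A (2^-1 *: (x + y))) ->
  (forall x y, Q x -> Q y -> Q (2^-1 *: (x + y))) ->
  (forall x y, (A `&` Q) x -> (A `&` Q) y -> sqdist x y <= D ^+ 2) ->
  poincare_on (A `&` Q) D u g.
Proof.
move=> oA AL ug mQ D0 midA midQ diam; have mA := open_rV_measurable oA.
have [su hg] := ug; set K := A `&` Q; have mK : measurable K by exact: measurableI.
have KA : K `<=` A by move=> x [].
pose K_ k := K `&` [set x | ball x k.+1%:R^-1 `<=` A].
have mK_ k : measurable (K_ k).
  apply: measurableI => //.
  rewrite (_ : [set x | _] = ~` \bigcup_(y in ~` A) ball y k.+1%:R^-1).
    apply: measurableC; apply: open_rV_measurable; apply: bigcup_open => y _.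
    by apply: ball_open; rewrite invr_gt0 ltr0n.
  apply/seteqP; split => x /=.
    by move=> h [y nAy yx]; apply: nAy; apply: h; exact: ball_sym.
  by move=> h y xy; apply: contrapT => nAy; apply: h; exists y => //; exact: ball_sym.
have ndK : nondecreasing_seq K_.
  move=> a b ab; apply/subsetPset => x [Kx hx]; split => //; apply: subset_trans hx.
  by apply: le_ball; rewrite lef_pV2 ?posrE ?ltr0n// ler_nat ltnS.
have UK : \bigcup_k K_ k = K.
  apply/seteqP; split => [x [k _ []]//|x Kx].
  have /nbhs_ballP[e /= e0 he] : nbhs x A by apply: open_nbhs_nbhs; split => //; exact: KA.
  have [k ke] : exists k : nat, k.+1%:R^-1 <= e.
    exists (Num.truncn e^-1); rewrite -[leRHS]invrK lef_pV2 ?posrE ?invr_gt0 ?ltr0n//.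
    by rewrite ltW// truncnS_gt.
  by exists k => //; split => //; apply: subset_trans he; exact: le_ball.
have step k : poincare_on (K_ k) D u g.
  have k0 : 0 < k.+1%:R^-1 :> R by rewrite invr_gt0 ltr0n.
  (* Half the radius, because a closed box has to fit into the open ball. *)
  apply: (@poincare_inner A (K_ k) L D (k.+1%:R^-1 / 2)) => //.
  - by move=> x [/KA].
  - move=> x y [[Ax Qx] bx] [[Ay Qy] by']; split; first by split; [exact: midA|exact: midQ].
    (* A point [w] near the midpoint [m] is the midpoint of [x] and [y] both shifted by [w - m], and
       the shifted points lie in [A]; so the inner set is again midpoint-convex. *)
    move=> w /(rV_ballE _ _ k0) hw; set m := 2^-1 *: (x + y) in hw.
    have -> : w = 2^-1 *: ((x + (w - m)) + (y + (w - m))).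
      by apply/rowP => i; rewrite /m !mxE; field.
    by apply: midA; [apply: bx|apply: by']; apply/(rV_ballE _ _ k0) => i; have := hw i;
      rewrite !mxE opprD addrA subrr add0r normrN distrC.
  - by move=> x y [Kx _] [Ky _]; exact: diam.
  - move=> x y [_ bx] hy; apply: bx; apply/(rV_ballE _ _ k0) => i.
    rewrite distrC; apply: (le_lt_trans (hy i)).
    by rewrite ltr_pdivrMr// ltr_pMr// ltr1n.
have KL : K `<=` rV_box L by move=> x /KA /AL.
have sK v : sqint leb A v -> sqint leb K v by move=> sv; exact: (sqint_subset mA mK).
have s1 : sqint leb K (fun=> 1) := sqint_cst 1 mK KL.
have cvgip v w : sqint leb K v -> sqint leb K w -> ip leb (K_ k) v w @[k --> \oo] --> ip leb K v w.
  move=> sv sw; rewrite -UK; apply: cvg_Rintegral_bigcup => //.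
  by rewrite UK; exact: sqint_mul.
apply: (@ler_cvg_to nat \oo _ R
  (fun k => ip leb (K_ k) (fun=> 1) (fun=> 1) * ip leb (K_ k) u u -
            ip leb (K_ k) u (fun=> 1) * ip leb (K_ k) u (fun=> 1))
  (fun k => ip leb (K_ k) (fun=> 1) (fun=> 1) * (2 * expR 1 * D ^+ 2 * \sum_i ip leb (K_ k) (g i) (g i)))).
- rewrite expr2; apply: cvgB; apply: cvgM; apply: cvgip => //; exact: sK.
- apply: cvgM; first exact: cvgip.
  apply: cvgM; first exact: cvg_cst.
  by apply: cvg_sumr => i; apply: cvgip; apply: sK; have [] := hg i.
- by near=> k; rewrite -expr2; exact: step.
Unshelve. all: by end_near.
Qed.

End weak_poincare.

(** * Dirichlet energy of bumps *)

Section divergence.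
Variables (R : realType) (n : nat).
Local Notation leb := (lebesgue_rV R n).
Implicit Types (x y z : 'rV[R]_n) (A : set 'rV[R]_n) (f F u : 'rV[R]_n -> R).

Lemma compact_rV_box L : compact (@rV_box R n L).
Proof.
rewrite (_ : rV_box L = [set x : 'rV[R]_n | forall i, `[- L, L]%classic (x 0 i)]).
  exact: rV_compact (fun i => @segment_compact _ _ _).
by apply/seteqP; split => x /= h i; have := h i; rewrite in_itv/= ler_norml.
Qed.

Lemma continuous_box_bounded L f : continuous f ->
  exists2 C, 0 < C & forall x, rV_box L x -> `|f x| <= C.
Proof.
move=> cf.
have /compact_bounded[M [_ hM]] : compact (f @` rV_box L).
  by apply: continuous_compact; [exact: continuous_subspaceT|exact: compact_rV_box].
exists (`|M| + 1); first by rewrite ltr_wpDl.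
move=> x xL; apply: (hM (`|M| + 1)); last by exists x.
by rewrite (le_lt_trans (ler_norm M))// ltrDl.
Qed.

Lemma is_derive_line F x i (t : R) : (forall x, differentiable F x) ->
  is_derive t 1 (fun t => F (t *: delta_mx 0 i + x)) (partial i F (t *: delta_mx 0 i + x)).
Proof.
move=> dF; apply: cvg_is_derive.
have /derivableP/is_derive_cvg := @diff_derivable _ _ _ _ _ (delta_mx 0 i : 'rV[R]_n) (dF (t *: delta_mx 0 i + x)).
apply: cvg_trans; apply: near_eq_cvg; apply: nearW => h.
by rewrite scalerDl addrA /GRing.scale/= mulr1.
Qed.

(** Difference quotients of [F] have integral 0 by translation invariance, and they converge to the
    partial derivative under a bounded, box-supported majorant. *)
Lemma Rintegral_partial_eq0 L F i : (forall x, differentiable F x) -> continuous (partial i F) ->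
  (forall x, ~ rV_box L x -> F x = 0) -> \int[leb]_x partial i F x = 0.
Proof.
move=> dF cF FL.
have cF0 : continuous F by move=> x; exact: differentiable_continuous.
have mF := continuous_rV_measurable cF0.
have [B B0 hB] := continuous_box_bounded L cF0.
have FB x : `|F x| <= B.
  by have [/hB//|/FL ->] := pselect (rV_box L x); rewrite normr0 ltW.
have iF := integrable_box_supported mF FB FL.
(* A step of length at most 1 from the box [L + 1] ends in the box [L + 2]; outside [L + 1] both
   values of [F] in the quotient vanish. *)
have [C C0 hC] := continuous_box_bounded (L + 2) cF.
have lip h x : `|h| <= 1 -> `|F (h *: delta_mx 0 i + x) - F x| <= C * `|h| * \1_(rV_box (L + 1)) x.
  move=> h1.
  have coord (t : R) j : `|t| <= 1 -> `|(t *: delta_mx 0 i + x : 'rV[R]_n) 0 j - x 0 j| <= 1.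
    move=> t1; rewrite !mxE addrK eqxx/=; case: eqP => _; rewrite ?mulr1// mulr0 normr0//.
  have [xL|xL] := pselect (rV_box (L + 1) x); last first.
    rewrite (FL x); last by move=> h'; apply: xL => j; rewrite (le_trans (h' j))// lerDl.
    rewrite (FL (h *: delta_mx 0 i + x)); first by rewrite subr0 normr0 mulr_ge0// mulr_ge0// ltW.
    apply: contra_not xL => h' j; have := coord h j h1.
    set y := (h *: delta_mx 0 i + x : 'rV[R]_n) in h' * => h2.
    have -> : x 0 j = y 0 j - (y 0 j - x 0 j) by rewrite subKr.
    by rewrite (le_trans (ler_normB _ _))// lerD// h'.
  rewrite indicE mem_set// mulr1.
  have [xi xih e] := mean_value 0 h (fun t => is_derive_line x i t dF).
  move: e; rewrite subr0 scale0r add0r => ->; rewrite normrM ler_wpM2r//.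
  apply: hC => j; have := coord xi j; rewrite subr0 subr0 in xih.
  move=> /(_ (le_trans xih h1)) h2.
  rewrite -[X in `|X|](subrK (x 0 j)) (le_trans (ler_normD _ _))//.
  rewrite (_ : L + 2 = 1 + (L + 1)); last by ring.
  by apply: lerD => //; exact: xL.
pose h_ (k : nat) : R := k.+1%:R^-1.
have h0 k : 0 < h_ k by rewrite invr_gt0 ltr0n.
have h1 k : `|h_ k| <= 1 by rewrite ger0_norm ?(ltW (h0 k))// /h_ invf_le1 ?ltr0n// ler1n.
pose D k x := (h_ k)^-1 * (F (h_ k *: delta_mx 0 i + x) - F x).
have mFs k : measurable_fun setT (fun x => F (h_ k *: delta_mx 0 i + x) : measurableTypeR R).
  have := measurable_fun_shift (h_ k *: delta_mx 0 i) mF; congr measurable_fun.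
  by apply/funext => x; rewrite /translate addrC.
have mD k : measurable_fun setT (D k : 'rV[R]_n -> measurableTypeR R).
  apply: measurable_funM; first exact: measurable_cst.
  exact: measurable_funB (mFs k) mF.
have DC k x : `|D k x| <= C * \1_(rV_box (L + 1)) x.
  rewrite normrM gtr0_norm ?invr_gt0// -(@ler_pM2l _ (h_ k))// mulVKf ?gt_eqF//.
  by apply: le_trans (lip _ _ (h1 k)) _; rewrite gtr0_norm// mulrCA mulrA.
have i1 : leb.-integrable setT (EFin \o (fun x => C * \1_(rV_box (L + 1)) x)).
  apply: integrable_scale => //; apply: (integrable_box_supported (C := 1) (L := L + 1)).
  - by apply: measurable_indic; exact: measurable_rV_cube.
  - by move=> x; rewrite indicE; case: (_ \in _); rewrite ?normr1 ?normr0.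
  - by move=> x nx; rewrite indicE memNset.
have [] := @dominated_convergence _ _ _ leb setT measurableT (fun k => EFin \o D k) (EFin \o partial i F)
  (EFin \o (fun x => C * \1_(rV_box (L + 1)) x)).
- by move=> k; apply/measurable_EFinP; exact: mD.
- by apply/measurable_EFinP; exact: continuous_rV_measurable.
- apply: aeW => x _; apply: cvg_EFin; first by near=> k.
  have /derivableP/is_derive_cvg h := @diff_derivable _ _ _ _ _ (delta_mx 0 i : 'rV[R]_n) (dF x).
  have hc : h_ k @[k --> \oo] --> (0 : R)^'.
    move=> P /= /nbhs_ballP[e /= e0 he].
    have := @cvg_harmonic R => /cvgrPdist_lt/(_ e e0)[N _ hN].
    exists N => // k Nk; apply: he; last by rewrite gt_eqF.
    by have := hN k Nk.
  exact: (cvg_comp _ _ hc h).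
- exact: i1.
- by apply: aeW => x k _; rewrite /= lee_fin; exact: DC.
move=> _ _ h.
have iFs k : leb.-integrable setT (EFin \o (fun x => F (h_ k *: delta_mx 0 i + x))).
  apply/integrableP; split; first by apply/measurable_EFinP; exact: mFs.
  rewrite (eq_integral (fun x => `|F (x + h_ k *: delta_mx 0 i)|%:E)%E); last by move=> x _; rewrite /= addrC.
  rewrite (integral_rV_shift (h_ k *: delta_mx 0 i) (f := fun x => `|(F x)%:E|%E)).
    by have /integrableP[] := iF.
  by apply/measurable_EFinP; exact: measurableT_comp.
have iD k : leb.-integrable setT (EFin \o D k).
  apply: integrable_scale => //; apply: eq_integrable (integrableB measurableT (iFs k) iF) => //.
have Dk0 k : (\int[leb]_x (EFin \o D k) x = 0)%E.
  rewrite -[LHS]fineK; last by apply: integrable_fin_num.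
  congr EFin; rewrite -/(Rintegral leb setT (D k)) /D RintegralZl//; last first.
    by apply: eq_integrable (integrableB measurableT (iFs k) iF).
  rewrite RintegralB// (_ : \int[leb]_x F (h_ k *: delta_mx 0 i + x) = \int[leb]_x F x) ?subrr ?mulr0//.
  rewrite /Rintegral -(integral_rV_shift (h_ k *: delta_mx 0 i) (f := EFin \o F)).
    by apply: (congr1 fine); apply: eq_integral => x _ /=; rewrite addrC.
  exact/measurable_EFinP.
rewrite /Rintegral; suff -> : (\int[leb]_x (partial i F x)%:E = 0)%E by [].
apply: (cvg_unique _ h) => //; apply: cvg_near_cst; apply: nearW => k; exact: Dk0.
Unshelve. all: by end_near.
Qed.

Lemma smooth_on_continuous_partial F i : smooth_on setT F -> continuous (partial i F).
Proof. by move=> sF x; apply: differentiable_continuous; exact: (sF [:: i] x I). Qed.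

Lemma partial_eq0 (K : set 'rV[R]_n) F i x : closed K -> (forall y, ~ K y -> F y = 0) -> ~ K x ->
  partial i F x = 0.
Proof.
move=> cK FK nKx; rewrite /partial (@near_eq_derive _ _ _ F (cst 0)); last first.
  have : nbhs x (~` K) by apply: open_nbhs_nbhs; split => //; exact: closed_openC.
  by apply: filterS => y /FK.
exact: derive_cst.
Qed.

Lemma sqint_bounded L A F B : measurable A -> A `<=` rV_box L ->
  measurable_fun setT (F : 'rV[R]_n -> measurableTypeR R) -> (forall x, A x -> `|F x| <= B) ->
  sqint leb A F.
Proof.
move=> mA AL mF FB; have [_ iB] := sqint_cst B mA AL.
split; first exact: measurable_funS mF.
apply: (integrable_le_fun mA (v := fun=> B ^+ 2)) => //.
  by apply: measurable_funX; exact: measurable_funS mF.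
move=> x Ax; have B0 : 0 <= B := le_trans (normr_ge0 _) (FB x Ax).
by rewrite ger0_norm ?sqr_ge0// -[leLHS]real_normK ?num_real// lerXn2r ?nnegrE ?FB.
Qed.

(** Integration by parts: [F * f] vanishes outside the compact support of the test function, so the
    integral of its partial derivative is 0, whatever [F] does near the boundary of [A]. *)
Lemma sobolev_H1_smooth L A F : measurable A -> A `<=` rV_box L -> smooth_on setT F ->
  sobolev_H1 A F (fun i => partial i F).
Proof.
move=> mA AL sF.
have dF x : differentiable F x := sF [::] x I.
have cF : continuous F by move=> x; exact: differentiable_continuous.
have sq (k : 'rV[R]_n -> R) : continuous k -> sqint leb A k.
  move=> ck; have [B B0 hB] := continuous_box_bounded L ck.
  apply: (sqint_bounded (B := B) mA AL); first exact: continuous_rV_measurable.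
  by move=> x /AL; exact: hB.
split; first exact: sq.
move=> i; split; first by apply: sq; exact: smooth_on_continuous_partial.
move=> f [sf [K [cK KA fK]]].
have clK : closed K by apply: compact_closed => //; exact: Rhausdorff.
have df x : differentiable f x := sf [::] x I.
have cf : continuous f by move=> x; exact: differentiable_continuous.
have cpF : continuous (partial i F) := smooth_on_continuous_partial sF.
have cpf : continuous (partial i f) := smooth_on_continuous_partial sf.
have pf x : ~ K x -> partial i f x = 0 by move=> nK; exact: partial_eq0 clK fK nK.
have cP (k l : 'rV[R]_n -> R) : continuous k -> continuous l -> continuous (k * l).
  by move=> ck cl x; exact: cvgM (ck x) (cl x).
have ic (k : 'rV[R]_n -> R) : continuous k -> (forall x, ~ K x -> k x = 0) ->
    leb.-integrable setT (EFin \o k) /\ \int[leb]_(x in A) k x = \int[leb]_x k x.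
  move=> ck kK; have kL x : ~ rV_box L x -> k x = 0 by move=> nL; apply: kK => /KA /AL.
  have [B B0 hB] := continuous_box_bounded L ck; split.
    apply: (integrable_box_supported (C := B) (L := L)) => //; first exact: continuous_rV_measurable.
    by move=> x; have [/hB//|/kL ->] := pselect (rV_box L x); rewrite normr0 ltW.
  rewrite [LHS]Rintegral_mkcond; apply: eq_Rintegral => x _; rewrite patchE; case: ifPn => //.
  by rewrite notin_setE => nA; rewrite kK// => /KA.
have [|i1 e1] := ic (F * partial i f) (cP _ _ cF cpf).
  by move=> x nK; rewrite /GRing.mul/= pf// mulr0.
have [|i2 e2] := ic (partial i F * f) (cP _ _ cpF cf).
  by move=> x nK; rewrite /GRing.mul/= fK// mulr0.
have pM : partial i (F * f) = F * partial i f + partial i F * f.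
  apply/funext => x; rewrite /partial deriveM; [|exact: diff_derivable|exact: diff_derivable].
  by rewrite /GRing.scale/= [f x * _]mulrC.
have := @Rintegral_partial_eq0 L (F * f) i.
rewrite pM => h; apply/eqP; rewrite -addr_eq0; apply/eqP.
rewrite [X in X + _]e1 [X in _ + X]e2 -RintegralD//; apply: h.
- by move=> x; exact: differentiableM.
- by move=> x; exact: cvgD (cP _ _ cF cpf x) (cP _ _ cpF cf x).
- by move=> x nL; rewrite /GRing.mul/= fK ?mulr0// => /KA /AL.
Qed.

End divergence.

(** * L2 norms of scaled bumps and of their gradients *)

Section bump_norms.
Variables (R : realType) (n : nat).
Local Notation leb := (lebesgue_rV R n).
Local Notation mu := (@lebesgue_measure R).

Lemma measurable_bump m : measurable_fun setT (bump m : measurableTypeR R -> measurableTypeR R).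
Proof. by apply: continuous_measurable_fun; exact: continuous_bump. Qed.

Definition bump_energy (m : nat) : R := fine (\int[mu]_t (bump m t ^+ 2)%:E).

Let bump_energy_fin (m : nat) : (\int[mu]_t (bump m t ^+ 2)%:E)%E \is a fin_num.
Proof.
have [C C0 hC] := bump_bounded R m.
apply: integrable_fin_num => //.
apply: (@integrable_bounded_support R _ _ mu `[-1, 1]%classic (fun t => bump m t ^+ 2) (C ^+ 2)).
- exact: measurable_itv.
- exact: lebesgue_segment_lty.
- by apply: measurable_funX; exact: measurable_bump.
- by move=> t; rewrite ger0_norm ?sqr_ge0// -[leLHS]real_normK ?num_real// lerXn2r ?nnegrE ?(ltW C0)// hC.
- move=> t /= ht; rewrite bump_eq0 ?expr0n// leNgt; apply/negP => /ltW h.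
  by apply: ht; rewrite in_itv/= -ler_norml.
Qed.

Lemma bump_energyE m : (\int[mu]_t (bump m t ^+ 2)%:E = (bump_energy m)%:E)%E.
Proof. by rewrite fineK. Qed.

Lemma bump_energy_ge0 m : 0 <= bump_energy m.
Proof. by apply: fine_ge0; apply: integral_ge0 => t _; rewrite lee_fin sqr_ge0. Qed.

Lemma bump_energy0_gt0 : 0 < bump_energy 0.
Proof.
pose q : R := expR (-4) ^+ 2; have q0 : 0 < q by rewrite exprn_gt0 ?expR_gt0.
apply: (lt_le_trans q0); rewrite -lee_fin -bump_energyE.
pose J : set R := `[- 2^-1, 2^-1]%classic.
have mJ : measurable (J : set (measurableTypeR R)) by exact: measurable_itv.
have -> : q%:E = (q%:E * mu J)%E.
  suff -> : mu J = 1%:E by rewrite mule1.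
  rewrite /J lebesgue_measure_itv/= lte_fin ifT; first by rewrite -EFinB; congr EFin; field.
  by lra.
rewrite -[X in (_ * mu X)%E]setIT -integral_indic// -ge0_integralZl//; last 2 first.
- by apply/measurable_EFinP; exact: measurable_indic.
- by rewrite lee_fin ltW.
apply: ge0_le_integral => //.
- by move=> t _; rewrite -EFinM lee_fin mulr_ge0// ltW.
- apply/measurable_EFinP; apply: measurable_funM; first exact: measurable_cst.
  exact: measurable_indic.
- by apply/measurable_EFinP; apply: measurable_funX; exact: measurable_bump.
move=> t _; rewrite lee_fin indicE; have [/set_mem tJ|_] := boolP (t \in _); last by rewrite mulr0 sqr_ge0.
rewrite mulr1 lerXn2r ?nnegrE ?expR_ge0 ?bump0_ge0//; apply: bump0_lower_bound.
by move: tJ; rewrite /J /= in_itv/= -ler_norml.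
Qed.

Variables (a : R) (a0 : 0 < a).

Lemma bump_family_energy (b : 'I_n -> R) i m :
  (\int[mu]_t (bump_family a b i m t ^+ 2)%:E = (a ^+ (2 * m) / a * bump_energy m)%:E)%E.
Proof.
rewrite (_ : (fun t => _) = (fun t => (fun s => ((a ^+ m) ^+ 2 * bump m s ^+ 2)%:E) (a * t + b i))); last first.
  by apply/funext => t; rewrite /bump_family exprMn.
rewrite (@ge0_integral_affine R a (b i) (fun s => ((a ^+ m) ^+ 2 * bump m s ^+ 2)%:E))//; last 2 first.
- apply/measurable_EFinP; apply: measurable_funM; first exact: measurable_cst.
  by apply: measurable_funX; exact: measurable_bump.
- by move=> t; rewrite lee_fin mulr_ge0 ?sqr_ge0.
under eq_integral do rewrite EFinM.
rewrite ge0_integralZl//; last 3 first.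
- by apply/measurable_EFinP; apply: measurable_funX; exact: measurable_bump.
- by move=> t _; rewrite lee_fin sqr_ge0.
- by rewrite lee_fin sqr_ge0.
by rewrite bump_energyE -!EFinM; congr EFin; rewrite mulnC exprM; ring.
Qed.

Lemma ip_prod_bump L (A : set 'rV[R]_n) (b : 'I_n -> R) (m : 'I_n -> nat) : measurable A -> A `<=` rV_box L ->
  [set x : 'rV[R]_n | forall i, `|a * x 0 i + b i| <= 1] `<=` A ->
  ip leb A (prod_coord (bump_family a b) m) (prod_coord (bump_family a b) m) =
  \prod_i (a ^+ (2 * m i) / a * bump_energy (m i)).
Proof.
move=> mA AL bA; have sb := smooth_bump_family a b.
have cF : continuous (prod_coord (bump_family a b) m).
  by move=> x; apply: differentiable_continuous; exact: differentiable_prod_coord.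
have [B B0 hB] := continuous_box_bounded L cF.
have sF : sqint leb A (prod_coord (bump_family a b) m).
  apply: (sqint_bounded (B := B) mA AL); first exact: continuous_rV_measurable.
  by move=> x /AL; exact: hB.
apply: EFin_inj; rewrite -ip_EFin// integral_mkcond.
transitivity (\int[leb]_x (\prod_i (bump_family a b i (m i) (x 0 i)) ^+ 2)%:E)%E.
  apply: eq_integral => x _; rewrite patchE; case: ifPn => [_|]; first by rewrite /prod_coord prodrXl.
  rewrite notin_setE => nA; have /existsNP[i /negP] : ~ forall i, `|a * x 0 i + b i| <= 1 by move/bA.
  rewrite -ltNge => /ltW h; rewrite (bigD1 i)//= /bump_family bump_eq0// mulr0 expr0n mul0r.
  by [].
rewrite (integral_prod_coord (f := fun i t => bump_family a b i (m i) t ^+ 2)).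
- by rewrite -prodEFin; apply: eq_bigr => i _; rewrite bump_family_energy.
- move=> i; apply: measurable_funX; apply: measurable_funM; first exact: measurable_cst.
  apply: measurableT_comp; first exact: measurable_bump.
  by apply: measurable_funD; [apply: measurable_funM => //|]; exact: measurable_cst.
- by move=> i t; exact: sqr_ge0.
Qed.

Definition bump_mass : R := \prod_(i < n) (bump_energy 0 / a).

Lemma bump_mass_gt0 : 0 < bump_mass.
Proof. by apply: prodr_gt0 => i _; rewrite divr_gt0// bump_energy0_gt0. Qed.

(** The integral factorises over the coordinates. Differentiation changes a single factor, replacing
    [bump_energy 0] by [a ^+ 2 * bump_energy 1]. *)
Lemma ip_bump L (A : set 'rV[R]_n) (b : 'I_n -> R) : measurable A -> A `<=` rV_box L ->
  [set x : 'rV[R]_n | forall i, `|a * x 0 i + b i| <= 1] `<=` A ->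
  ip leb A (bump_rV a b) (bump_rV a b) = bump_mass /\
  forall i, ip leb A (partial i (bump_rV a b)) (partial i (bump_rV a b)) =
    bump_energy 1 / bump_energy 0 * a ^+ 2 * bump_mass.
Proof.
move=> mA AL bA; split.
  rewrite /bump_rV (ip_prod_bump _ mA AL bA); apply: eq_bigr => i _.
  by rewrite muln0 expr0 mul1r mulrC.
move=> i; rewrite /bump_rV partial_prod_coord; last exact: smooth_bump_family.
rewrite (ip_prod_bump _ mA AL bA) /bump_mass (bigD1 i)//= [in RHS](bigD1 i)//= mulrA; congr (_ * _).
  rewrite /incr eqxx add0n muln1; have e0 := bump_energy0_gt0.
  by field; rewrite !gt_eqF.
by apply: eq_bigr => j /negbTE ji; rewrite /incr ji addn0 muln0 expr0 mul1r mulrC.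
Qed.

(** In the rescaled coordinate the supports are intervals of length 2 whose centres are at least 2
    apart. *)
Lemma prod_bump_disjoint (b b' : 'I_n -> R) m m' x i : 2 <= `|b i - b' i| ->
  prod_coord (bump_family a b) m x * prod_coord (bump_family a b') m' x = 0.
Proof.
move=> h; have [h1|h1] := leP 1 `|a * x 0 i + b i|.
  by rewrite (prod_bump_eq0 _ h1) mul0r.
rewrite (@prod_bump_eq0 _ _ a b' m' x i) ?mulr0// leNgt; apply/negP => h2.
have : `|b i - b' i| < 2.
  rewrite (_ : b i - b' i = (a * x 0 i + b i) - (a * x 0 i + b' i)); last by ring.
  by apply: le_lt_trans (ler_normB _ _) _; lra.
by rewrite ltNge h.
Qed.

End bump_norms.

(** * Neumann eigenfunctions *)

Section eigenvectors.
Variables (R : realType) (V : lmodType R) (P : V -> Prop) (a b : V -> V -> R).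
Hypotheses (subP : subspace_pred P) (fa : psd_form P a) (fb : psd_form P b).

Lemma form_sqr_sum m (w : 'I_m -> V) (c : 'I_m -> R) (f : V -> V -> R) : psd_form P f ->
  (forall i, P (w i)) ->
  f (\sum_i c i *: w i) (\sum_i c i *: w i) = \sum_i \sum_j c i * c j * f (w i) (w j).
Proof.
move=> ff hw; have hcw i : P (c i *: w i) by exact: subspZ.
have hs : P (\sum_i c i *: w i) by apply: subsp_sum.
rewrite (form_suml subP ff)//; apply: eq_bigr => i _.
rewrite (form_sumr subP ff)//; apply: eq_bigr => j _.
by rewrite (formZl subP ff)// (formZr subP ff)// mulrA.
Qed.

Lemma form_sqr_orthogonal m (w : 'I_m -> V) (c : 'I_m -> R) (f : V -> V -> R) (s : R) : psd_form P f ->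
  (forall i, P (w i)) -> (forall i j, i != j -> f (w i) (w j) = 0) -> (forall i, f (w i) (w i) = s) ->
  f (\sum_i c i *: w i) (\sum_i c i *: w i) = s * \sum_i c i ^+ 2.
Proof.
move=> ff hw orth norm; rewrite form_sqr_sum// mulr_sumr; apply: eq_bigr => i _.
rewrite (bigD1 i)//= big1 ?addr0 ?norm; first by rewrite expr2 mulrC.
by move=> j ji; rewrite orth ?mulr0// eq_sym.
Qed.

(** The eigenvectors need not be orthonormal, but those of different eigenvalues are orthogonal.
    Hence [t * b - a] at the combination equals [b] at the combination with coefficients
    [sqrt (t - l i) * c i], which is nonnegative. *)
Lemma Rayleigh_eigenvectors m (l : 'I_m -> R) (w : 'I_m -> V) (t : R) (c : 'I_m -> R) :
  (forall i, P (w i)) -> (forall i, l i <= t) ->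
  (forall i v, P v -> a (w i) v = l i * b (w i) v) ->
  a (\sum_i c i *: w i) (\sum_i c i *: w i) <= t * b (\sum_i c i *: w i) (\sum_i c i *: w i).
Proof.
move=> hw lt eig.
have hcw (d : 'I_m -> R) i : P (d i *: w i) by exact: subspZ.
have hs (d : 'I_m -> R) : P (\sum_i d i *: w i) by apply: subsp_sum.
have orth i j : (l i - l j) * b (w i) (w j) = 0.
  rewrite mulrBl -eig// [b (w i) _](formC fb)// -eig//.
  by rewrite (formC fa)// subrr.
pose s i := Num.sqrt (t - l i).
have ss i j : s i * s j * b (w i) (w j) = (t - l i) * b (w i) (w j).
  have /eqP := orth i j; rewrite mulf_eq0 subr_eq0 => /orP[/eqP lij|/eqP ->]; last by rewrite !mulr0.
  by rewrite /s -lij -expr2 sqr_sqrtr// subr_ge0.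
have := form_ge0 fb (hs (fun i => s i * c i)).
rewrite (form_sqr_sum _ fb)// (form_sqr_sum _ fa)// (form_sqr_sum _ fb)// => h.
rewrite -subr_ge0 mulr_sumr -sumrB; apply: (le_trans h); rewrite le_eqVlt; apply/orP; left; apply/eqP.
apply: eq_bigr => i _; rewrite mulr_sumr -sumrB; apply: eq_bigr => j _.
rewrite eig// (_ : s i * c i * (s j * c j) * _ = c i * c j * (s i * s j * b (w i) (w j))); last by ring.
by rewrite ss; ring.
Qed.

Lemma orthonormal_coef m (w : nat -> V) (c : 'I_m -> R) (j : 'I_m) :
  (forall i, (i < m)%N -> P (w i)) ->
  (forall i i', (i < m)%N -> (i' < m)%N -> b (w i) (w i') = (i == i')%:R) ->
  b (\sum_(i < m) c i *: w i) (w j) = c j.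
Proof.
move=> hw orth; have hw' (i : 'I_m) : P (w i) by exact: hw.
have hc (i : 'I_m) : P (c i *: w i) by exact: subspZ.
rewrite (form_suml subP fb)// (bigD1 j)//= (formZl subP fb)// orth// eqxx mulr1.
rewrite big1 ?addr0// => i ij.
by rewrite (formZl subP fb)// orth// val_eqE (negbTE ij) mulr0.
Qed.

End eigenvectors.

(** * The Sobolev space with its mass and Dirichlet forms *)

Section sobolev_form.
Variables (R : realType) (n : nat) (A : set 'rV[R]_n) (L : R).
Local Notation leb := (lebesgue_rV R n).
Hypotheses (oA : open A) (AL : A `<=` rV_box L).
Hypothesis midA : forall x y, A x -> A y -> A (2^-1 *: (x + y)).
Implicit Types (u v : 'rV[R]_n -> R) (g h : 'I_n -> 'rV[R]_n -> R).

Let mA : measurable A := open_rV_measurable oA.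

(** A function is carried together with a weak gradient: the gradient is determined only almost
    everywhere, and as data it makes the Dirichlet form bilinear without any choice. *)
Definition sobolev_pair : lmodType R :=
  (('rV[R]_n -> R^o) * ('I_n -> 'rV[R]_n -> R^o))%type.

Implicit Types w : sobolev_pair.

Definition in_H1 w := sobolev_H1 A w.1 w.2.
Definition mass_form w w' : R := ip leb A w.1 w'.1.
Definition dirichlet_form w w' : R := \sum_i ip leb A (w.2 i) (w'.2 i).

Let subA := subspace_sqint leb mA.
Let formA := psd_ip leb mA.

Lemma in_H1_sqint w : in_H1 w -> sqint leb A w.1.
Proof. by case. Qed.

Lemma in_H1_sqint_grad w i : in_H1 w -> sqint leb A (w.2 i).
Proof. by case=> _ /(_ i)[]. Qed.

Lemma sqint_test f i : test_function A f -> sqint leb A f /\ sqint leb A (partial i f).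
Proof. by case=> sf _; have [h1 /(_ i)[h2 _]] := sobolev_H1_smooth mA AL sf. Qed.

Lemma subspace_H1 : subspace_pred in_H1.
Proof.
split.
  split=> [|i]; first exact: sqint0.
  split; first exact: sqint0.
  have z k : ip leb A (fun=> 0) k = 0.
    by rewrite /ip /Rintegral (eq_integral (fun=> 0%E)) ?integral0// => x _; rewrite mul0r.
  move=> f _; transitivity (ip leb A (fun=> 0) (partial i f)); first by [].
  by transitivity (- ip leb A (fun=> 0) f); [rewrite !z oppr0|].
move=> c x y hx hy; have [x1 x2] := hx; have [y1 y2] := hy.
have e1 : (c *: x + y).1 = (fun z => c * x.1 z + y.1 z) by [].
have e2 i : (c *: x + y).2 i = (fun z => c * x.2 i z + y.2 i z).
  by rewrite /=; apply/funext => z.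
rewrite /in_H1 /sobolev_H1 e1; split; first exact: (sqintZD mA c x1 y1).
move=> i; rewrite e2; have [sx wx] := x2 i; have [sy wy] := y2 i.
split; first exact: (sqintZD mA c sx sy).
move=> f tf; have [sf spf] := sqint_test i tf.
have i1 := ipZDl mA c x1 y1 spf; have i2 := ipZDl mA c sx sy sf.
rewrite /ip in i1 i2; rewrite i1 i2 wx// wy//; ring.
Qed.

Lemma psd_mass : psd_form in_H1 mass_form.
Proof.
split.
- by move=> x y hx hy; exact: ipC.
- move=> c x y z /in_H1_sqint hx /in_H1_sqint hy /in_H1_sqint hz; exact: (ipZDl mA c hx hy hz).
- by move=> x _; exact: ip_ge0.
Qed.

Lemma psd_dirichlet : psd_form in_H1 dirichlet_form.
Proof.
split.
- by move=> x y hx hy; apply: eq_bigr => i _; exact: ipC.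
- move=> c x y z hx hy hz; rewrite /dirichlet_form mulr_sumr -big_split/=; apply: eq_bigr => i _.
  exact: (ipZDl mA c (in_H1_sqint_grad i hx) (in_H1_sqint_grad i hy) (in_H1_sqint_grad i hz)).
- by move=> x _; apply: sumr_ge0 => i _; exact: ip_ge0.
Qed.

Lemma dirichlet_formE w w' : in_H1 w -> in_H1 w' ->
  \int[leb]_(x in A) (\sum_i w.2 i x * w'.2 i x) = dirichlet_form w w'.
Proof.
move=> hw hw'; rewrite /dirichlet_form.
have im i : leb.-integrable A (EFin \o (fun x => w.2 i x * w'.2 i x)).
  by apply: sqint_mul => //; exact: in_H1_sqint_grad.
elim: (index_enum _) => [|i r IH].
  rewrite big_nil (_ : (fun x => _) = fun=> 0); first by rewrite /Rintegral integral0.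
  by apply/funext => x; rewrite big_nil.
rewrite big_cons -IH -RintegralD//; last first.
  rewrite (_ : _ \o _ = (fun x => \sum_(j <- r) (w.2 j x * w'.2 j x)%:E)%E).
    by apply: integrable_sum => // j _; exact: im.
  by apply/funext => x /=; rewrite sumEFin.
by apply: eq_Rintegral => x _; rewrite big_cons.
Qed.

(** L2 completeness is applied to the function and to each gradient component; the weak gradient
    identity survives because it only pairs them with fixed square-integrable functions. *)
Lemma complete_H1 (x_ : nat -> sobolev_pair) : (forall k, in_H1 (x_ k)) ->
  (forall e : R, 0 < e -> exists N, forall m k, (N <= m)%N -> (N <= k)%N ->
    dirichlet_form (x_ m - x_ k) (x_ m - x_ k) + mass_form (x_ m - x_ k) (x_ m - x_ k) <= e) ->
  exists x, [/\ in_H1 x, dirichlet_form (x_ k - x) (x_ k - x) @[k --> \oo] --> (0 : R) &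
    mass_form (x_ k - x) (x_ k - x) @[k --> \oo] --> (0 : R)].
Proof.
move=> hx cauchy.
have dge (x : sobolev_pair) i : ip leb A (x.2 i) (x.2 i) <= dirichlet_form x x.
  by rewrite /dirichlet_form (bigD1 i)//= lerDl; apply: sumr_ge0 => j _; exact: ip_ge0.
have mge (x : sobolev_pair) : 0 <= mass_form x x by exact: ip_ge0.
have dge0 (x : sobolev_pair) : 0 <= dirichlet_form x x by apply: sumr_ge0 => j _; exact: ip_ge0.
have [|u [su cu]] := @sqint_complete _ _ R leb A mA (fun k => (x_ k).1) (fun k => in_H1_sqint (hx k)).
  move=> e e0; have [N hN] := cauchy e e0; exists N => m k Nm Nk.
  by apply: le_trans (hN m k Nm Nk); rewrite lerDr.
have /boolp.choice[g hg] : forall i, exists k0 : 'rV[R]_n -> R, sqint leb A k0 /\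
    ip leb A ((x_ k).2 i \- k0) ((x_ k).2 i \- k0) @[k --> \oo] --> (0 : R).
  move=> i; apply: (@sqint_complete _ _ R leb A mA (fun k => (x_ k).2 i) (fun k => in_H1_sqint_grad i (hx k))).
  move=> e e0; have [N hN] := cauchy e e0; exists N => m k Nm Nk.
  by apply: le_trans (hN m k Nm Nk); apply: le_trans (dge (x_ m - x_ k) i) _; rewrite lerDl.
exists (u, g); split.
- split=> // i; have [sg cg] := hg i; split => // f tf; have [sf spf] := sqint_test i tf.
  have c1 := cvg_form subA formA (fun k => in_H1_sqint (hx k)) su cu spf.
  have c2 := cvg_form subA formA (fun k => in_H1_sqint_grad i (hx k)) sg cg sf.
  have c3 : ip leb A (x_ k).1 (partial i f) @[k --> \oo] --> - ip leb A (g i) f.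
    rewrite (_ : (fun k => ip leb A (x_ k).1 (partial i f)) = fun k => - ip leb A ((x_ k).2 i) f).
      exact: cvgN.
    by apply/funext => k; have [_ /(_ i)[_ /(_ f tf)]] := hx k; rewrite /ip => ->.
  exact: (cvg_unique _ c1 c3).
- rewrite (_ : 0 = \sum_(i < n) 0); last by rewrite big1.
  by apply: cvg_sumr => i; have [] := hg i.
- exact: cu.
Qed.

Section pieces.
Variables (J : finType) (Q : J -> set 'rV[R]_n) (D : R).
Hypotheses (mQ : forall j, measurable (Q j)) (D0 : 0 < D).
Hypothesis midQ : forall j x y, Q j x -> Q j y -> Q j (2^-1 *: (x + y)).
Hypothesis diamQ : forall j x y, (A `&` Q j) x -> (A `&` Q j) y -> sqdist x y <= D ^+ 2.
Hypothesis coverQ : forall x, A x -> exists j, Q j x /\ forall j', Q j' x -> j' = j.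

Let K j := A `&` Q j.

Let mK j : measurable (K j).
Proof. exact: measurableI. Qed.

Let vol j := ip leb (K j) (fun=> 1) (fun=> 1).

Let KL j : K j `<=` rV_box L.
Proof. by move=> x [/AL]. Qed.

(** The square root of the volume makes this the inner product with a unit constant, so its square
    is bounded by the mass. On a null piece the convention [0^-1 = 0] makes it 0. *)
Definition piece_mean j u : R := (Num.sqrt (vol j))^-1 * ip leb (K j) u (fun=> 1).

Lemma sum_ip_pieces u : sqint leb A u -> ip leb A u u = \sum_j ip leb (K j) u u.
Proof.
move=> su; have [mu' iu] := su.
have iuj j : leb.-integrable A (EFin \o (fun x => u x * u x * \1_(Q j) x)).
  apply: (integrable_le_fun mA (v := fun x => u x ^+ 2)) => //.
    apply: measurable_funM; first exact: measurable_funM.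
    by apply: measurable_indic; exact: mQ.
  move=> x _; rewrite normrM -expr2 ger0_norm ?sqr_ge0// indicE.
  by case: (_ \in _); rewrite ?normr1 ?normr0 ?mulr1 ?mulr0 ?sqr_ge0.
have e j : ip leb (K j) u u = \int[leb]_(x in A) (u x * u x * \1_(Q j) x).
  rewrite /ip [LHS]Rintegral_mkcond [RHS]Rintegral_mkcond; apply: eq_Rintegral => x _.
  rewrite !patchE in_setI; case: (x \in A) => //=; rewrite indicE.
  by case: (x \in Q j); rewrite ?mulr1 ?mulr0.
have sumI (r : seq J) : leb.-integrable A (EFin \o (fun x => \sum_(j <- r) u x * u x * \1_(Q j) x)) /\
    \int[leb]_(x in A) (\sum_(j <- r) u x * u x * \1_(Q j) x) =
    \sum_(j <- r) \int[leb]_(x in A) (u x * u x * \1_(Q j) x).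
  elim: r => [|j r [IH1 IH2]].
    rewrite (_ : (fun x => _) = fun=> 0); last by apply/funext => z; rewrite big_nil.
    by split; [exact: integrable0|rewrite /Rintegral integral0 big_nil].
  rewrite (_ : (fun x => _) = (fun x => u x * u x * \1_(Q j) x) \+
      (fun x => \sum_(j <- r) u x * u x * \1_(Q j) x)); last first.
    by apply/funext => z; rewrite big_cons.
  by split; [apply: eq_integrable (integrableD mA (iuj j) IH1)|rewrite RintegralD// IH2 big_cons].
under eq_bigr do rewrite e.
have [_ <-] := sumI (index_enum J); apply: eq_Rintegral => x /set_mem Ax.
have [j [Qj uj]] := coverQ Ax.
rewrite (bigD1 j)//= indicE mem_set// mulr1 big1 ?addr0// => j' /eqP jj'.
by rewrite indicE memNset ?mulr0// => /uj.
Qed.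

Lemma poincare_pieces w : in_H1 w ->
  mass_form w w <= 2 * expR 1 * D ^+ 2 * dirichlet_form w w + \sum_j piece_mean j w.1 ^+ 2.
Proof.
move=> hw; have su := in_H1_sqint hw.
rewrite /mass_form (sum_ip_pieces su).
have -> : dirichlet_form w w = \sum_j \sum_i ip leb (K j) (w.2 i) (w.2 i).
  rewrite exchange_big/=; apply: eq_bigr => i _; apply: sum_ip_pieces; exact: in_H1_sqint_grad.
rewrite mulr_sumr -big_split/=; apply: ler_sum => j _.
have := poincare_convex_piece oA AL hw (mQ j) D0 midA (midQ (j := j)) (diamQ (j := j)).
rewrite /poincare_on -/(K j) -/(vol j).
have sK v : sqint leb A v -> sqint leb (K j) v.
  by move=> sv; apply: (sqint_subset mA (mK j)) => // x [].
have s1 := sqint_cst 1 (mK j) (@KL j).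
have v0 : 0 <= vol j by exact: ip_ge0.
have CS := ip_CS (mK j) (sK _ su) s1; rewrite -/(vol j) in CS.
rewrite /piece_mean -/(vol j) exprMn exprVn sqr_sqrtr//.
set U := ip leb (K j) w.1 w.1; set E := \sum_i _; set m := ip leb (K j) w.1 _ in CS *.
have E0 : 0 <= E by apply: sumr_ge0 => i _; exact: ip_ge0.
(* On a null piece [poincare_on] is void, but there the mass of [u] vanishes as well. *)
have [vz|vn] := eqVneq (vol j) 0.
  move=> _; rewrite vz invr0 mul0r addr0.
  suff -> : U = 0.
    by apply: mulr_ge0 => //; apply: mulr_ge0; [exact: mulr_ge0 (ler0n _ _) (expR_ge0 _)|exact: sqr_ge0].
  have ae1 := ip_eq0 (mK j) s1 vz.
  rewrite /U /ip /Rintegral (@ae_eq_integral _ _ _ leb (K j) (fun=> 0%E))//.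
  - by rewrite integral0.
  - apply/measurable_EFinP; have [m1 _] := sK _ su; exact: measurable_funM.
  - apply: filterS ae1 => x h /h /eqP; by rewrite oner_eq0.
have vp : 0 < vol j by rewrite lt_neqAle eq_sym vn.
move=> h; have {}h : 0 <= vol j * (2 * expR 1 * D ^+ 2 * E) - (vol j * U - m ^+ 2) by rewrite subr_ge0.
rewrite -subr_ge0.
rewrite (_ : _ - U = (vol j * (2 * expR 1 * D ^+ 2 * E) - (vol j * U - m ^+ 2)) / vol j).
  exact: divr_ge0.
by field; rewrite gt_eqF.
Qed.

Lemma piece_meanB j u v : sqint leb A u -> sqint leb A v ->
  piece_mean j (fun x => u x - v x) = piece_mean j u - piece_mean j v.
Proof.
have sK (k : 'rV[R]_n -> R) : sqint leb A k -> sqint leb (K j) k.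
  by move=> sv; apply: (sqint_subset mA (mK j)) => // x [].
move=> /sK su /sK sv; rewrite /piece_mean -mulrBr; congr (_ * _).
have := ipZDl (mK j) (-1) sv su (sqint_cst 1 (mK j) (@KL j)).
rewrite mulN1r addrC => <-; apply: eq_Rintegral => x _; ring.
Qed.

Lemma piece_mean_le j u : sqint leb A u -> piece_mean j u ^+ 2 <= 1 * ip leb A u u.
Proof.
move=> su; have suK : sqint leb (K j) u by apply: (sqint_subset mA (mK j)) => // x [].
have v0 : 0 <= vol j by exact: ip_ge0.
rewrite mul1r /piece_mean exprMn exprVn sqr_sqrtr//.
have CS := ip_CS (mK j) suK (sqint_cst 1 (mK j) (@KL j)); rewrite -/(vol j) in CS.
apply: (@le_trans _ _ (ip leb (K j) u u)); last first.
  by apply: ip_le_subset => // x [].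
have [->|vn] := eqVneq (vol j) 0; first by rewrite invr0 mul0r ip_ge0.
by rewrite mulrC ler_pdivrMr// lt_neqAle eq_sym vn.
Qed.

End pieces.

Lemma sobolev_pair_sum (I : Type) (r : seq I) (c : I -> R) (w : I -> sobolev_pair) x :
  (\sum_(i <- r) c i *: w i).1 x = \sum_(i <- r) c i * (w i).1 x.
Proof.
elim: r => [|i r IH]; first by rewrite !big_nil.
by rewrite !big_cons /= -IH.
Qed.

(** Stated for an arbitrary admissible family, so that it bounds every member of the set whose
    infimum is the eigenvalue. *)
Lemma eigenvalue_lower_bound (J : finType) (Q : J -> set 'rV[R]_n) (D t : R) m (l : 'I_m -> R) (u : 'I_m -> 'rV[R]_n -> R) :
  (forall j, measurable (Q j)) -> 0 < D ->
  (forall j x y, Q j x -> Q j y -> Q j (2^-1 *: (x + y))) ->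
  (forall j x y, (A `&` Q j) x -> (A `&` Q j) y -> sqdist x y <= D ^+ 2) ->
  (forall x, A x -> exists j, Q j x /\ forall j', Q j' x -> j' = j) ->
  (#|J| < m)%N ->
  (forall i, l i <= t /\ neumann_eigenspace A (l i) (u i)) -> ae_free A u ->
  1 <= 2 * expR 1 * D ^+ 2 * t.
Proof.
move=> mQ D0 midQ diamQ coverQ Jm hu fu.
have /boolp.choice[g hg] : forall i, exists k0, sobolev_H1 A (u i) k0 /\
    forall v h, sobolev_H1 A v h -> \int[leb]_(x in A) (\sum_j k0 j x * h j x) = l i * \int[leb]_(x in A) (u i x * v x).
  by move=> i; have [_] := hu i.
pose w i : sobolev_pair := (u i, g i).
have hw i : in_H1 (w i) by have [] := hg i.
have subP := subspace_H1; have fa := psd_dirichlet; have fb := psd_mass.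
have eig i (v : sobolev_pair) : in_H1 v -> dirichlet_form (w i) v = l i * mass_form (w i) v.
  by move=> hv; rewrite -dirichlet_formE//; have [_ /(_ v.1 v.2 hv)] := hg i.
pose B : 'M[R]_(m, #|J|) := \matrix_(i, j) piece_mean Q (enum_val j) (u i).
have [c c0 cB] := exists_kernel_rV B Jm.
pose W := \sum_i c 0 i *: w i.
have hcw i : in_H1 (c 0 i *: w i) by exact: subspZ.
have hW : in_H1 W by apply: subsp_sum.
have mean0 j : piece_mean Q j W.1 = 0.
  have /rowP/(_ (enum_rank j)) := cB; rewrite !mxE => <-.
  have mK : measurable (A `&` Q j) by exact: measurableI.
  have KL : A `&` Q j `<=` rV_box L by move=> x [/AL].
  have s1 := sqint_cst 1 mK KL.
  have sK k : sqint leb A k -> sqint leb (A `&` Q j) k.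
    by move=> sk; apply: (sqint_subset mA mK) => // x [].
  rewrite /piece_mean.
  have -> : ip leb (A `&` Q j) W.1 (fun=> 1) = \sum_i c 0 i * ip leb (A `&` Q j) (u i) (fun=> 1).
    rewrite (_ : W.1 = fun x => \sum_i c 0 i * u i x); last first.
      by apply/funext => x; rewrite /W sobolev_pair_sum.
    elim: (index_enum _) => [|i r IH].
      rewrite big_nil (_ : (fun x => _) = fun=> 0).
        by rewrite /ip /Rintegral (eq_integral (fun=> 0%E)) ?integral0// => x _; rewrite mul0r.
      by apply/funext => x; rewrite big_nil.
    rewrite big_cons -IH -ipZDl//; last 2 first.
    - exact: sK (in_H1_sqint (hw i)).
    - elim: r {IH} => [|i' r IH].
        by under eq_fun do rewrite big_nil; exact: sqint0.
      under eq_fun do rewrite big_cons.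
      have := sqintZD mK (c 0 i') (sK (u i') (in_H1_sqint (hw i'))) IH; exact.
    by apply: eq_Rintegral => x _; rewrite big_cons.
  rewrite mulr_sumr; apply: eq_bigr => i _.
  by rewrite mxE enum_rankK /piece_mean mulrCA.
have := poincare_pieces mQ D0 midQ diamQ coverQ hW.
rewrite [X in _ + X]big1 ?addr0; last by move=> j _; rewrite mean0 expr0n.
have aW := Rayleigh_eigenvectors subP fa fb (fun i => c 0 i) hw (fun i => (hu i).1) eig.
rewrite -/W in aW => h.
(* A combination of zero mass vanishes almost everywhere, which [ae_free] excludes for nonzero
   coefficients. *)
have bW : 0 < mass_form W W.
  rewrite lt_neqAle (form_ge0 fb hW) andbT eq_sym; apply/eqP => bW0.
  have := ip_eq0 mA (in_H1_sqint hW) bW0 => ae0.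
  have /fu c00 : {ae leb, forall x, A x -> \sum_i c 0 i * u i x = 0}.
    by apply: filterS ae0 => x hx Ax; have := hx Ax; rewrite /W sobolev_pair_sum.
  by move/eqP: c0; apply; apply/rowP => i; rewrite mxE c00.
have C0 : 0 <= 2 * expR 1 * D ^+ 2.
  by apply: mulr_ge0; [exact: mulr_ge0 (ler0n _ _) (expR_ge0 _)|exact: sqr_ge0].
rewrite -(ler_pM2r bW) mul1r; apply: (le_trans h); rewrite -[leRHS]mulrA.
exact: (ler_wpM2l C0 aW).
Qed.

(** Turns trial functions into the eigenfunctions that [neumann_eigenvalue] asks for; orthonormality
    in mass gives [ae_free]. *)
Lemma exists_neumann_family N (T : R) (e : 'I_N.+1 -> sobolev_pair)
    (coercive : forall e : R, 0 < e -> exists M (ell : 'I_M -> sobolev_pair -> R) C,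
      [/\ forall i x y, in_H1 x -> in_H1 y -> ell i (x - y) = ell i x - ell i y,
          forall i x, in_H1 x -> ell i x ^+ 2 <= C * mass_form x x &
          forall x, in_H1 x -> mass_form x x <= e * dirichlet_form x x + \sum_i ell i x ^+ 2]) :
  (forall i, in_H1 (e i)) ->
  (forall c : 'I_N.+1 -> R, dirichlet_form (\sum_i c i *: e i) (\sum_i c i *: e i) <=
     T * mass_form (\sum_i c i *: e i) (\sum_i c i *: e i)) ->
  (forall c : 'I_N.+1 -> R, mass_form (\sum_i c i *: e i) (\sum_i c i *: e i) = 0 -> forall i, c i = 0) ->
  exists (l : 'I_N.+1 -> R) (u : 'I_N.+1 -> 'rV[R]_n -> R),
    (forall i, l i <= T /\ neumann_eigenspace A (l i) (u i)) /\ ae_free A u.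
Proof.
move=> he hT hfree.
have subP := subspace_H1; have fa := psd_dirichlet; have fb := psd_mass.
have [l [w [[hw orth eig] lT]]] := exists_eigenfamily subP fa fb complete_H1 coercive he hT hfree.
exists (fun i => l i), (fun i => (w i).1); split.
  move=> i; split; first exact: lT.
  exists (w i).2; split; first exact: hw.
  move=> v h hv; have := eig i (v, h) (ltn_ord i) hv.
  by rewrite -dirichlet_formE//; exact: hw.
move=> c ae0 j.
have hc i : in_H1 (c i *: w i) by apply: subspZ => //; exact: hw.
have hW : in_H1 (\sum_(i < N.+1) c i *: w i) by apply: subsp_sum.
have : mass_form (\sum_(i < N.+1) c i *: w i) (w j) = 0.
  apply: (ae_ip0 mA _ (in_H1_sqint hW).1 (in_H1_sqint (hw j (ltn_ord j))).1).
  by apply: filterS ae0 => x h Ax; rewrite sobolev_pair_sum; exact: h.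
by rewrite (orthonormal_coef subP fb).
Qed.

End sobolev_form.

(** * Eigenvalue bounds *)

Section grid.
Variables (R : realType) (n : nat) (L : R) (p : nat).
Hypotheses (n0 : (0 < n)%N) (L0 : 0 < L) (p0 : (0 < p)%N).
Implicit Types x y : 'rV[R]_n.

Let h : R := 2 * L / p%:R.

Let pR0 : 0 < p%:R :> R. Proof. by rewrite ltr0n. Qed.

Let h0 : 0 < h. Proof. by rewrite divr_gt0// mulr_gt0. Qed.

(** Half-open cells, so that each point of the half-open cube lies in exactly one. *)
Definition grid_cell (j : {ffun 'I_n -> 'I_p}) : set 'rV[R]_n :=
  [set x | forall i, - L + h * (j i)%:R <= x 0 i < - L + h * (j i).+1%:R].

Lemma measurable_grid_cell j : measurable (grid_cell j).
Proof.
rewrite (_ : grid_cell j = [set x : 'rV[R]_n | forall i,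
    `[- L + h * (j i)%:R, - L + h * (j i).+1%:R[%classic (x 0 i)]).
  apply: (measurable_rV_box (A := fun i => `[- L + h * (j i)%:R, - L + h * (j i).+1%:R[%classic)).
  by move=> i; exact: measurable_itv.
by apply/seteqP; split => x /= hx i; have := hx i; rewrite in_itv.
Qed.

Lemma midpoint_grid_cell j x y : grid_cell j x -> grid_cell j y -> grid_cell j (2^-1 *: (x + y)).
Proof.
by move=> hx hy i; have /andP[x1 x2] := hx i; have /andP[y1 y2] := hy i; rewrite !mxE; apply/andP; split; lra.
Qed.

Definition grid_diam : R := Num.sqrt n%:R * h.

Lemma grid_diam_gt0 : 0 < grid_diam.
Proof. by rewrite mulr_gt0// sqrtr_gt0 ltr0n. Qed.

Lemma sqdist_grid_cell j x y : grid_cell j x -> grid_cell j y -> sqdist x y <= grid_diam ^+ 2.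
Proof.
move=> hx hy; rewrite exprMn sqr_sqrtr ?ler0n//.
rewrite (_ : n%:R * h ^+ 2 = \sum_(i < n) h ^+ 2); last by rewrite sumr_const card_ord mulr_natl.
apply: ler_sum => i _; have /andP[x1 x2] := hx i; have /andP[y1 y2] := hy i.
rewrite -[leLHS]real_normK ?num_real// lerXn2r ?nnegrE ?(ltW h0)//.
by move: x2 y2; rewrite -!natr1 !mulrDr mulr1 ler_norml => x2 y2; apply/andP; split; lra.
Qed.

Lemma grid_cell_cover x : (forall i, - L <= x 0 i < L) ->
  exists j, grid_cell j x /\ forall j', grid_cell j' x -> j' = j.
Proof.
move=> hx; pose f i := Num.truncn ((x 0 i + L) / h).
have f0 i : 0 <= (x 0 i + L) / h by have /andP[h1 _] := hx i; rewrite divr_ge0 ?(ltW h0)//; lra.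
have fp i : (f i < p)%N.
  rewrite /f truncn_lt_nat// ltr_pdivrMr// /h mulrC divfK ?gt_eqF//.
  by have /andP[_ h2] := hx i; lra.
exists [ffun i => Ordinal (fp i)]; split.
  move=> i; rewrite ffunE /=; have /andP[t1 t2] := truncn_itv (f0 i).
  move: t1 t2; rewrite -/(f i) ler_pdivlMr// ltr_pdivrMr// ![_ * h]mulrC => t1 t2.
  by apply/andP; split; lra.
move=> j' hj; apply/ffunP => i; rewrite ffunE; apply/val_inj => /=; symmetry; apply: truncn_def.
have /andP[t1 t2] := hj i.
by rewrite ler_pdivlMr// ltr_pdivrMr// ![_ * h]mulrC; apply/andP; split; lra.
Qed.

End grid.

(** * Two-sided control of the set whose infimum is the eigenvalue *)

Section domain_bounds.
Variables (R : realType) (n : nat) (A : set 'rV[R]_n) (L : R).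
Hypotheses (n0 : (0 < n)%N) (oA : open A) (L0 : 0 < L).
Hypothesis AL : forall x i, A x -> - L <= x 0 i < L.
Hypothesis midA : forall x y, A x -> A y -> A (2^-1 *: (x + y)).
Local Notation leb := (lebesgue_rV R n).

Let AL' : A `<=` rV_box L.
Proof. by move=> x /AL h i; have /andP[h1 h2] := h i; rewrite ler_norml h1 ltW. Qed.

Let mA : measurable A := open_rV_measurable oA.

(** The set inside [neumann_eigenvalue], named so that its members can be bounded one by one. *)
Definition neumann_set k := [set t : R | exists (l : 'I_k.+1 -> R) (u : 'I_k.+1 -> 'rV[R]_n -> R),
  (forall i, l i <= t /\ neumann_eigenspace A (l i) (u i)) /\ ae_free A u].

Lemma neumann_set_grid k p t : (0 < p)%N -> (p ^ n <= k)%N -> neumann_set k t ->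
  1 <= 2 * expR 1 * (n%:R * (2 * L / p%:R) ^+ 2) * t.
Proof.
move=> p0 pk [l [u [hl fu]]].
have <- : grid_diam n L p ^+ 2 = n%:R * (2 * L / p%:R) ^+ 2 by rewrite exprMn sqr_sqrtr ?ler0n.
apply: (eigenvalue_lower_bound oA AL' midA (@measurable_grid_cell R n L p)
  (grid_diam_gt0 n0 L0 p0) (@midpoint_grid_cell R n L p) _ _ _ hl fu).
- by move=> j x y [_ hx] [_ hy]; exact: sqdist_grid_cell hx hy.
- by move=> x Ax; apply: grid_cell_cover => // i; exact: AL.
- by rewrite card_ffun !card_ord ltnS.
Qed.

(** A single piece and the true diameter: for the unit ball this bound is independent of the
    dimension, unlike the grid bound. *)
Lemma neumann_set_diam k D t : 0 < D -> (forall x y, A x -> A y -> sqdist x y <= D ^+ 2) -> (0 < k)%N ->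
  neumann_set k t -> 1 <= 2 * expR 1 * D ^+ 2 * t.
Proof.
move=> D0 diam k0 [l [u [hl fu]]].
apply: (eigenvalue_lower_bound oA AL' midA (Q := fun _ : unit => setT) _ D0 _ _ _ _ hl fu) => //.
- by move=> _ x y [Ax _] [Ay _]; exact: diam.
- by move=> x _; exists tt; split => // -[].
- by rewrite card_unit ltnS.
Qed.

Lemma H1_coercive (e : R) : 0 < e -> exists M (ell : 'I_M -> sobolev_pair R n -> R) C,
  [/\ forall i x y, in_H1 A x -> in_H1 A y -> ell i (x - y) = ell i x - ell i y,
      forall i x, in_H1 A x -> ell i x ^+ 2 <= C * mass_form A x x &
      forall x, in_H1 A x -> mass_form A x x <= e * dirichlet_form A x x + \sum_i ell i x ^+ 2].
Proof.
move=> e0; pose C : R := 2 * expR 1 * (n%:R * (2 * L) ^+ 2).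
have C0 : 0 <= C.
  apply: mulr_ge0; first exact: mulr_ge0 (ler0n _ _) (expR_ge0 _).
  by apply: mulr_ge0 => //; exact: sqr_ge0.
(* [p] exceeds [C / e], and [C / p ^+ 2 <= C / p] since [p >= 1]. *)
pose p := (Num.truncn (C / e)).+1; have p0 : (0 < p)%N by [].
have pR0 : 0 < p%:R :> R by rewrite ltr0n.
have p1 : 1 <= p%:R :> R by rewrite ler1n.
have Cp : 2 * expR 1 * grid_diam n L p ^+ 2 <= e.
  rewrite /grid_diam exprMn sqr_sqrtr ?ler0n// expr_div_n.
  rewrite (_ : _ * _ = C / p%:R ^+ 2); last by rewrite /C; ring.
  rewrite ler_pdivrMr ?exprn_gt0//.
  apply: (@le_trans _ _ (e * p%:R)); last by rewrite ler_pM2l// expr2 ler_peMl// ltW.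
  by rewrite mulrC -ler_pdivrMr// ltW// truncnS_gt.
pose J := {ffun 'I_n -> 'I_p}; pose Q := @grid_cell R n L p.
exists #|J|, (fun i w => piece_mean A Q (enum_val i) w.1), 1.
have mQ := @measurable_grid_cell R n L p.
split.
- by move=> i x y hx hy; apply: (piece_meanB oA AL' mQ); exact: in_H1_sqint.
- by move=> i x hx; apply: (piece_mean_le oA AL' mQ); exact: in_H1_sqint.
- move=> x hx.
  have diamQ (j : J) y z : (A `&` Q j) y -> (A `&` Q j) z -> sqdist y z <= grid_diam n L p ^+ 2.
    by move=> [_ hy] [_ hz]; exact: sqdist_grid_cell hy hz.
  have coverQ y : A y -> exists j, Q j y /\ forall j', Q j' y -> j' = j.
    by move=> Ay; apply: grid_cell_cover => // i; exact: AL.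
  apply: le_trans (poincare_pieces oA AL' midA mQ (grid_diam_gt0 n0 L0 p0) (@midpoint_grid_cell R n L p) diamQ coverQ hx) _.
  apply: lerD; first by rewrite ler_wpM2r// (form_ge0 (psd_dirichlet oA) hx).
  rewrite le_eqVlt; apply/orP; left; apply/eqP.
  apply: (reindex (fun i : 'I_#|J| => enum_val i)); apply: onW_bij; exact: enum_val_bij.
Qed.

(** Disjoint supports make both forms diagonal on the bumps, so the trial space has a single
    Rayleigh quotient: [n] times the one-dimensional energy ratio over [s ^+ 2], where
    [1 / s ^+ 2 = 4 * n * q ^+ 2 / r ^+ 2]. *)
Lemma neumann_set_ball k q (c : 'rV[R]_n) (r : R) : 0 < r -> eball c r `<=` A -> (0 < q)%N -> (k < q ^ n)%N ->
  neumann_set k (4 * (bump_energy R 1 / bump_energy R 0) * (n%:R * q%:R) ^+ 2 / r ^+ 2).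
Proof.
move=> r0 cA q0 kq.
have nR0 : 0 < n%:R :> R by rewrite ltr0n.
have qR0 : 0 < q%:R :> R by rewrite ltr0n.
have sn0 : 0 < Num.sqrt n%:R :> R by rewrite sqrtr_gt0.
(* The cube of half-side [q * s = r / (2 * sqrt n)] around [c] has circumradius [r / 2], so it lies
   in the open ball; its [q ^ n] cells have half-side [s]. *)
pose s : R := r / (2 * Num.sqrt n%:R * q%:R).
have s0 : 0 < s by rewrite divr_gt0// !mulr_gt0.
pose J := {ffun 'I_n -> 'I_q}.
have kJ : (k.+1 <= #|J|)%N by rewrite card_ffun !card_ord.
pose j_ (m : 'I_k.+1) : J := enum_val (widen_ord kJ m).
have j_inj : injective j_.
  by move=> m m' /enum_val_inj/(congr1 val) /= mm; apply/val_inj.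
(* In coordinates centred at [c] and scaled by [1 / s], cell [j] is centred at [2 * j - q + 1]. *)
pose b_ (m : 'I_k.+1) i : R := - (s^-1 * c 0 i) - (2 * (j_ m i)%:R - q%:R + 1).
have a0 : 0 < s^-1 by rewrite invr_gt0.
have suppA m : [set x : 'rV[R]_n | forall i, `|s^-1 * x 0 i + b_ m i| <= 1] `<=` A.
  move=> x /= hx; apply: cA; rewrite /eball /enorm /=.
  have qs0 : 0 <= q%:R * s by rewrite mulr_ge0// ltW.
  have xi i : (x 0 i - c 0 i) ^+ 2 <= (q%:R * s) ^+ 2.
    rewrite -[leLHS]real_normK ?num_real// lerXn2r ?nnegrE//.
    have := hx i; rewrite (_ : s^-1 * x 0 i + b_ m i = s^-1 * (x 0 i - c 0 i) - (2 * (j_ m i)%:R - q%:R + 1)); last first.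
      by rewrite /b_; ring.
    have jq : (j_ m i)%:R + 1 <= q%:R :> R by rewrite natr1 ler_nat ltn_ord.
    have j0 : 0 <= (j_ m i)%:R :> R by rewrite ler0n.
    rewrite ler_distl => /andP[h1 h2].
    have : `|s^-1 * (x 0 i - c 0 i)| <= q%:R by rewrite ler_norml; apply/andP; split; lra.
    by rewrite normrM gtr0_norm// mulrC ler_pdivrMr.
  rewrite -[ltRHS](gtr0_norm r0) -sqrtr_sqr ltr_sqrt ?exprn_gt0//.
  apply: (@le_lt_trans _ _ (\sum_(i < n) (q%:R * s) ^+ 2)).
    by apply: ler_sum => i _; rewrite !mxE; exact: xi.
  rewrite sumr_const card_ord -[_ *+ n]mulr_natl (_ : n%:R * _ = r ^+ 2 / 4).
    by rewrite ltr_pdivrMr// ltr_pMr ?exprn_gt0// ltr1n.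
  rewrite -[X in X * _](@sqr_sqrtr _ n%:R) ?ler0n// /s.
  by field; rewrite !gt_eqF.
pose phi m := bump_rV s^-1 (b_ m).
pose e m : sobolev_pair R n := (phi m, fun i => partial i (phi m)).
have sphi m : smooth_on setT (phi m) by apply: smooth_on_prod_coord; exact: smooth_bump_family.
have he m : in_H1 A (e m) := sobolev_H1_smooth mA AL' (sphi m).
have norms m := ip_bump a0 mA AL' (@suppA m).
have disj m m' : m != m' -> exists i, 2 <= `|b_ m i - b_ m' i|.
  move=> mm'; have /eqP/ffunP : j_ m != j_ m' by rewrite (inj_eq j_inj).
  move=> /existsNP[i /eqP ji]; exists i.
  rewrite (_ : _ - _ = 2 * ((j_ m' i)%:R - (j_ m i)%:R)); last by rewrite /b_; ring.
  rewrite normrM ger0_norm// ler_peMr// distrC.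
  have := neq_ltn (j_ m i) (j_ m' i); rewrite (_ : (_ == _) = false); last exact/negbTE.
  move=> /esym/orP[lt|lt].
    by rewrite distrC -natrB ?(ltnW lt)// normr_nat ler1n subn_gt0.
  by rewrite -natrB ?(ltnW lt)// normr_nat ler1n subn_gt0.
have orth0 m m' mm mm' : m != m' ->
    ip leb A (prod_coord (bump_family s^-1 (b_ m)) mm) (prod_coord (bump_family s^-1 (b_ m')) mm') = 0.
  move=> /disj[i hi]; rewrite /ip /Rintegral (eq_integral (fun=> 0%E)) ?integral0// => x _.
  by rewrite (prod_bump_disjoint s^-1 mm mm' x hi).
have partialE m i : partial i (phi m) = prod_coord (bump_family s^-1 (b_ m)) (incr (fun=> 0%N) i).
  by rewrite /phi /bump_rV partial_prod_coord//; exact: smooth_bump_family.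
pose mu := bump_mass n s^-1.
pose T := 4 * (bump_energy R 1 / bump_energy R 0) * (n%:R * q%:R) ^+ 2 / r ^+ 2.
have subP := subspace_H1 oA AL'; have fa := psd_dirichlet oA; have fb := psd_mass oA.
have mu0 : 0 < mu by apply: bump_mass_gt0.
have massE c' : mass_form A (\sum_m c' m *: e m) (\sum_m c' m *: e m) = mu * \sum_m c' m ^+ 2.
  apply: (form_sqr_orthogonal subP c' fb he).
    by move=> m m' mm'; exact: orth0.
  by move=> m; exact: (norms m).1.
have dirE c' : dirichlet_form A (\sum_m c' m *: e m) (\sum_m c' m *: e m) = (T * mu) * \sum_m c' m ^+ 2.
  apply: (form_sqr_orthogonal subP c' fa he).
    move=> m m' mm'; rewrite /dirichlet_form big1// => i _ /=.
    by rewrite !partialE; exact: orth0.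
  move=> m; rewrite /dirichlet_form /= (eq_bigr (fun=> bump_energy R 1 / bump_energy R 0 * s^-1 ^+ 2 * mu)).
    rewrite sumr_const card_ord -[_ *+ n]mulr_natl /T.
    have -> : s^-1 ^+ 2 = 4 * n%:R * q%:R ^+ 2 / r ^+ 2.
      rewrite -[X in 4 * X](@sqr_sqrtr _ n%:R) ?ler0n// /s.
      by field; rewrite !gt_eqF.
    by ring.
  by move=> i _; exact: (norms m).2.
apply: (exists_neumann_family oA AL' (e := e) H1_coercive he) => c'.
- by rewrite massE dirE mulrA.
- move=> /eqP; rewrite massE mulf_eq0 gt_eqF//= => /eqP h m.
  have /eqP := h; rewrite psumr_eq0; last by move=> i _; rewrite sqr_ge0.
  by move=> /allP/(_ m (mem_index_enum _)); rewrite sqrf_eq0 => /eqP.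
Qed.

End domain_bounds.

(** * Geometry of the unit ball and of bounded convex sets *)

Section unit_ball.
Variables (R : realType) (n : nat).
Implicit Types x y c : 'rV[R]_n.

Lemma eball_sqdist c (r : R) x : 0 < r -> eball c r x <-> sqdist x c < r ^+ 2.
Proof.
move=> r0; rewrite /eball /enorm /=.
rewrite (_ : \sum_i _ = sqdist x c); last by apply: eq_bigr => i _; rewrite !mxE.
by rewrite -[ltRHS](gtr0_norm r0) -sqrtr_sqr ltr_sqrt ?exprn_gt0.
Qed.

Lemma unit_ballP x : eball 0 1 x <-> sqdist x 0 < 1.
Proof. by have := eball_sqdist 0 x ltr01; rewrite expr1n. Qed.

Lemma unit_ball_coord x i : eball 0 1 x -> -1 <= x 0 i < 1.
Proof.
move/unit_ballP => h.
have : x 0 i ^+ 2 < 1.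
  apply: le_lt_trans h; rewrite /sqdist (bigD1 i)//= mxE subr0 lerDl.
  by apply: sumr_ge0 => j _; rewrite sqr_ge0.
by move=> h2; apply/andP; split; nra.
Qed.

Lemma open_unit_ball : open (eball (0 : 'rV[R]_n) 1).
Proof.
have c : continuous (fun x : 'rV[R]_n => sqdist x 0).
  rewrite /sqdist; elim: (index_enum _) => [|i r IH] x.
    rewrite (_ : (fun x => _) = cst 0); first exact: cst_continuous.
    by apply/funext => y; rewrite big_nil.
  rewrite (_ : (fun x => _) = fun x => (x 0 i - (0 : 'rV[R]_n) 0 i) * (x 0 i - (0 : 'rV[R]_n) 0 i) +
      \sum_(j <- r) (x 0 j - (0 : 'rV[R]_n) 0 j) ^+ 2); last first.
    by apply/funext => y; rewrite big_cons expr2.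
  have ci : continuous (fun y : 'rV[R]_n => y 0 i - (0 : 'rV[R]_n) 0 i).
    apply: (@lipschitz_continuous _ _ _ 1) => y z.
    by rewrite mul1r opprB addrA subrK; exact: l1dist_coord.
  exact: cvgD (cvgM (ci x) (ci x)) (IH x).
rewrite (_ : eball 0 1 = (fun x : 'rV[R]_n => sqdist x 0) @^-1` [set t | t < 1]).
  by apply: open_comp => [x _|]; [exact: c|exact: open_lt].
by apply/seteqP; split => x; [move/unit_ballP|move=> h; apply/unit_ballP].
Qed.

Lemma midpoint_unit_ball x y : eball 0 1 x -> eball 0 1 y -> eball 0 1 (2^-1 *: (x + y)).
Proof.
move=> /unit_ballP hx /unit_ballP hy; apply/unit_ballP.
have := sqdist_parallelogram x y 0; have := sqdist_ge0 x y.
by move=> h1 h2; lra.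
Qed.

Lemma sqdist_unit_ball x y : eball 0 1 x -> eball 0 1 y -> sqdist x y <= 2 ^+ 2.
Proof.
move=> /unit_ballP hx /unit_ballP hy.
have := sqdist_parallelogram x y 0; have := sqdist_ge0 (2^-1 *: (x + y)) 0.
by move=> h1 h2; rewrite expr2; lra.
Qed.

Lemma convex_midpoint (A : set 'rV[R]_n) : @convex_set R 'rV[R]_n A ->
  forall x y, A x -> A y -> A (2^-1 *: (x + y)).
Proof.
move=> cA x y Ax Ay.
have h0 : 0 <= 2^-1 :> R by lra.
have h1 : 2^-1 <= 1 :> R by lra.
have := cA x y (Itv01 h0 h1) (mem_set Ax) (mem_set Ay) => /set_mem.
congr A; rewrite /conv /= scalerDr; congr (_ + _ *: _); rewrite /unstable.onem; lra.
Qed.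

Lemma bounded_rV_box (A : set 'rV[R]_n) : bounded_set A -> exists2 L : R, 0 < L &
  forall x i, A x -> - L <= x 0 i < L.
Proof.
move=> [M [_ hM]]; pose L := `|M| + 2; have L0 : 0 < L by rewrite ltr_wpDl.
exists L => // x i Ax.
have xL : `|x| < L.
  apply: (@le_lt_trans _ _ (`|M| + 1)); last by rewrite ltrD2l ltr1n.
  by apply: (hM (`|M| + 1)) => //; rewrite (le_lt_trans (ler_norm M))// ltrDl.
have : ball (0 : 'rV[R]_n) L x by rewrite -ball_normE /= sub0r normrN.
move/(rV_ballE _ _ L0) => /(_ i); rewrite mxE sub0r normrN ltr_norml => /andP[h1 h2].
by rewrite (ltW h1) h2.
Qed.

End unit_ball.

Section eigenvalue_bounds.
Variables (R : realType) (n : nat) (A : set 'rV[R]_n).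
Implicit Types (k : nat) (t : R).

(** [inf] has a default value on empty or unbounded sets, so a lower bound comes with a member of
    the set, and an upper bound with a lower bound for the set. *)
Lemma neumann_eigenvalue_ge k b : (neumann_set A k) !=set0 ->
  (forall t, neumann_set A k t -> b <= t) -> b <= neumann_eigenvalue A k.
Proof. by move=> ne h; apply: lb_le_inf => // t /h. Qed.

Lemma neumann_eigenvalue_le k b t : (forall t, neumann_set A k t -> b <= t) ->
  neumann_set A k t -> neumann_eigenvalue A k <= t.
Proof. by move=> h ht; apply: ge_inf => //; exists b => t' /h. Qed.

End eigenvalue_bounds.

(** From [ln x >= 1 - 1 / x], which is [ln (1 + y) <= y] at [y = 1 / x - 1]. *)
Lemma ln_ge_half (R : realType) (x : R) : 2 <= x -> 2^-1 <= ln x.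
Proof.
move=> x2; have x0 : 0 < x by apply: lt_le_trans x2.
have := @le_ln1Dx R (x^-1 - 1); rewrite addrCA subrr addr0 lnV ?posrE//.
have xi : 0 < x^-1 by rewrite invr_gt0.
have : x^-1 <= 2^-1 by rewrite lef_pV2 ?posrE.
by move=> h1 /(_ _)/wrap[|h2]; lra.
Qed.

(* [q ^ n] cells are just enough to hold [k + 1] bumps, so that a grid with [(q - 2) ^ n]
   cells has fewer than [k] pieces, and [log k >= n log (q - 1)]. *)
Lemma minimal_grid (R : realType) n k : (0 < n)%N -> (2 <= k)%N -> exists q, [/\ (2 <= q)%N, (k < q ^ n)%N &
  (4 <= q)%N -> ((q - 2) ^ n <= k.-1)%N /\ n%:R <= 2 * ln (k%:R : R)].
Proof.
move=> n0 k2.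
have ex : exists q, (k < q ^ n)%N.
  exists k.+1; apply: (@leq_trans k.+1) => //; rewrite -[X in (X <= _)%N]expn1.
  by rewrite leq_pexp2l.
case: (ex_minnP ex) => q kq minq; exists q.
have q2 : (2 <= q)%N.
  case: q kq {minq} => [|[|q]]//; first by rewrite exp0n.
  by rewrite exp1n => h; move: (leq_trans k2 (ltnW h)); rewrite ltnn.
split => // q4.
have q1k : ((q - 1) ^ n <= k)%N.
  rewrite leqNgt; apply/negP => /minq; rewrite leqNgt ltn_subrL /=.
  by rewrite (leq_trans _ q2).
split.
  have h : ((q - 2) ^ n < (q - 1) ^ n)%N.
    rewrite ltn_exp2r// ltn_sub2l//; exact: leq_trans q4.
  by rewrite -ltnS prednK ?(ltnW k2)//; exact: leq_trans h q1k.
have k0 : 0 < k%:R :> R by rewrite ltr0n (leq_trans _ k2).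
have q12 : 2 <= (q - 1)%:R :> R by rewrite ler_nat leq_subRL ?(leq_trans _ q4)//.
have q10 : 0 < (q - 1)%:R :> R by apply: lt_le_trans q12.
have h : ln ((q - 1)%:R ^+ n) <= ln (k%:R : R).
  by rewrite ler_ln ?posrE ?exprn_gt0// -natrX ler_nat.
rewrite lnXn// -[_ *+ n]mulr_natl in h.
(* Since [q - 1 >= 2], its logarithm is at least 1/2, while [n * ln (q - 1) <= ln k]. *)
have := ln_ge_half q12 => h2; have n0' : 0 <= n%:R :> R by rewrite ler0n.
nra.
Qed.

Lemma sub_ball_eball (R : realType) n (x : 'rV[R]_n) (e : R) : 0 < e -> eball x e `<=` ball x e.
Proof.
move=> e0 y /(eball_sqdist _ _ e0) h; apply/(rV_ballE _ _ e0) => i; rewrite distrC.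
rewrite -(@ltr_pXn2r _ 2) ?nnegrE ?(ltW e0)// real_normK ?num_real//.
apply: le_lt_trans h; rewrite /sqdist (bigD1 i)//= lerDl.
by apply: sumr_ge0 => j _; rewrite sqr_ge0.
Qed.

(** * Comparison of the two bounds *)

Section inradius.
Variables (R : realType) (n : nat).
Hypothesis n0 : (0 < n)%N.
Let B : set 'rV[R]_n := eball 0 1.
Let C : R := 2 * expR 1.
Let M : R := bump_energy R 1 / bump_energy R 0.

Let C0 : 0 < C. Proof. by rewrite mulr_gt0// expR_gt0. Qed.

Let M0 : 0 <= M. Proof. by rewrite divr_ge0 ?bump_energy_ge0. Qed.

Let coordB x i : B x -> -1 <= x 0 i < 1. Proof. exact: unit_ball_coord. Qed.

(** The infimum defining the ball's eigenvalue is over a nonempty set: a grid with [k.+2] cells per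
    side carries enough bumps inside the ball itself. *)
Lemma unit_ball_neumann_set k : exists t, neumann_set B k t.
Proof.
have kq : (k < k.+2 ^ n)%N.
  by apply: (@leq_trans (k.+2 ^ 1)); [rewrite expn1 ltnW|rewrite leq_pexp2l].
by eexists; apply: (neumann_set_ball n0 (@open_unit_ball R n) ltr01 coordB (@midpoint_unit_ball R n)
  (c := 0) ltr01 _ _ kq).
Qed.

Lemma unit_ball_eigenvalue_ge k : (0 < k)%N -> 1 <= C * 4 * neumann_eigenvalue B k.
Proof.
move=> k0; rewrite -ler_pdivrMl ?mulr_gt0// mulr1.
apply: neumann_eigenvalue_ge => [|t ht]; first exact: unit_ball_neumann_set.
rewrite -[leLHS]mulr1 ler_pdivrMl ?mulr_gt0//.
have := neumann_set_diam (@open_unit_ball R n) coordB (@midpoint_unit_ball R n) (D := 2) _ (@sqdist_unit_ball R n) k0 ht.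
by rewrite -natrX; apply.
Qed.

Lemma unit_ball_eigenvalue_grid k p : (0 < p)%N -> (p ^ n <= k)%N ->
  p%:R ^+ 2 <= 4 * C * n%:R * neumann_eigenvalue B k.
Proof.
move=> p0 pk; have pR0 : 0 < p%:R :> R by rewrite ltr0n.
have nR0 : 0 < n%:R :> R by rewrite ltr0n.
rewrite -ler_pdivrMl ?mulr_gt0//.
apply: neumann_eigenvalue_ge => [|t ht]; first exact: unit_ball_neumann_set.
rewrite ler_pdivrMl ?mulr_gt0//.
have := neumann_set_grid n0 (@open_unit_ball R n) ltr01 coordB (@midpoint_unit_ball R n) p0 pk ht.
rewrite -/C mulr1 expr_div_n => h.
rewrite (_ : 4 * C * n%:R * t = p%:R ^+ 2 * (C * (n%:R * (2 ^+ 2 / p%:R ^+ 2)) * t)).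
  by rewrite ler_peMr// exprn_ge0// ltW.
by field; rewrite gt_eqF.
Qed.

(** For [q >= 4], [q <= 2 * (q - 2)] and the dimension factor of the grid bound is paid by
    [n <= 2 * ln k]. For [q <= 3] the diameter bound gives [1 <= 2 * (g * s)], and with
    [ln k >= 1/2] the constant is 3 times 2 times 2, that is 12. *)
Lemma grid_size_le k : (2 <= k)%N -> exists q, [/\ (0 < q)%N, (k < q ^ n)%N &
  q%:R <= 12 * Num.sqrt C * (ln k%:R * Num.sqrt (neumann_eigenvalue B k.-1))].
Proof.
move=> k2; have [q [q2 kq hq]] := minimal_grid R n0 k2.
exists q; split => //; first exact: ltnW.
set lam := neumann_eigenvalue B k.-1; set g := Num.sqrt C; set s := Num.sqrt lam.
have k10 : (0 < k.-1)%N by rewrite -ltnS prednK// ltnW.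
have lam1 : 1 <= C * 4 * lam := unit_ball_eigenvalue_ge k10.
have lam0 : 0 < lam by rewrite -(pmulr_rgt0 _ (mulr_gt0 C0 (ltr0Sn R 3))) (lt_le_trans ltr01).
have g0 : 0 < g by rewrite sqrtr_gt0.
have s0 : 0 < s by rewrite sqrtr_gt0.
have gs : g ^+ 2 = C by rewrite sqr_sqrtr// ltW.
have ss : s ^+ 2 = lam by rewrite sqr_sqrtr// ltW.
have nR1 : 1 <= n%:R :> R by rewrite ler1n.
have lk : 2^-1 <= ln (k%:R : R) by apply: ln_ge_half; rewrite ler_nat.
have [q4|q3] := leqP 4 q.
  have [pk nk] := hq q4.
  have p0 : (0 < q - 2)%N by rewrite subn_gt0 (leq_trans _ q4).
  have h := unit_ball_eigenvalue_grid p0 pk; rewrite -/lam -gs -ss in h.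
  have pg : (q - 2)%:R <= 2 * g * n%:R * s.
    rewrite -(@ler_pXn2r _ 2) ?nnegrE ?mulr_ge0 ?(ltW g0) ?(ltW s0)//.
    apply: (le_trans h); rewrite (_ : (2 * g * n%:R * s) ^+ 2 = 4 * g ^+ 2 * n%:R * s ^+ 2 * n%:R); last by ring.
    by apply: ler_peMr => //; exact: le_trans (sqr_ge0 _) h.
  rewrite natrB// in pg.
  have q4R : 4 <= q%:R :> R by rewrite ler_nat.
  have gs0 : 0 < g * s by rewrite mulr_gt0.
  have : n%:R * (g * s) <= 2 * ln k%:R * (g * s) by rewrite ler_pM2r.
  by move: pg; set x := ln _; set N := n%:R; lra.
have q3R : q%:R <= 3 :> R by rewrite ler_nat.
have gs1 : 1 <= 2 * (g * s).
  rewrite -(@ler_pXn2r _ 2) ?nnegrE ?mulr_ge0 ?(ltW g0) ?(ltW s0)// expr1n.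
  by rewrite !exprMn gs ss; move: lam1; rewrite expr2; lra.
have gs0 : 0 < g * s by rewrite mulr_gt0.
have : 2^-1 * (g * s) <= ln k%:R * (g * s) by rewrite ler_pM2r.
by set x := ln _; lra.
Qed.

(** The bumps in the ball give [r] at most [2 * sqrt M * n * q] over the root of the eigenvalue, and
    [grid_size_le] bounds [q]; hence 24 as 2 times 12. *)
Lemma ball_radius_le (A : set 'rV[R]_n) c (r : R) k : open A -> bounded_set A ->
  (forall x y, A x -> A y -> A (2^-1 *: (x + y))) -> (2 <= k)%N -> 0 < r -> eball c r `<=` A ->
  r <= 24 * Num.sqrt M * Num.sqrt C *
    ((n%:R * ln k%:R * Num.sqrt (neumann_eigenvalue B k.-1)) / Num.sqrt (neumann_eigenvalue A k)).
Proof.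
move=> oA bA midA k2 r0 cA; have [L L0 AL] := bounded_rV_box bA.
have [q [q0 kq hq]] := grid_size_le k2.
have nR0 : 0 < n%:R :> R by rewrite ltr0n.
have ht := neumann_set_ball n0 oA L0 AL midA r0 cA q0 kq.
(* The grid with one cell bounds the set below by a positive number, so the eigenvalue is positive
   and its root can be divided by. *)
have lb t : neumann_set A k t -> (C * (n%:R * (2 * L / 1%:R) ^+ 2))^-1 <= t.
  move=> tk; have := neumann_set_grid n0 oA L0 AL midA (p := 1) isT _ tk.
  rewrite exp1n -/C => /(_ (ltnW k2)) h.
  have D0 : 0 < C * (n%:R * (2 * L / 1%:R) ^+ 2).
    by rewrite !mulr_gt0// exprn_gt0// divr_gt0// mulr_gt0.
  by rewrite -[leLHS]mulr1 ler_pdivrMl.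
have lam0 : 0 < neumann_eigenvalue A k.
  apply: (@lt_le_trans _ _ (C * (n%:R * (2 * L / 1%:R) ^+ 2))^-1).
    by rewrite invr_gt0 !mulr_gt0// exprn_gt0// divr_gt0// mulr_gt0.
  by apply: neumann_eigenvalue_ge => //; eexists; exact: ht.
have := neumann_eigenvalue_le lb ht; rewrite -/M => lamT.
rewrite mulrA ler_pdivlMr ?sqrtr_gt0//.
apply: (@le_trans _ _ (2 * Num.sqrt M * (n%:R * q%:R))).
  rewrite -ler_pdivlMl// -(@ler_pXn2r _ 2) ?nnegrE ?sqrtr_ge0//; last first.
    by rewrite !mulr_ge0 ?sqrtr_ge0 ?invr_ge0 ?(ltW r0).
  rewrite sqr_sqrtr ?(ltW lam0)//; apply: (le_trans lamT).
  rewrite -[X in 4 * X](@sqr_sqrtr _ M)// le_eqVlt; apply/orP; left; apply/eqP.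
  by field; rewrite gt_eqF.
have sM : 0 <= 2 * Num.sqrt M * n%:R by rewrite !mulr_ge0 ?sqrtr_ge0.
rewrite mulrA; apply: le_trans (ler_wpM2l sM hq) _.
by rewrite le_eqVlt; apply/orP; left; apply/eqP; ring.
Qed.

End inradius.

Theorem corollary1p4 (R : realType) :
  exists c : R, 0 < c /\
    forall n : nat, (1 <= n)%N ->
    forall Omega : set 'rV[R]_n,
      domain Omega -> bounded_set Omega -> @convex_set R 'rV[R]_n Omega ->
      piecewise_smooth_boundary Omega ->
    forall k : nat, (2 <= k)%N ->
      inrad Omega <=
        c * ((n%:R * ln k%:R * Num.sqrt (neumann_eigenvalue (eball 0 1 : set 'rV[R]_n) k.-1))
             / Num.sqrt (neumann_eigenvalue Omega k)).
Proof.
(* The [+ 1] makes the constant visibly positive, from nonnegativity of the square roots alone. *)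
exists (24 * Num.sqrt (bump_energy R 1 / bump_energy R 0) * Num.sqrt (2 * expR 1) + 1); split.
  by rewrite ltr_wpDl// !mulr_ge0 ?sqrtr_ge0.
move=> n n1 Omega [oO _ [x Ox]] bO cO _ k k2.
have midO := convex_midpoint cO.
have F0 : 0 <= (n%:R * ln k%:R * Num.sqrt (neumann_eigenvalue (eball 0 1 : set 'rV[R]_n) k.-1))
    / Num.sqrt (neumann_eigenvalue Omega k).
  by rewrite divr_ge0 ?sqrtr_ge0// !mulr_ge0 ?sqrtr_ge0// ln_ge0// ler1n ltnW.
(* The supremum is bounded through its members only when the set of radii is nonempty; openness
   supplies a ball around a point of [Omega]. *)
apply: ge_sup => [|r [r0 [c cO']]].
  have /nbhs_ballP[e /= e0 he] : nbhs x Omega by apply: open_nbhs_nbhs.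
  by exists e; split => //; exists x; apply: subset_trans he; exact: sub_ball_eball.
apply: le_trans (ball_radius_le n1 oO bO midO k2 r0 cO') _.
by rewrite ler_wpM2r// lerDl.
Qed.
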